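(* Let $c>0$, $n=\lfloor cN^2\rfloor$, and let $\rho_N$ be the probability measure on $\mathbb{GT}_N$ whose Schur generating function is $\frac{(x_1+\dots+x_N)^n}{N^n}$ (the decomposition measure of the representation of $U(N)$ on $(\mathbb C^N)^{\otimes n}$). Let $p_k^{(N)}=\sum_{i=1}^N(\lambda_i+N-i)^k$ with $\lambda\sim\rho_N$. Then $\{N^{-k}(p_k^{(N)}-\mathbf Ep_k^{(N)})\}_{k\ge1}$ converges in the sense of moments to a centered Gaussian vector with covariance $$\lim_{N\to\infty}\frac{\mathrm{cov}(p_{k_1}^{(N)},p_{k_2}^{(N)})}{N^{k_1+k_2}}=\frac1{(2\pi\mathbf i)^2}\oint_{|z|=\epsilon}\oint_{|w|=2\epsilon}\Big(\frac1z+1+c+cz\Big)^{k_1}\Big(\frac1w+1+c+cw\Big)^{k_2}\Big(-c+\frac1{(z-w)^2}\Big)dz\,dw,$$ counter-clockwise contours, $\epsilon>0$ small.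
   Context: Signatures $\lambda=(\lambda_1\ge\dots\ge\lambda_N)\in\mathbb Z^N$ form $\mathbb{GT}_N$; the Schur generating function of a probability measure $\rho$ on $\mathbb{GT}_N$ is $\sum_\lambda\rho(\lambda)s_\lambda(x_1,\dots,x_N)/s_\lambda(1^N)$, with $s_\lambda$ the Schur function. *)

(* Defs.v *)
From Stdlib Require Import Reals ZArith List.
Import ListNotations.
Open Scope R_scope.

Definition sum_list (l : list R) : R := fold_right Rplus 0 l.
Definition prod_list (l : list R) : R := fold_right Rmult 1 l.

Fixpoint nonincreasing (l : list Z) : Prop :=
  match l with
  | a :: ((b :: _) as t) => (b <= a)%Z /\ nonincreasing t
  | _ => True
  end.

Definition is_signature (N : nat) (l : list Z) : Prop :=
  length l = N /\ nonincreasing l.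

Definition Zrange (b a : Z) : list Z :=
  map (fun i => (b + Z.of_nat i)%Z) (seq 0 (Z.to_nat (a - b + 1))).

Fixpoint interl (l : list Z) : list (list Z) :=
  match l with
  | [] => [[]]
  | [_] => [[]]
  | a :: ((b :: _) as t) => flat_map (fun m => map (cons m) (interl t)) (Zrange b a)
  end.

Definition sumZ (l : list Z) : Z := fold_right Z.add 0%Z l.

(* Schur function via the branching rule (sum over Gelfand-Tsetlin patterns):
   s_lambda(x_1..x_N) = sum_{mu < lambda} s_mu(x_1..x_{N-1}) x_N^{|lambda|-|mu|}.
   The variables are given here in reverse order [x_N; ...; x_1]. *)
Fixpoint schur_rev (xs : list R) (l : list Z) : R :=
  match xs with
  | [] => 1
  | xN :: xs' =>
      sum_list (map (fun mu => schur_rev xs' mu * powerRZ xN (sumZ l - sumZ mu)) (interl l))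
  end.

Definition schur (x : list R) (l : list Z) : R := schur_rev (rev x) l.

Definition fmeasure := list (list Z * R).

Definition expect (rho : fmeasure) (f : list Z -> R) : R :=
  sum_list (map (fun p => snd p * f (fst p)) rho).

Definition is_prob_GT (N : nat) (rho : fmeasure) : Prop :=
  Forall (fun p => is_signature N (fst p) /\ 0 <= snd p) rho /\
  sum_list (map snd rho) = 1.

Definition SGF (N : nat) (rho : fmeasure) (x : list R) : R :=
  expect rho (fun l => schur x l / schur (repeat 1 N) l).

(* rho has Schur generating function (x_1 + ... + x_N)^n / N^n
   (as an identity of Laurent polynomials, equivalently on positive reals) *)
Definition has_SGF_tensor_power (N n : nat) (rho : fmeasure) : Prop :=
  forall x : list R, length x = N -> Forall (fun t => 0 < t) x ->
    SGF N rho x = (sum_list x) ^ n / INR N ^ n.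

Definition nfloor (c : R) (N : nat) : nat := Z.to_nat (Int_part (c * INR N ^ 2)).

Definition pk (N k : nat) (l : list Z) : R :=
  sum_list (map (fun p => IZR (fst p + Z.of_nat N - Z.of_nat (snd p))%Z ^ k)
                (combine l (seq 1 N))).

Definition cov (rho : fmeasure) (f g : list Z -> R) : R :=
  expect rho (fun l => f l * g l) - expect rho f * expect rho g.

Definition Xk (rho : fmeasure) (N k : nat) (l : list Z) : R :=
  (pk N k l - expect rho (pk N k)) / INR N ^ k.

Definition joint_moment (rho : fmeasure) (N : nat) (ks : list nat) : R :=
  expect rho (fun l => prod_list (map (fun k => Xk rho N k l) ks)).

Definition remove_at {A} (j : nat) (l : list A) : list A := firstn j l ++ skipn (S j) l.

Fixpoint wick_f (C : nat -> nat -> R) (fuel : nat) (l : list nat) : R :=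
  match fuel with
  | O => 1
  | S f =>
    match l with
    | [] => 1
    | k :: t =>
        sum_list (map (fun j => C k (nth j t O) * wick_f C f (remove_at j t))
                      (seq 0 (length t)))
    end
  end.

(* E[ prod_{k in ks} G_k ] for a centered Gaussian vector (G_k) with covariance C *)
Definition wick (C : nat -> nat -> R) (ks : list nat) : R := wick_f C (length ks) ks.

Definition Cx := (R * R)%type.
Definition RtoC (r : R) : Cx := (r, 0).
Definition Ci : Cx := (0, 1).
Definition Cadd (z w : Cx) : Cx := (fst z + fst w, snd z + snd w).
Definition Csub (z w : Cx) : Cx := (fst z - fst w, snd z - snd w).
Definition Cmul (z w : Cx) : Cx :=
  (fst z * fst w - snd z * snd w, fst z * snd w + snd z * fst w).
Definition Cinv (z : Cx) : Cx :=
  (fst z / (fst z ^ 2 + snd z ^ 2), - snd z / (fst z ^ 2 + snd z ^ 2)).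
Fixpoint Cpow (z : Cx) (n : nat) : Cx :=
  match n with O => RtoC 1 | S m => Cmul z (Cpow z m) end.

Definition circ (r th : R) : Cx := (r * cos th, r * sin th).
Definition dcirc (r th : R) : Cx := Cmul Ci (circ r th).

Definition is_RInt2 (f : R -> R -> R) (v : R) : Prop :=
  exists g : R -> R,
    (forall th, exists pr : Riemann_integrable (fun ph => f th ph) 0 (2 * PI),
        RiemannInt pr = g th) /\
    exists pr : Riemann_integrable g 0 (2 * PI), RiemannInt pr = v.

Definition Fc (c : R) (z : Cx) : Cx :=
  Cadd (Cadd (Cinv z) (RtoC (1 + c))) (Cmul (RtoC c) z).

Definition integrand (c : R) (k1 k2 : nat) (eps th ph : R) : Cx :=
  let z := circ eps th in
  let w := circ (2 * eps) ph in
  Cmul (Cmul (Cmul (Cpow (Fc c z) k1) (Cpow (Fc c w) k2))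
             (Cadd (RtoC (- c)) (Cinv (Cpow (Csub z w) 2))))
       (Cmul (dcirc eps th) (dcirc (2 * eps) ph)).

(* v = 1/(2 pi i)^2 \oint_{|z|=eps} \oint_{|w|=2eps} F(z,w) dz dw,
   i.e. the double contour integral equals (2 pi i)^2 v = -4 pi^2 v (with v real) *)
Definition contour_value (c : R) (k1 k2 : nat) (eps v : R) : Prop :=
  is_RInt2 (fun th ph => fst (integrand c k1 k2 eps th ph)) (- (4 * PI ^ 2) * v) /\
  is_RInt2 (fun th ph => snd (integrand c k1 k2 eps th ph)) 0.

(* Main.v *)
From mathcomp Require all_boot all_order all_fingroup all_algebra.
From mathcomp Require Rstruct ring lra zify.
From Coquelicot Require Coquelicot.
From Stdlib Require FunctionalExtensionality Lra Lia.
Require Import Defs.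

(** With l_i = lambda_i + N - i and V the Vandermonde determinant, expanding the
    Schur generating function in monomials shows that the expectation under rho_N
    of a symmetric function F of l / N is (T^n (V F) / V) (delta), where
    T g (l) = N^-1 sum_i g (l + e_i) and delta is the value of l at the empty
    signature: rho_N is the law at time n of a Markov chain adding one box per
    step. The probability V (l + e_i) / (N V (l)) of a jump at i enters only
    through the sums N^-1 sum_i V (l + e_i) / V (l) l_i^m, and a generating
    function identity turns these into polynomials in the power sums. Hence the
    moments of the rescaled power sums satisfy, up to O(1/N), a triangular
    system of difference equations in time n / N^2. In the limit it becomes a
    system of differential equations in t. With f (z) = 1/z + 1 + t + t z, which
    is (1 + z) (1/z + t), identities between the coefficients of the powers of f
    show that the means are the polynomials mlim and that the solution for the
    centred moments is Wick's formula for the covariance Cov, whose value at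
    t = c is the contour integral. *)

(** Give p_k the weight k. Its increment under a jump at y has degree k - 1 in y, and averaging y^m
    over the jump position gives power sums of weight at most m. So the time derivative of a moment
    of weight D + 1 involves only weights up to D, and each level is found by integrating functions
    already known, with no closure estimate. The obstacle is the scale: fluctuations carry a factor
    N, so convergence of the jump means is not enough. They are expanded to first order in the
    fluctuations, with a remainder of order N^-2. The linear coefficients have a closed form
    because, in the limit, the jump means have the generating function exp (sum_k P_k x^(k+1)).
    Limits are polynomials in t and f^k is represented by z^k f^k, a polynomial in two variables, so
    the identities between coefficients become formal residue computations. The contour integral is
    handled without a residue theorem: expanding the powers of f leaves integrals of w^s / (w -
    z)^2, which obey a recursion in s. *)

Module Contour.
Import Stdlib.Reals.Reals Stdlib.ZArith.ZArith Stdlib.Lists.List Stdlib.micromega.Lra Stdlib.micromega.Lia.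
Import Coquelicot.Coquelicot.
Local Open Scope R_scope.

(** * The contour integral *)

Definition CI (f : R -> C) (v : C) :=
  is_RInt (fun t => fst (f t)) 0 (2 * PI) (fst v) /\
  is_RInt (fun t => snd (f t)) 0 (2 * PI) (snd v).

Lemma CI_ext f g v : (forall t, f t = g t) -> CI f v -> CI g v.
Proof.
  intros h [h1 h2]; split.
  - apply is_RInt_ext with (2 := h1); intros; now rewrite h.
  - apply is_RInt_ext with (2 := h2); intros; now rewrite h.
Qed.

Lemma CI_plus f g v w : CI f v -> CI g w -> CI (fun t => Cplus (f t) (g t)) (Cplus v w).
Proof.
  intros [h1 h2] [h3 h4]; split; simpl.
  - exact (is_RInt_plus _ _ _ _ _ _ h1 h3).
  - exact (is_RInt_plus _ _ _ _ _ _ h2 h4).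
Qed.

Lemma CI_scal a f v : CI f v -> CI (fun t => Cmult a (f t)) (Cmult a v).
Proof.
  intros [h1 h2]; split; simpl.
  - exact (is_RInt_minus _ _ _ _ _ _ (is_RInt_scal _ _ _ (fst a) _ h1) (is_RInt_scal _ _ _ (snd a) _ h2)).
  - exact (is_RInt_plus _ _ _ _ _ _ (is_RInt_scal _ _ _ (fst a) _ h2) (is_RInt_scal _ _ _ (snd a) _ h1)).
Qed.

Lemma CI_eq f v w : v = w -> CI f v -> CI f w.
Proof. now intros ->. Qed.

(** The Laurent monomial (r exp(i th))^s, in polar form so that its primitive in th is explicit for
    either sign of s. *)
Definition zp (r th : R) (s : Z) : C :=
  (powerRZ r s * cos (IZR s * th), powerRZ r s * sin (IZR s * th)).

Lemma zp_add r th a b : r <> 0 -> zp r th (a + b) = Cmult (zp r th a) (zp r th b).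
Proof.
  intros hr; unfold zp, Cmult; simpl.
  rewrite powerRZ_add by exact hr.
  rewrite plus_IZR, Rmult_plus_distr_r, cos_plus, sin_plus.
  f_equal; ring.
Qed.

Lemma zp_0 r th : zp r th 0 = RtoC 1.
Proof. unfold zp, RtoC; simpl; rewrite Rmult_0_l, cos_0, sin_0; f_equal; ring. Qed.

Lemma zp_1 r th : zp r th 1 = circ r th.
Proof. unfold zp, circ; simpl; rewrite Rmult_1_l; f_equal; ring. Qed.

Lemma zp_neq0 r th s : r <> 0 -> zp r th s <> RtoC 0.
Proof.
  intros hr h.
  assert (e : Cmult (zp r th s) (zp r th (- s)) = RtoC 1).
  { rewrite <- zp_add by exact hr. rewrite Z.add_opp_diag_r. apply zp_0. }
  rewrite h, Cmult_0_l in e. injection e; lra.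
Qed.

Lemma zp_m1 r th : r <> 0 -> Cinv (circ r th) = zp r th (-1).
Proof.
  intros hr. rewrite <- zp_1.
  assert (h := zp_neq0 r th 1 hr).
  assert (e : Cmult (zp r th 1) (zp r th (-1)) = RtoC 1).
  { rewrite <- zp_add by exact hr. apply zp_0. }
  change (Complex.Cinv (zp r th 1) = zp r th (-1)).
  rewrite <- (Cmult_1_l (zp r th (-1))), <- (Cinv_l (zp r th 1) h), <- Cmult_assoc, e.
  ring.
Qed.

Lemma sin_2Zpi s : sin (IZR s * (2 * PI)) = 0.
Proof. apply sin_eq_0_1; exists (2 * s)%Z; rewrite mult_IZR; ring. Qed.

Lemma cos_2Zpi s : cos (IZR s * (2 * PI)) = 1.
Proof.
  replace (IZR s * (2 * PI)) with (2 * (IZR s * PI)) by ring.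
  rewrite cos_2a_sin. replace (sin (IZR s * PI)) with 0; [ring|].
  symmetry; apply sin_eq_0_1; now exists s.
Qed.

Lemma is_RInt_primitive (F f : R -> R) :
  (forall t, is_derive F t (f t)) -> (forall t, continuous f t) -> F (2 * PI) = F 0 ->
  is_RInt f 0 (2 * PI) 0.
Proof.
  intros h1 h2 h3.
  assert (h := is_RInt_derive (V := R_CompleteNormedModule) F f 0 (2 * PI)
    (fun x _ => h1 x) (fun x _ => h2 x)).
  rewrite h3 in h.
  replace 0 with (minus (F 0) (F 0)) at 2; [exact h|].
  unfold minus, plus, opp; simpl; ring.
Qed.

Lemma is_RInt_cst v : is_RInt (fun _ => v) 0 (2 * PI) (2 * PI * v).
Proof.
  assert (h := is_RInt_const (V := R_NormedModule) 0 (2 * PI) v).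
  replace (2 * PI * v) with (scal (2 * PI - 0) v); [exact h|].
  unfold scal; simpl; unfold mult; simpl; ring.
Qed.

Lemma CI_cst v : CI (fun _ => v) (Cmult (RtoC (2 * PI)) v).
Proof.
  split; simpl.
  - replace (2 * PI * fst v - 0 * snd v) with (2 * PI * fst v) by ring. apply is_RInt_cst.
  - replace (2 * PI * snd v + 0 * fst v) with (2 * PI * snd v) by ring. apply is_RInt_cst.
Qed.

Lemma CI_zp r s : CI (fun th => zp r th s) (RtoC (if Z.eqb s 0 then 2 * PI else 0)).
Proof.
  destruct (Z.eqb_spec s 0) as [->|hs].
  - apply CI_ext with (fun _ => RtoC 1).
    { intros t; now rewrite zp_0. }
    apply CI_eq with (2 := CI_cst (RtoC 1)). ring.
  - assert (hs' : IZR s <> 0) by (now apply not_0_IZR).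
    split; simpl.
    + apply (is_RInt_primitive (fun t => powerRZ r s * sin (IZR s * t) / IZR s)).
      * intros t. auto_derive; [easy|]. field; exact hs'.
      * intros t. apply (ex_derive_continuous (fun t => powerRZ r s * cos (IZR s * t))).
        auto_derive; easy.
      * rewrite sin_2Zpi, (Rmult_0_r (IZR s)), sin_0; reflexivity.
    + apply (is_RInt_primitive (fun t => - (powerRZ r s * cos (IZR s * t) / IZR s))).
      * intros t. auto_derive; [easy|]. field; exact hs'.
      * intros t. apply (ex_derive_continuous (fun t => powerRZ r s * sin (IZR s * t))).
        auto_derive; easy.
      * rewrite cos_2Zpi, (Rmult_0_r (IZR s)), cos_0; reflexivity.
Qed.

(** The kernel integrals are computed directly at s = 0 only, while the factors 1/w and w in f shift
    s in both directions. *)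
Lemma Z_two_sided (P : Z -> Prop) : P 0%Z -> (forall s, P s -> P (s + 1)%Z) ->
  (forall s, P (s + 1)%Z -> P s) -> forall s, P s.
Proof.
  intros h0 h1 h2.
  assert (hp : forall n : nat, P (Z.of_nat n)).
  { induction n as [|n IH]; [exact h0|].
    replace (Z.of_nat (S n)) with (Z.of_nat n + 1)%Z by lia. auto. }
  assert (hn : forall n : nat, P (- Z.of_nat n)%Z).
  { induction n as [|n IH]; [exact h0|].
    apply h2. replace (- Z.of_nat (S n) + 1)%Z with (- Z.of_nat n)%Z by lia. auto. }
  intros s; destruct (Z_le_gt_dec 0 s).
  - replace s with (Z.of_nat (Z.to_nat s)) by lia; apply hp.
  - replace s with (- Z.of_nat (Z.to_nat (- s)))%Z by lia; apply hn.
Qed.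

(** * Cauchy kernels on the circle |w| = 2 |z| *)

Section Kernel.
Variables (e th : R).
Hypothesis he : 0 < e.

Let r := 2 * e.
Let z := circ e th.
Let uu (ph : R) : C := Cinv (Csub (circ r ph) z).

Lemma r_neq0 : r <> 0. Proof. unfold r; lra. Qed.

Lemma dist_pos ph : 0 < (r * cos ph - e * cos th) ^ 2 + (r * sin ph - e * sin th) ^ 2.
Proof.
  assert (h1 := sin2_cos2 ph). assert (h2 := sin2_cos2 th).
  unfold Rsqr in h1, h2.
  assert (h3 := COS_bound (ph - th)). rewrite cos_minus in h3.
  replace ((r * cos ph - e * cos th) ^ 2 + (r * sin ph - e * sin th) ^ 2) with
    (r ^ 2 * (sin ph * sin ph + cos ph * cos ph) + e ^ 2 * (sin th * sin th + cos th * cos th)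
     - 2 * r * e * (cos ph * cos th + sin ph * sin th)) by ring.
  rewrite h1, h2. unfold r. nra.
Qed.

Lemma sub_neq0 ph : Csub (circ r ph) z <> RtoC 0.
Proof.
  intros h. assert (hd := dist_pos ph).
  unfold Csub, circ, z, RtoC in h; simpl in h.
  injection h as h1 h2. unfold circ in h1, h2; simpl in h1, h2.
  rewrite h1, h2 in hd. lra.
Qed.

Lemma w_uu ph : Cmult (circ r ph) (uu ph) = Cplus (RtoC 1) (Cmult z (uu ph)).
Proof.
  assert (h := sub_neq0 ph). unfold uu.
  change (Cmult (circ r ph) (Complex.Cinv (Cminus (circ r ph) z)) =
    Cplus (RtoC 1) (Cmult z (Complex.Cinv (Cminus (circ r ph) z)))).
  change (Cminus (circ r ph) z <> RtoC 0) in h.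
  field. exact h.
Qed.

Let kk (s : Z) (ph : R) : C := Cmult (zp r ph (s + 1)) (uu ph).
Let jj (s : Z) (ph : R) : C := Cmult (kk s ph) (uu ph).

(** One factor w is written as (w - z) + z. Together with [jj_step] this reduces all s to the two
    integrals at s = 0. *)
Lemma kk_step s ph : kk (s + 1) ph = Cplus (zp r ph (s + 1)) (Cmult z (kk s ph)).
Proof.
  unfold kk. rewrite (zp_add r ph (s + 1) 1 r_neq0), zp_1.
  rewrite <- Cmult_assoc, w_uu. ring.
Qed.

Lemma jj_step s ph : jj (s + 1) ph = Cplus (kk s ph) (Cmult z (jj s ph)).
Proof.
  unfold jj. rewrite kk_step. unfold kk. ring.
Qed.

(* For z = e exp(i th) and |w| = 2 e, these are the integrals over the argument of w
   of w^(s+1) / (w - z) and w^(s+1) / (w - z)^2. *)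
Definition vK (s : Z) : C := if Z.leb 0 s then Cmult (RtoC (2 * PI)) (zp e th s) else RtoC 0.
Definition vJ (s : Z) : C :=
  if Z.leb 1 s then Cmult (RtoC (2 * PI * IZR s)) (zp e th (s - 1)) else RtoC 0.

Lemma zz : z = zp e th 1. Proof. unfold z; now rewrite zp_1. Qed.

Lemma e_neq0 : e <> 0. Proof. lra. Qed.

Lemma z_neq0 : z <> RtoC 0. Proof. rewrite zz; apply zp_neq0, e_neq0. Qed.

Lemma vK_step s : vK (s + 1) = Cplus (RtoC (if Z.eqb (s + 1) 0 then 2 * PI else 0)) (Cmult z (vK s)).
Proof.
  unfold vK. destruct (Z.eqb_spec (s + 1) 0) as [h|h].
  - replace s with (-1)%Z by lia; simpl. rewrite zp_0; ring.
  - destruct (Z.leb_spec 0 s), (Z.leb_spec 0 (s + 1)); try lia; try ring.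
    rewrite (zp_add e th s 1 e_neq0), zz. ring.
Qed.

Lemma vJ_step s : vJ (s + 1) = Cplus (vK s) (Cmult z (vJ s)).
Proof.
  unfold vJ, vK. destruct (Z.leb_spec 1 s), (Z.leb_spec 0 s), (Z.leb_spec 1 (s + 1)); try lia; try ring.
  - replace (s + 1 - 1)%Z with ((s - 1) + 1)%Z by lia.
    replace (zp e th s) with (zp e th ((s - 1) + 1)) by (f_equal; lia).
    rewrite (zp_add e th (s - 1) 1 e_neq0), zz.
    rewrite plus_IZR, !RtoC_mult, RtoC_plus. ring.
  - replace s with 0%Z by lia. simpl. rewrite Rmult_1_r. ring.
Qed.

(** In the argument of w, the derivative of 1/(w - z) is -i w / (w - z)^2. Hence the two parts of
    the integrand have periodic primitives read off from [uu]. *)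
Lemma CI_jj0 : CI (jj 0) (RtoC 0).
Proof.
  assert (hd : forall t, (r * cos t - e * cos th) * ((r * cos t - e * cos th) * 1)
     + (r * sin t - e * sin th) * ((r * sin t - e * sin th) * 1) <> 0).
  { intros t; assert (h := dist_pos t); simpl in h; lra. }
  split.
  - apply (is_RInt_primitive (fun t => - snd (uu t))).
    + intros t. unfold jj, kk, uu, Cinv, Csub, circ, z, zp; simpl.
      auto_derive; [repeat split; try (intros hh; apply (hd t); rewrite <- hh; ring)|].
      rewrite (Rmult_1_l t). field. intros h; apply (hd t); rewrite <- h; ring.
    + intros t. unfold jj, kk, uu, Cinv, Csub, circ, z, zp; simpl.
      apply (ex_derive_continuous (V := R_NormedModule)).
      auto_derive; repeat split; try (intros hh; apply (hd t); rewrite <- hh; ring).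
    + unfold uu, Csub, circ; simpl. now rewrite cos_2PI, sin_2PI, cos_0, sin_0.
  - apply (is_RInt_primitive (fun t => fst (uu t))).
    + intros t. unfold jj, kk, uu, Cinv, Csub, circ, z, zp; simpl.
      auto_derive; [repeat split; try (intros hh; apply (hd t); rewrite <- hh; ring)|].
      rewrite (Rmult_1_l t). field. intros h; apply (hd t); rewrite <- h; ring.
    + intros t. unfold jj, kk, uu, Cinv, Csub, circ, z, zp; simpl.
      apply (ex_derive_continuous (V := R_NormedModule)).
      auto_derive; repeat split; try (intros hh; apply (hd t); rewrite <- hh; ring).
    + unfold uu, Csub, circ; simpl. now rewrite cos_2PI, sin_2PI, cos_0, sin_0.
Qed.

(** As |w| = 2 |z|, the quotient z / (w - z) is 1 / (2 exp(i (t - th)) - 1), with denominator of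
    squared modulus 5 - 4 cos (t - th). *)
Lemma zuu_val t : Cmult z (uu t) =
  ((2 * cos (t - th) - 1) / (5 - 4 * cos (t - th)), - (2 * sin (t - th)) / (5 - 4 * cos (t - th))).
Proof.
  assert (h1 := sin2_cos2 t). assert (h2 := sin2_cos2 th). unfold Rsqr in h1, h2.
  assert (h3 := COS_bound (t - th)).
  assert (hD : (r * cos t - e * cos th) ^ 2 + (r * sin t - e * sin th) ^ 2 = e ^ 2 * (5 - 4 * cos (t - th))).
  { rewrite cos_minus. unfold r.
    replace (e ^ 2 * (5 - 4 * (cos t * cos th + sin t * sin th))) with
      (e ^ 2 * (4 * 1 + 1 - 4 * (cos t * cos th + sin t * sin th))) by ring.
    rewrite <- h1 at 1. rewrite <- h2. ring. }
  assert (hp : 5 - 4 * cos (t - th) <> 0) by lra.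
  assert (n1 : e * cos th * (r * cos t - e * cos th) + e * sin th * (r * sin t - e * sin th)
     = e ^ 2 * (2 * cos (t - th) - 1)).
  { rewrite cos_minus. unfold r. rewrite <- h2. ring. }
  assert (n2 : e * sin th * (r * cos t - e * cos th) - e * cos th * (r * sin t - e * sin th)
     = e ^ 2 * (- (2 * sin (t - th)))).
  { rewrite sin_minus. unfold r. ring. }
  unfold Cmult, uu, Cinv, Csub, circ, z, circ; cbn [fst snd].
  rewrite hD. f_equal.
  - transitivity ((e ^ 2 * (2 * cos (t - th) - 1)) / (e ^ 2 * (5 - 4 * cos (t - th)))).
    + rewrite <- n1. field. split; [exact hp | lra].
    + field. split; [exact hp | lra].
  - transitivity ((e ^ 2 * (- (2 * sin (t - th)))) / (e ^ 2 * (5 - 4 * cos (t - th)))).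
    + rewrite <- n2. field. split; [exact hp | lra].
    + field. split; [exact hp | lra].
Qed.

Lemma sin_shift x : sin (2 * PI - x) = sin (0 - x).
Proof. replace (2 * PI - x) with (- x + 2 * PI) by ring. rewrite sin_plus, sin_2PI, cos_2PI. replace (0 - x) with (- x) by ring. ring. Qed.

Lemma cos_shift x : cos (2 * PI - x) = cos (0 - x).
Proof. replace (2 * PI - x) with (- x + 2 * PI) by ring. rewrite cos_plus, sin_2PI, cos_2PI. replace (0 - x) with (- x) by ring. ring. Qed.

(** Here w / (w - z) = 1 + z / (w - z), and the second term has primitive -i log (1 - z/w). Since
    |z/w| = 1/2, the logarithm stays in the right half-plane and is periodic; [atan] and [ln] below
    are its parts up to a constant. *)
Lemma CI_kk0 : CI (kk 0) (RtoC (2 * PI)).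
Proof.
  apply CI_eq with (Cplus (Cmult (RtoC (2 * PI)) (RtoC 1)) (RtoC 0)); [ring|].
  apply CI_ext with (fun t => Cplus (RtoC 1) (Cmult z (uu t))).
  { intros t. unfold kk. simpl Z.add. now rewrite zp_1, w_uu. }
  apply CI_plus; [apply CI_cst|].
  assert (hp : forall t, 5 - 4 * cos (t - th) <> 0).
  { intros t. assert (h := COS_bound (t - th)). lra. }
  assert (hq : forall t, 2 - cos (t - th) <> 0).
  { intros t. assert (h := COS_bound (t - th)). lra. }
  apply CI_ext with (fun t => ((2 * cos (t - th) - 1) / (5 - 4 * cos (t - th)),
      - (2 * sin (t - th)) / (5 - 4 * cos (t - th)))).
  { intros t. now rewrite zuu_val. }
  split; cbn [fst snd RtoC].
  - apply (is_RInt_primitive (fun t => atan (sin (t - th) / (2 - cos (t - th))))).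
    + intros t. auto_derive; [apply hq|].
      assert (h := sin2_cos2 (t - th)). unfold Rsqr in h.
      assert (h1 := hp t). assert (h2 := hq t).
      replace (t + - th) with (t - th) by ring.
      set (c := cos (t - th)) in *. set (s := sin (t - th)) in *.
      assert (h3 : (2 - c) * (2 - c) + s * s <> 0).
      { replace ((2 - c) * (2 - c) + s * s) with (4 - 4 * c + (s * s + c * c)) by ring.
        rewrite h. intros h4. apply h1. lra. }
      field_simplify_eq.
      * replace (s ^ 2) with (1 - c ^ 2) by (rewrite <- h; ring). ring.
      * repeat split; try assumption; try (intros h4; apply h3; rewrite <- h4; ring).
    + intros t. apply (ex_derive_continuous (V := R_NormedModule)).
      auto_derive. apply hp.
    + now rewrite sin_shift, cos_shift.
  - apply (is_RInt_primitive (fun t => - (ln (5 - 4 * cos (t - th)) / 2))).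
    + intros t. auto_derive.
      * assert (h := COS_bound (t - th)). unfold Rminus in h. lra.
      * replace (t + - th) with (t - th) by ring. field. apply hp.
    + intros t. apply (ex_derive_continuous (V := R_NormedModule)).
      auto_derive. apply hp.
    + now rewrite cos_shift.
Qed.

Lemma CI_kk s : CI (kk s) (vK s).
Proof.
  revert s; apply Z_two_sided.
  - apply CI_eq with (2 := CI_kk0). unfold vK; simpl. rewrite zp_0. ring.
  - intros s IH. rewrite vK_step.
    apply CI_ext with (1 := fun t => eq_sym (kk_step s t)).
    apply CI_plus; [apply CI_zp | now apply CI_scal].
  - intros s IH. rewrite vK_step in IH.
    assert (h := CI_scal (Complex.Cinv z) _ _
      (CI_plus _ _ _ _ IH (CI_scal (RtoC (-1)) _ _ (CI_zp r (s + 1))))).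
    eapply CI_eq; [|eapply CI_ext; [|exact h]].
    + field. apply z_neq0.
    + intros t. cbv beta. rewrite kk_step. field. apply z_neq0.
Qed.

Lemma CI_jj s : CI (jj s) (vJ s).
Proof.
  revert s; apply Z_two_sided.
  - exact CI_jj0.
  - intros s IH. rewrite vJ_step.
    apply CI_ext with (1 := fun t => eq_sym (jj_step s t)).
    apply CI_plus; [apply CI_kk | now apply CI_scal].
  - intros s IH. rewrite vJ_step in IH.
    assert (h := CI_scal (Complex.Cinv z) _ _
      (CI_plus _ _ _ _ IH (CI_scal (RtoC (-1)) _ _ (CI_kk s)))).
    eapply CI_eq; [|eapply CI_ext; [|exact h]].
    + field. apply z_neq0.
    + intros t. cbv beta. rewrite jj_step. field. apply z_neq0.
Qed.

End Kernel.

(** The coefficient of z^s in (1/z + 1 + c + c z)^k, one factor at a time. *)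
Fixpoint laurent_coef (c : R) (k : nat) (s : Z) : R :=
  match k with
  | O => if Z.eqb s 0 then 1 else 0
  | S k' => laurent_coef c k' (s + 1) + (1 + c) * laurent_coef c k' s + c * laurent_coef c k' (s - 1)
  end.

(* The moment sequence of f^k times a function whose moment sequence is [m]. *)
Fixpoint shiftF (c : R) (k : nat) (m : Z -> C) (s : Z) : C :=
  match k with
  | O => m s
  | S k' => Cplus (Cplus (shiftF c k' m (s - 1)) (Cmult (RtoC (1 + c)) (shiftF c k' m s)))
                  (Cmult (RtoC c) (shiftF c k' m (s + 1)))
  end.

Lemma shiftF_delta c k a b s :
  shiftF c k (fun s => RtoC (if Z.eqb (s + a) 0 then b else 0)) s =
  RtoC (b * laurent_coef c k (- a - s)).
Proof.
  revert s; induction k as [|k IH]; intros s; simpl.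
  - destruct (Z.eqb_spec (s + a) 0), (Z.eqb_spec (- a - s) 0); try lia; f_equal; ring.
  - rewrite !IH.
    replace (- a - (s - 1))%Z with (- a - s + 1)%Z by lia.
    replace (- a - (s + 1))%Z with (- a - s - 1)%Z by lia.
    rewrite <- !RtoC_mult, <- !RtoC_plus. f_equal. ring.
Qed.

Lemma Fc_zp c r th s : r <> 0 -> Cmult (Fc c (circ r th)) (zp r th s) =
  Cplus (Cplus (zp r th (s - 1)) (Cmult (RtoC (1 + c)) (zp r th s))) (Cmult (RtoC c) (zp r th (s + 1))).
Proof.
  intros hr. unfold Fc. rewrite zp_m1 by exact hr.
  unfold Z.sub. rewrite (zp_add r th s (Z.opp 1) hr), (zp_add r th s 1 hr), zp_1.
  change (Cmult (Cplus (Cplus (zp r th (-1)) (RtoC (1 + c))) (Cmult (RtoC c) (circ r th))) (zp r th s) =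
   Cplus (Cplus (Cmult (zp r th s) (zp r th (-1))) (Cmult (RtoC (1 + c)) (zp r th s)))
         (Cmult (RtoC c) (Cmult (zp r th s) (circ r th)))).
  ring.
Qed.

(** A factor f acts on the sequence of integrals against w^s as a three-term operator, so the power
    f^k never has to be expanded. *)
Lemma CI_Fc c k r (h0 : R -> C) (m : Z -> C) : r <> 0 ->
  (forall s, CI (fun t => Cmult (zp r t s) (h0 t)) (m s)) ->
  forall s, CI (fun t => Cmult (Defs.Cpow (Fc c (circ r t)) k) (Cmult (zp r t s) (h0 t))) (shiftF c k m s).
Proof.
  intros hr hm; induction k as [|k IH]; intros s.
  - apply CI_ext with (2 := hm s). intros t.
    change (Cmult (zp r t s) (h0 t) = Cmult (RtoC 1) (Cmult (zp r t s) (h0 t))). ring.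
  - simpl shiftF.
    eapply CI_ext; [|exact (CI_plus _ _ _ _ (CI_plus _ _ _ _ (IH (s - 1)%Z) (CI_scal (RtoC (1 + c)) _ _ (IH s)))
      (CI_scal (RtoC c) _ _ (IH (s + 1)%Z)))].
    intros t. cbv beta.
    change (Defs.Cpow (Fc c (circ r t)) (S k)) with
      (Cmult (Fc c (circ r t)) (Defs.Cpow (Fc c (circ r t)) k)).
    set (P := Defs.Cpow (Fc c (circ r t)) k).
    transitivity (Cmult P (Cmult (Cmult (Fc c (circ r t)) (zp r t s)) (h0 t))).
    + rewrite Fc_zp by exact hr. ring.
    + ring.
Qed.

Lemma CI_shiftF c k (g : R -> C) (m : R -> Z -> C) (v : Z -> C) :
  (forall s, CI (fun t => Cmult (g t) (m t s)) (v s)) ->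
  forall s, CI (fun t => Cmult (g t) (shiftF c k (m t) s)) (shiftF c k v s).
Proof.
  intros h; induction k as [|k IH]; intros s; [apply h|]. simpl shiftF.
  eapply CI_ext; [|exact (CI_plus _ _ _ _ (CI_plus _ _ _ _ (IH (s - 1)%Z) (CI_scal (RtoC (1 + c)) _ _ (IH s)))
      (CI_scal (RtoC c) _ _ (IH (s + 1)%Z)))].
  intros t. cbv beta. ring.
Qed.

(** Up to 4 pi^2, the integral over the argument of z of f(z)^k1 z [vJ] s: the factor s z^(s-1) in
    [vJ] selects the coefficient of z^(-s) in f^k1. *)
Definition outer_seq (c : R) (k1 : nat) (s : Z) : C :=
  RtoC (if Z.leb 1 s then IZR s * laurent_coef c k1 (- s) else 0).

Definition contour_limit (c : R) (k1 k2 : nat) : R :=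
  fst (shiftF c k2 (outer_seq c k1) 0) - c * laurent_coef c k1 (-1) * laurent_coef c k2 (-1).

Lemma shiftF_scal c k a m s : shiftF c k (fun s => Cmult a (m s)) s = Cmult a (shiftF c k m s).
Proof. revert s; induction k as [|k IH]; intros s; simpl; [reflexivity|]. rewrite !IH. ring. Qed.

Lemma snd_shiftF c k m s : (forall s, snd (m s) = 0) -> snd (shiftF c k m s) = 0.
Proof.
  intros h; revert s; induction k as [|k IH]; intros s; [apply h|]. simpl.
  rewrite !IH. ring.
Qed.

(** * The double integral as a finite combination of Laurent coefficients *)

Section Contour.
Variables (c e : R) (k1 k2 : nat).
Hypothesis he : 0 < e.

(** The factor -1 is i i, from dz = i z dth and dw = i w dph. The two summands come from -c and from
    1/(z - w)^2. *)
Definition inner_val (th : R) : C :=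
  Cmult (Cmult (RtoC (-1)) (Cmult (Defs.Cpow (Fc c (circ e th)) k1) (zp e th 1)))
   (Cplus (RtoC (- c * (2 * PI * laurent_coef c k2 (-1)))) (shiftF c k2 (vJ e th) 0)).

Lemma CI_inner th : CI (fun ph => integrand c k1 k2 e th ph) (inner_val th).
Proof.
  assert (hr : 2 * e <> 0) by lra.
  set (u := fun ph => Complex.Cinv (Cminus (circ (2 * e) ph) (circ e th))).
  assert (hJ : forall s, CI (fun t => Cmult (zp (2 * e) t s) (Cmult (zp (2 * e) t 1) (Cmult (u t) (u t)))) (vJ e th s)).
  { intros s. eapply CI_ext; [|exact (CI_jj e th he s)].
    intros t. cbv beta. rewrite (zp_add (2 * e) t s 1 hr).
    change (Cmult (Cmult (Cmult (zp (2 * e) t s) (zp (2 * e) t 1)) (u t)) (u t) =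
      Cmult (zp (2 * e) t s) (Cmult (zp (2 * e) t 1) (Cmult (u t) (u t)))). ring. }
  assert (hM : forall s, CI (fun t => Cmult (zp (2 * e) t s) (zp (2 * e) t 1)) (RtoC (if Z.eqb (s + 1) 0 then 2 * PI else 0))).
  { intros s. eapply CI_ext; [|exact (CI_zp (2 * e) (s + 1))].
    intros t. cbv beta. now rewrite (zp_add (2 * e) t s 1 hr). }
  assert (h1 := CI_Fc c k2 (2 * e) _ _ hr hJ 0).
  assert (h2 := CI_Fc c k2 (2 * e) _ _ hr hM 0).
  rewrite shiftF_delta in h2. simpl Z.sub in h2.
  eapply CI_eq; [|eapply CI_ext; [|exact (CI_scal (Cmult (RtoC (-1)) (Cmult (Defs.Cpow (Fc c (circ e th)) k1) (zp e th 1))) _ _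
     (CI_plus _ _ _ _ (CI_scal (RtoC (- c)) _ _ h2) h1))]].
  - unfold inner_val. rewrite <- RtoC_mult. reflexivity.
  - intros t. cbv beta. rewrite !zp_0.
    assert (hn := sub_neq0 e th he t).
    change (Cminus (circ (2 * e) t) (circ e th) <> RtoC 0) in hn.
    unfold integrand, dcirc. rewrite <- !zp_1.
    change Ci with Complex.Ci.
    set (P1 := Defs.Cpow (Fc c (zp e th 1)) k1). set (P2 := Defs.Cpow (Fc c (zp (2 * e) t 1)) k2).
    set (Z1 := zp e th 1). set (W1 := zp (2 * e) t 1).
    assert (hu : Defs.Cinv (Defs.Cpow (Csub Z1 W1) 2) = Cmult (u t) (u t)).
    { change (Complex.Cinv (Cmult (Cminus Z1 W1) (Cmult (Cminus Z1 W1) (RtoC 1))) = Cmult (u t) (u t)).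
      unfold u. rewrite <- !zp_1 in hn |- *. fold Z1 W1 in hn |- *.
      assert (hn' : Cminus Z1 W1 <> RtoC 0).
      { intros h; apply hn. replace (Cminus W1 Z1) with (Copp (Cminus Z1 W1)) by ring. rewrite h. ring. }
      field. now split. }
    rewrite hu.
    assert (hi : Cmult Complex.Ci Complex.Ci = RtoC (-1)).
    { unfold Cmult, Complex.Ci, RtoC; simpl; f_equal; ring. }
    change (Cmult (Cmult (RtoC (-1)) (Cmult P1 Z1))
       (Cplus (Cmult (RtoC (- c)) (Cmult P2 (Cmult (RtoC 1) W1)))
          (Cmult P2 (Cmult (RtoC 1) (Cmult W1 (Cmult (u t) (u t)))))) =
      Cmult (Cmult (Cmult P1 P2) (Cplus (RtoC (- c)) (Cmult (u t) (u t))))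
       (Cmult (Cmult Complex.Ci Z1) (Cmult Complex.Ci W1))).
    replace (Cmult (Cmult Complex.Ci Z1) (Cmult Complex.Ci W1)) with
      (Cmult (Cmult Complex.Ci Complex.Ci) (Cmult Z1 W1)) by ring.
    rewrite hi. ring.
Qed.

Lemma CI_outer : CI inner_val (RtoC (- (4 * PI ^ 2) * contour_limit c k1 k2)).
Proof.
  assert (hr : e <> 0) by lra.
  set (g := fun t => Cmult (Defs.Cpow (Fc c (circ e t)) k1) (zp e t 1)).
  assert (hz : forall a, CI (fun t => Cmult (g t) (zp e t a)) (RtoC (2 * PI * laurent_coef c k1 (- 1 - a)))).
  { intros a.
    assert (hM : forall s, CI (fun t => Cmult (zp e t s) (zp e t 1)) (RtoC (if Z.eqb (s + 1) 0 then 2 * PI else 0))).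
    { intros s. eapply CI_ext; [|exact (CI_zp e (s + 1))].
      intros t. cbv beta. now rewrite (zp_add e t s 1 hr). }
    assert (h := CI_Fc c k1 e _ _ hr hM a). rewrite shiftF_delta in h.
    eapply CI_ext; [|exact h]. intros t. unfold g. ring. }
  assert (hJ : forall s, CI (fun t => Cmult (g t) (vJ e t s)) (Cmult (RtoC (4 * PI ^ 2)) (outer_seq c k1 s))).
  { intros s. unfold vJ, outer_seq. destruct (Z.leb_spec 1 s) as [h|h].
    - eapply CI_eq; [|eapply CI_ext; [|exact (CI_scal (RtoC (2 * PI * IZR s)) _ _ (hz (s - 1)%Z))]].
      + rewrite <- !RtoC_mult. f_equal. replace (- 1 - (s - 1))%Z with (- s)%Z by lia. ring.
      + intros t. cbv beta. ring.
    - eapply CI_eq; [|eapply CI_ext; [|exact (CI_cst (RtoC 0))]]; [|intros t; cbv beta]; ring. }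
  assert (h1 := CI_shiftF c k2 g _ _ hJ 0).
  assert (h2 := hz 0%Z).
  rewrite shiftF_scal in h1.
  eapply CI_eq; [|eapply CI_ext; [|exact (CI_plus _ _ _ _
     (CI_scal (RtoC (c * (2 * PI * laurent_coef c k2 (-1)))) _ _ h2) (CI_scal (RtoC (-1)) _ _ h1))]].
  - assert (hs : shiftF c k2 (outer_seq c k1) 0 = RtoC (fst (shiftF c k2 (outer_seq c k1) 0))).
    { apply injective_projections; simpl; [reflexivity|]. apply snd_shiftF. intros s; reflexivity. }
    rewrite hs. unfold contour_limit. simpl Z.sub.
    rewrite <- !RtoC_mult, <- RtoC_plus. f_equal. ring.
  - intros t. cbv beta. rewrite zp_0. unfold inner_val. fold (g t).
    replace (- c * (2 * PI * laurent_coef c k2 (-1))) with (-1 * (c * (2 * PI * laurent_coef c k2 (-1)))) by ring.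
    rewrite (RtoC_mult (-1)).
    assert (hm : RtoC (-1) = Copp (RtoC 1)).
    { apply injective_projections; simpl; ring. }
    rewrite hm. ring.
Qed.

Lemma is_RInt2_of_RInt f g v : (forall th, is_RInt (f th) 0 (2 * PI) (g th)) ->
  is_RInt g 0 (2 * PI) v -> is_RInt2 f v.
Proof.
  intros h1 h2. exists g. split.
  - intros th. assert (pr := ex_RInt_Reals_0 _ _ _ (ex_intro _ _ (h1 th))). exists pr.
    rewrite <- RInt_Reals. apply is_RInt_unique, h1.
  - assert (pr := ex_RInt_Reals_0 _ _ _ (ex_intro _ _ h2)). exists pr.
    rewrite <- RInt_Reals. apply is_RInt_unique, h2.
Qed.

Lemma contour_value_limit : contour_value c k1 k2 e (contour_limit c k1 k2).
Proof.
  destruct CI_outer as [h1 h2]. split.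
  - apply is_RInt2_of_RInt with (fun th => fst (inner_val th)); [|exact h1].
    intros th. apply (CI_inner th).
  - apply is_RInt2_of_RInt with (fun th => snd (inner_val th)); [|exact h2].
    intros th. apply (CI_inner th).
Qed.

End Contour.

End Contour.

Module Moments.
Import all_boot all_order all_fingroup all_algebra.
Import Rstruct ring lra zify FunctionalExtensionality.
Set Implicit Arguments. Unset Strict Implicit. Unset Printing Implicit Defensive.
Import Order.TTheory GRing.Theory Num.Theory.
Local Open Scope ring_scope.

(** * Coefficients of the powers of f *)

Section Laurent.
Variable R : realFieldType.
Local Notation A := {poly R}.
Implicit Types p q : {poly A}.

Definition dt p : {poly A} := map_poly (@deriv R) p.

Lemma coef_dt p i : (dt p)`_i = (p`_i)^`().
Proof. by rewrite /dt coef_map_id0 ?deriv0. Qed.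

Lemma dtM p q : dt (p * q) = dt p * q + p * dt q.
Proof.
apply/polyP=> i; rewrite coef_dt coefD !coefM raddf_sum -big_split /=.
by apply: eq_bigr => j _; rewrite derivM !coef_dt.
Qed.

Lemma dtD p q : dt (p + q) = dt p + dt q.
Proof. by apply/polyP=> i; rewrite !(coef_dt, coefD) derivD. Qed.

Lemma dtC (a : A) : dt a%:P = (a^`())%:P.
Proof. by apply/polyP=> i; rewrite coef_dt !coefC; case: ifP; rewrite ?deriv0. Qed.

Lemma dtX : dt 'X = 0.
Proof.
by apply/polyP=> i; rewrite coef_dt coefX coef0; case: eqP; rewrite ?derivC ?deriv0 // -polyC1 derivC.
Qed.

Lemma dt1 : dt 1 = 0.
Proof. by rewrite -(polyC1 A) dtC -polyC1 derivC. Qed.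

Lemma dtXn p k : dt (p ^+ k.+1) = k.+1%:R * (p ^+ k * dt p).
Proof.
elim: k => [|k IH]; first by rewrite expr0 expr1 !mul1r.
by rewrite exprS dtM IH [k.+2%:R]mulrS !exprS; ring.
Qed.

(* The variable of [{poly A}] is z, that of [A] is t, and [zf] is z f (z):
   [(zf ^+ k)`_i] is the coefficient of z^(i - k) in f^k. *)
Definition tC : {poly A} := ('X)%:P.
Definition zf : {poly A} := (1 + 'X) * (1 + tC * 'X).

Lemma dt_1tX : dt (1 + tC * 'X) = 'X.
Proof. by rewrite dtD dt1 add0r dtM dtX mulr0 addr0 dtC derivX polyC1 mul1r. Qed.

Lemma dt_zf : dt zf = 'X * (1 + 'X).
Proof. by rewrite dtM dt_1tX dtD dt1 dtX; ring. Qed.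

Lemma deriv_tC : tC^`() = 0.
Proof. exact: derivC. Qed.

(** This is z^2 f' = t z^2 - 1. In general z d/dz - k, applied to a numerator over z^k, is z d/dz of
    the quotient; derivatives of Laurent polynomials are written in this way to stay within
    polynomials. *)
Lemma euler_zf : 'X * zf^`() - zf = tC * 'X^2 - 1.
Proof.
rewrite /zf derivM !derivD derivM deriv_tC derivX -polyC1 derivC.
by ring.
Qed.

Lemma natA_neq0 k : (k.+1%:R : A) != 0.
Proof. by rewrite -polyC_natr polyC_eq0 pnatr_eq0. Qed.

Lemma natPA_coef k p i : (k%:R * p)`_i = k%:R * p`_i.
Proof. by rewrite -polyC_natr coefCM. Qed.

Lemma zf_exp_euler a : a.+1%:R * (zf ^+ a * (tC * 'X^2 - 1)) = 'X * (zf ^+ a.+1)^`() - a.+1%:R * zf ^+ a.+1.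
Proof.
rewrite -euler_zf deriv_exp /= -mulr_natl exprS.
by ring.
Qed.

Lemma euler_zf_exp a : 'X * (zf ^+ a)^`() - a%:R * zf ^+ a =
  a%:R * (zf ^+ a.-1 * (tC * 'X^2 - 1)).
Proof.
case: a => [|a]; last by rewrite zf_exp_euler.
by rewrite expr0 -polyC1 derivC mulr0 !mul0r subrr.
Qed.

Lemma euler_Xn n : 'X * ('X^n)^`() = n%:R * 'X^n :> {poly A}.
Proof.
case: n => [|n]; first by rewrite expr0 -polyC1 derivC mul0r mulr0.
by rewrite derivXn /= -mulr_natl mulrCA exprS.
Qed.

Lemma eulerM (p q : {poly A}) (m n : nat) :
  'X * (p * q)^`() - (m + n)%:R * (p * q) =
  ('X * p^`() - m%:R * p) * q + p * ('X * q^`() - n%:R * q).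
Proof. by rewrite derivM natrD; ring. Qed.

(** The coefficient is the residue of f^a f', which is a derivative. *)
Lemma res_exact a : (zf ^+ a * (tC * 'X^2 - 1))`_a.+1 = 0.
Proof.
have /(congr1 (fun p => p`_a.+1)) := zf_exp_euler a.
rewrite natPA_coef coefB coefXM /= coef_deriv natPA_coef -[_`_ _ *+ _]mulr_natl subrr.
by move/eqP; rewrite mulf_eq0 (negbTE (natA_neq0 a)) /= => /eqP.
Qed.

(** Integration by parts: the residue of (f^(a+1))' (1 + z) is minus that of f^(a+1). *)
Lemma res_zf_1X a :
  a.+1%:R * (zf ^+ a * (tC * 'X^2 - 1) * (1 + 'X))`_a.+1 = - (zf ^+ a.+1)`_a.
Proof.
rewrite mulrDr mulr1 coefD coefMX /= mulrDr res_exact mulr0 add0r -natPA_coef.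
rewrite zf_exp_euler coefB natPA_coef coefXM; case: a => [|a] /=.
  by rewrite sub0r mul1r.
by rewrite coef_deriv -[_`_ _ *+ _]mulr_natl [a.+2%:R]mulrS; ring.
Qed.

(* [resF k] is the residue of f^k. The polynomial part of f^k (1 + z) is
   [sum_(a <= k) phi (k - a) f^a]. *)
Definition resF k : A := if k is k'.+1 then (zf ^+ k)`_k' else 0.
Definition phi k : A := if k is k'.+1 then (k%:R^-1)%:P * resF k else 1.

Lemma phiE k : k.+1%:R * phi k.+1 = resF k.+1.
Proof.
by rewrite /phi mulrA -polyC_natr -polyCM mulfV ?pnatr_eq0 // polyC1 mul1r.
Qed.

Lemma coef0_zf_exp k : (zf ^+ k)`_0 = 1.
Proof. by rewrite -horner_coef0 horner_exp /zf !hornerE /= expr1n. Qed.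

(** Divided by z^k, the remainder is z S, free of negative powers and of a constant term.
    Multiplying by f turns it into S zf, whose constant term is the coefficient to be added at the
    next step. *)
Lemma poly_part k : exists S : {poly A},
  zf ^+ k * (1 + 'X) - \sum_(a < k.+1) (phi (k - a))%:P * ('X^(k - a) * zf ^+ a)
   = 'X^(k.+1) * S.
Proof.
elim: k => [|k [S hS]].
  by exists 1; rewrite big_ord_recl big_ord0 /= expr0 expr1 polyC1; ring.
(* The identity is multiplied by f' and residues are taken. The sum disappears by [res_exact], z S
   f' contributes -S(0), and f^k f' (1 + z) is integrated by parts. *)
have S0 : S`_0 = phi k.+1.
  set w := tC * 'X^2 - 1.
  have sum0 : ((\sum_(a < k.+1) (phi (k - a))%:P * ('X^(k - a) * zf ^+ a)) * w)`_k.+1 = 0.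
    rewrite mulr_suml coef_sum; apply: big1 => -[a ha] _ /=.
    rewrite -mulrA coefCM -mulrA coefXnM ifF; last by lia.
    have -> : (k.+1 - (k - a) = a.+1)%N by lia.
    by rewrite res_exact mulr0.
  have h1 : (zf ^+ k * (1 + 'X) * w)`_k.+1 = ('X^(k.+1) * S * w)`_k.+1.
    by rewrite -hS mulrBl coefB sum0 subr0.
  have h2 : ('X^(k.+1) * S * w)`_k.+1 = - S`_0.
    rewrite -mulrA coefXnM ltnn subnn /w mulrBr mulr1 coefB.
    by rewrite mulrA coefMXn sub0r.
  have h : k.+1%:R * S`_0 = resF k.+1.
    rewrite -[S`_0]opprK -h2 -h1 mulrN -[resF _]opprK; congr (- _).
    by rewrite -mulrA [(1 + 'X) * w]mulrC mulrA /w res_zf_1X.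
  by apply: (mulfI (natA_neq0 k)); rewrite phiE h.
have [S' hS'] : exists S', S * zf - (phi k.+1)%:P = 'X * S'.
  have : root (S * zf - (phi k.+1)%:P) 0.
    by rewrite /root horner_coef0 coefB coefC /= coefM big_ord_recl big_ord0 /= addr0 S0 -[zf]expr1 coef0_zf_exp mulr1 subrr.
  move/factor_theorem=> [q ->]; exists q.
  by rewrite subr0 mulrC.
exists S'.
rewrite big_ord_recr /= subnn expr0 mul1r polyC1.
rewrite (_ : 'X^(k.+2) * S' = 'X^(k.+1) * ('X * S')); last by rewrite exprSr mulrA.
rewrite -hS'.
have -> : \sum_(i < k.+1) (phi (k.+1 - i))%:P * ('X^(k.+1 - i) * zf ^+ i)
  = (\sum_(a < k.+1) (phi (k - a))%:P * ('X^(k - a) * zf ^+ a)) * zf + (phi k.+1)%:P * 'X^(k.+1)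
    - zf ^+ k.+1.
  apply/eqP; rewrite eq_sym subr_eq eq_sym; apply/eqP.
  have e : \sum_(i < k.+2) (phi (k.+1 - i))%:P * ('X^(k.+1 - i) * zf ^+ i) =
     \sum_(i < k.+1) (phi (k.+1 - i))%:P * ('X^(k.+1 - i) * zf ^+ i) + zf ^+ k.+1.
    by rewrite big_ord_recr /= subnn expr0 polyC1 !mul1r.
  rewrite -e big_ord_recl /= subn0 expr0 mulr1 addrC; congr (_ + _).
  rewrite mulr_suml; apply: eq_bigr => i _.
  by rewrite /bump /= add1n subSS exprS; ring.
have -> : 'X^(k.+1) * (S * zf - (phi k.+1)%:P) = ('X^(k.+1) * S) * zf - 'X^(k.+1) * (phi k.+1)%:P by ring.
by rewrite -hS exprS; ring.
Qed.

(* The limit of N^(-k-1) E p_k at time t. *)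
Definition mlim k : A :=
  (k.+1%:R^-1)%:P * ((1 + 'X) ^+ k * (1 + tC * 'X) ^+ k.+1)`_k.

Lemma natinvK k (a : A) : k.+1%:R * ((k.+1%:R^-1)%:P * a) = a.
Proof. by rewrite mulrA -polyC_natr -polyCM mulfV ?pnatr_eq0 // polyC1 mul1r. Qed.

Lemma coef_eq0_of_1DX p q m : (1 + 'X) * p = 'X^m * q ->
  forall i, (i < m)%N -> p`_i = 0.
Proof.
move=> h i hi; have e j : (j < m)%N -> ((1 + 'X) * p)`_j = 0.
  by move=> hj; rewrite h coefXnM hj.
elim: i hi => [|i IH] hi; have := e _ hi; rewrite mulrDl mul1r coefD coefXM /=.
  by rewrite addr0.
by rewrite IH ?addr0 //; apply: ltnW.
Qed.

(** This comes from dividing [poly_part] by 1 + z, a unit among power series: [L] is the quotient,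
    and its coefficient of index m vanishes. It is the limit of [ph_rec], so it identifies the limit
    of [ph] as [phi]. *)
Lemma phi_rec m :
  m%:R * phi m = \sum_(k < m) k.+1%:R * mlim k * phi (m - k.+1).
Proof.
case: m => [|m]; first by rewrite big_ord0 mul0r.
rewrite phiE /resF.
have [S hS] := poly_part m.+1.
pose L : {poly A} := zf ^+ m.+1 - \sum_(a < m.+1) (phi (m - a))%:P *
   ('X^(m - a) * ((1 + 'X) ^+ a * (1 + tC * 'X) ^+ a.+1)).
have hL : (1 + 'X) * L = 'X^(m.+1) * ((phi m.+1)%:P + 'X * S).
  rewrite mulrBr mulr_sumr.
  have -> : \sum_(i < m.+1) (1 + 'X) * ((phi (m - i))%:P *
     ('X^(m - i) * ((1 + 'X) ^+ i * (1 + tC * 'X) ^+ i.+1)))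
    = \sum_(i < m.+1) (phi (m - i))%:P * ('X^(m - i) * zf ^+ i.+1).
    apply: eq_bigr => i _; rewrite /zf [in RHS]exprMn [in RHS]exprS; ring.
  move: hS; rewrite big_ord_recl /= subn0 expr0 mulr1.
  under eq_bigr do rewrite /bump /= add1n subSS.
  move=> hS; rewrite mulrDr [in RHS]mulrA -[in RHS]exprSr -hS; ring.
have := coef_eq0_of_1DX hL (ltnSn m).
rewrite coefB coef_sum => /eqP; rewrite subr_eq0 => /eqP ->.
apply: eq_bigr => i _; rewrite coefCM coefXnM ifF; last by lia.
have -> : (m - (m - i) = i)%N by have := ltn_ord i; lia.
by rewrite subSS /mlim natinvK mulrC.
Qed.

Lemma mlim0 : mlim 0 = 1.
Proof.
rewrite /mlim expr0 mul1r expr1 coefD coefMX coef1 /= addr0 mulr1.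
by rewrite invr1 polyC1.
Qed.

Lemma phi1 : phi 1 = 1.
Proof. by have := phi_rec 1; rewrite big_ord1 mlim0 !mul1r. Qed.

(** The limit equation for the means: the jump of p_k is k y^(k-1) to leading order, and [phi k] is
    the limiting mean of y^(k-1). *)
Lemma deriv_mlim k : (mlim k)^`() = k%:R * phi k.
Proof.
rewrite /mlim derivM derivC mul0r add0r -coef_dt dtM dtXn dt_1tX.
have dt1X n : dt ((1 + 'X) ^+ n) = 0 :> {poly A}.
  by case: n => [|n]; rewrite ?expr0 ?dt1 // dtXn dtD dt1 dtX addr0 !mulr0.
rewrite dt1X mul0r add0r.
rewrite (_ : _ * (k.+1%:R * _) = k.+1%:R * (zf ^+ k * 'X)); last by rewrite /zf exprMn; ring.
rewrite natPA_coef mulrCA natinvK coefMX.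
by case: k => [|k]; rewrite ?mul0r // phiE.
Qed.

Lemma coefM_at0 p q : (forall i, (p`_i).[0] = (q`_i).[0]) ->
   forall r i, ((p * r)`_i).[0] = ((q * r)`_i).[0].
Proof.
move=> h r i; rewrite !coefM !horner_sum; apply: eq_bigr => j _.
by rewrite !hornerM h.
Qed.

Lemma coef_exp_at0 (p q : {poly A}) : (forall i, (p`_i).[0] = (q`_i).[0]) ->
   forall k i, ((p ^+ k)`_i).[0] = ((q ^+ k)`_i).[0].
Proof.
move=> h; elim=> [|k IH] i; first by rewrite !expr0.
by rewrite !exprS (coefM_at0 h) mulrC (coefM_at0 IH) mulrC.
Qed.

Lemma coef_1tX_at0 i : ((1 + tC * 'X)`_i).[0] = ((1 : {poly A})`_i).[0].
Proof.
rewrite coefD coefCM hornerD coefX.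
by case: eqP => _; rewrite ?mulr1 ?mulr0 ?hornerX ?horner0 addr0.
Qed.

Lemma coef_zf_at0 i : (zf`_i).[0] = ((1 + 'X : {poly A})`_i).[0].
Proof. by rewrite /zf mulrC (coefM_at0 coef_1tX_at0) mul1r. Qed.

Lemma coef_1X k i : ((1 + 'X : {poly A}) ^+ k)`_i = 'C(k, i)%:R.
Proof.
rewrite addrC exprD1n coef_sum; case: (ltnP i k.+1) => hi.
  rewrite (bigD1 (Ordinal hi)) //= big1 ?addr0 => [|j].
    by rewrite coefMn coefXn eqxx.
  by rewrite -val_eqE /= eq_sym => /negbTE hj; rewrite coefMn coefXn hj mul0rn.
rewrite bin_small // big1 // => j _; rewrite coefMn coefXn gtn_eqF ?mul0rn //.
by have := ltn_ord j; lia.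
Qed.

Lemma mlim_at0 k : (mlim k).[0] = k.+1%:R^-1.
Proof.
rewrite /mlim hornerM hornerC mulrC mulrC.
rewrite [_ ^+ k * _]mulrC (coefM_at0 (coef_exp_at0 coef_1tX_at0 _)) expr1n mul1r.
by rewrite coef_1X binn hornerE ?mulr1.
Qed.

(* The sum comes from expanding (z - w)^-2 in |z| < |w|. *)
Definition Cov k l : A :=
  \sum_(m < k) m.+1%:R * ((zf ^+ k)`_(k - m.+1) * (zf ^+ l)`_(l + m.+1))
  - 'X * (resF k * resF l).

(* [drift k a] is the coefficient of the a-th fluctuation in the drift of the k-th,
   [qvar k l] the rate of the quadratic covariation. *)
Definition drift k a : A := if (0 < a < k)%N then k%:R * phi (k - a.+1) else 0.

Lemma dt_zf_exp k : dt (zf ^+ k.+1) = k.+1%:R * ('X * (zf ^+ k * (1 + 'X))).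
Proof. by rewrite dtXn dt_zf; ring. Qed.

Lemma coef_sumXg (c : nat -> A) k i :
  (\sum_(a < k) (c a)%:P * ('X^(k - a) * zf ^+ a))`_i =
  \sum_(a < k) if (i < k - a)%N then 0 else c a * (zf ^+ a)`_(i - (k - a)).
Proof.
rewrite coef_sum; apply: eq_bigr => a _; rewrite coefCM coefXnM.
by case: ifP => _; rewrite ?mulr0.
Qed.

(** * Residues against the remainder of the polynomial part *)

Section Remainder.
Variables (L : nat) (S : {poly A}).
Hypothesis hS :
  zf ^+ L * (1 + 'X) - \sum_(a < L.+1) (phi (L - a))%:P * ('X^(L - a) * zf ^+ a)
   = 'X^(L.+1) * S.

Lemma dt_zf_exp_split : dt (zf ^+ L.+1) =
  \sum_(a < L.+1) (L.+1%:R * phi (L - a))%:P * ('X^(L.+1 - a) * zf ^+ a)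
   + L.+1%:R * ('X^(L.+2) * S).
Proof.
rewrite dt_zf_exp -[zf ^+ L * _](subrK (\sum_(a < L.+1) (phi (L - a))%:P * ('X^(L - a) * zf ^+ a))) hS.
rewrite addrC !mulrDr; congr (_ + _); last by rewrite !exprS; ring.
rewrite !mulr_sumr; apply: eq_bigr => a _.
have -> : (L.+1 - a = (L - a).+1)%N by have := ltn_ord a; lia.
by rewrite polyCM polyC_natr exprS; ring.
Qed.

(** The operator z d/dz carried over to numerators with denominator z^L. *)
Let Op (r : {poly A}) := 'X * r^`() - L%:R * r.

Lemma Op_r (p : {poly A}) k : (zf ^+ k.+1 * Op ('X^(L.+1) * p))`_(k.+1 + L) =
  \sum_(m < k.+1) m.+1%:R * ((zf ^+ k.+1)`_(k - m) * p`_m).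
Proof.
have -> : Op ('X^(L.+1) * p) = 'X^(L.+1) * ('X * p)^`().
  rewrite /Op !derivM derivXn derivX /= -mulr_natl !exprS mulrSr.
  by case: (L) => [|n]; rewrite /= ?exprS; ring.
rewrite mulrCA coefXnM ifF; last by lia.
have -> : (k.+1 + L - L.+1 = k)%N by lia.
rewrite mulrC coefM; apply: eq_bigr => m _.
by rewrite coef_deriv coefXM /= -[_ *+ m.+1]mulr_natl; ring.
Qed.

Lemma Op_Xg a k : (a <= L)%N -> (zf ^+ k.+1 * Op ('X^(L - a) * zf ^+ a))`_(k.+1 + L) = 0.
Proof.
move=> ha.
have -> : Op ('X^(L - a) * zf ^+ a) = a%:R * ('X^(L - a) * (zf ^+ a.-1 * (tC * 'X^2 - 1))).
  rewrite /Op -[in L%:R](subnK ha) eulerM euler_Xn subrr mul0r add0r euler_zf_exp.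
  by rewrite mulrCA.
case: a ha => [|a] ha; first by rewrite mul0r mulr0 coef0.
rewrite mulrCA natPA_coef mulrCA coefXnM ifF; last by lia.
rewrite mulrA -exprD /=.
have -> : (k.+1 + L - (L - a.+1) = (k.+1 + a).+1)%N by lia.
by rewrite res_exact mulr0.
Qed.

Lemma Op_g1X k : (k.+1 + L)%:R * (zf ^+ k.+1 * Op (zf ^+ L * (1 + 'X)))`_(k.+1 + L)
  = k.+1%:R * resF (k.+1 + L).
Proof.
have -> : Op (zf ^+ L * (1 + 'X)) =
   L%:R * (zf ^+ L.-1 * (tC * 'X^2 - 1) * (1 + 'X)) + zf ^+ L * 'X.
  rewrite /Op -[in L%:R](addn0 L) eulerM addn0 euler_zf_exp derivD derivX -(polyC1 A) derivC.
  by rewrite polyC1 mul0r add0r subr0 mulr1 -!mulrA.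
rewrite mulrDr coefD (mulrA (zf ^+ k.+1) (zf ^+ L) 'X) -exprD coefMX /=.
have -> : zf ^+ k.+1 * (L%:R * (zf ^+ L.-1 * (tC * 'X^2 - 1) * (1 + 'X))) =
   L%:R * (zf ^+ (k + L) * (tC * 'X^2 - 1) * (1 + 'X)).
  case: (L) => [|n]; first by rewrite !mul0r mulr0.
  rewrite /= addnS -addSn exprD; set w := tC * _ - 1.
  by rewrite !mulrA [zf ^+ _ * _%:R]mulrC.
rewrite natPA_coef addSn mulrDr mulrCA res_zf_1X /= mulrS natrD; ring.
Qed.

(** The left side is the residue of f^(k+1) (z S)'. Expressing z S by [poly_part], the powers of f
    contribute nothing, since f^(k+1) (f^a)' is exact; f^L (1 + z) is treated by parts in
    [Op_g1X]. *)
Lemma remainder k :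
  \sum_(m < k.+1) m.+1%:R * ((zf ^+ k.+1)`_(k - m) * S`_m) = k.+1%:R * phi (k.+1 + L).
Proof.
rewrite -Op_r -hS.
have OpB p q : Op (p - q) = Op p - Op q by rewrite /Op derivB; ring.
have OpS (c : nat -> A) n (r : nat -> {poly A}) :
    Op (\sum_(a < n) (c a)%:P * r a) = \sum_(a < n) (c a)%:P * Op (r a).
  elim: n => [|n IH]; first by rewrite !big_ord0 /Op deriv0 !mulr0 subr0.
  rewrite !big_ord_recr /= -IH /Op derivD derivM derivC; ring.
rewrite OpB (OpS (fun a => phi (L - a)) _ (fun a => 'X^(L - a) * zf ^+ a)) mulrBr coefB mulr_sumr coef_sum [X in _ - X]big1 => [|[a ha] _ /=].
  rewrite subr0; apply: (mulfI (natA_neq0 (k + L))).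
  by rewrite -addSn Op_g1X mulrCA -phiE.
by rewrite mulrCA coefCM Op_Xg ?mulr0.
Qed.

End Remainder.

Lemma Cov0l l : Cov 0 l = 0.
Proof. by rewrite /Cov big_ord0 mul0r mulr0 subrr. Qed.

Lemma resF_dt k : (resF k)^`() = \sum_(a < k) k%:R * phi (k - a.+1) * resF a.
Proof.
case: k => [|L]; first by rewrite /= derivC big_ord0.
have [S hS] := poly_part L.
rewrite /resF -coef_dt (dt_zf_exp_split hS) coefD natPA_coef coefXnM ifT; last by lia.
rewrite mulr0 addr0 (coef_sumXg (fun a => L.+1%:R * phi (L - a))).
apply: eq_bigr => -[a ha] _ /=; rewrite subSS; case: a ha => [|a] ha.
  by rewrite ifT ?mulr0 //; lia.
by rewrite ifF; [congr (_ * _`_ _); lia|lia].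
Qed.

(** As d/dt f^(k+1) = (k+1) f^k (1 + z), [poly_part] expands it in powers of f plus a multiple of z.
    That multiple of z has no effect on negative powers, but on the positive powers of the second
    factor it contributes the term with [phi (k.+1 + l)], by [remainder]. The product of the two
    [phi] comes from differentiating the explicit t in [Cov]. *)
Lemma Cov_dt k l :
  (Cov k.+1 l.+1)^`() = \sum_(a < k.+1) drift k.+1 a * Cov a l.+1
     + \sum_(a < l.+1) drift l.+1 a * Cov k.+1 a
     + k.+1%:R * l.+1%:R * (phi (k.+1 + l) - phi k.+1 * phi l.+1).
Proof.
pose N k l := \sum_(m < k) m.+1%:R * ((zf ^+ k)`_(k - m.+1) * (zf ^+ l)`_(l + m.+1)).
pose d k a := k%:R * phi (k - a.+1).
(* [drift] is 0 at a = 0 although the expansion has a term there; that term multiplies a covariance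
   with index 0, which vanishes. *)
have driftE j i (c : nat -> A) : (c 0 = 0) ->
    \sum_(a < i) drift j a * c a = \sum_(a < i) (if (a < j)%N then d j a else 0) * c a.
  by move=> c0; apply: eq_bigr => -[[|a] ha] _ /=; rewrite /drift ?c0 ?mulr0.
have N0 j : N j 0 = 0.
  by rewrite /N big1 // => m _; rewrite expr0 add0n coef1 /= !mulr0.
have R0 j : Cov j 0 = 0 by rewrite /Cov -/(N j 0) N0 !mulr0 subrr.
rewrite (driftE _ _ (fun a => Cov a l.+1) (Cov0l _)) (driftE _ _ (Cov k.+1) (R0 _)).
have [S hS] := poly_part k; have [T hT] := poly_part l.
have dN : (N k.+1 l.+1)^`() = \sum_(a < k.+1) d k.+1 a * N a l.+1
   + \sum_(a < l.+1) d l.+1 a * N k.+1 a + k.+1%:R * l.+1%:R * phi (k.+1 + l).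
  rewrite /N raddf_sum /=.
  rewrite (eq_bigr (fun m : 'I_k.+1 =>
      m.+1%:R * ((dt (zf ^+ k.+1))`_(k - m) * (zf ^+ l.+1)`_(l.+1 + m.+1))
    + m.+1%:R * ((zf ^+ k.+1)`_(k - m) * (dt (zf ^+ l.+1))`_(l.+1 + m.+1)))); last first.
    move=> m _; rewrite subSS !coef_dt derivM -polyC_natr derivC mul0r add0r derivM.
    by rewrite mulrDr.
  rewrite big_split /= -addrA; congr (_ + _).
    under eq_bigr => m _.
      rewrite (dt_zf_exp_split hS) coefD natPA_coef coefXnM ifT; last by lia.
      rewrite mulr0 addr0 (coef_sumXg (fun a => k.+1%:R * phi (k - a))) mulr_suml mulr_sumr.
      over.
    rewrite exchange_big /=; apply: eq_bigr => -[a ha] _ /=.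
    rewrite mulr_sumr (big_ord_widen k.+1 (fun m =>
       d k.+1 a * (m.+1%:R * ((zf ^+ a)`_(a - m.+1) * (zf ^+ l.+1)`_(l.+1 + m.+1))))); last by lia.
    rewrite [in RHS]big_mkcond /=; apply: eq_bigr => -[m hm] _ /=.
    case: (ltnP m a) => h.
      rewrite ifF; last by lia.
      rewrite /d subSS; have -> : (k - m - (k.+1 - a) = a - m.+1)%N by lia.
      by ring.
    by rewrite ifT ?mul0r ?mulr0 //; lia.
  have -> : k.+1%:R * l.+1%:R * phi (k.+1 + l) =
     \sum_(m < k.+1) m.+1%:R * ((zf ^+ k.+1)`_(k - m) * (l.+1%:R * T`_m)).
    rewrite mulrAC [_ * l.+1%:R]mulrC -(remainder hT) mulr_sumr.
    by apply: eq_bigr => m _; ring.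
  under eq_bigr => m _.
    rewrite (dt_zf_exp_split hT) coefD natPA_coef coefXnM ifF; last by lia.
    rewrite (_ : l.+1 + m.+1 - l.+2 = m)%N; last by lia.
    rewrite (coef_sumXg (fun a => l.+1%:R * phi (l - a))) mulrDr mulrDr.
    over.
  rewrite big_split /=; congr (_ + _).
  under eq_bigr do rewrite !mulr_sumr.
  rewrite exchange_big /=; apply: eq_bigr => -[a ha] _ /=.
  rewrite mulr_sumr; apply: eq_bigr => -[m hm] _ /=.
  rewrite ifF; last by lia.
  have -> : (l.+1 + m.+1 - (l.+1 - a) = a + m.+1)%N by lia.
  rewrite /d subSS.
  by ring.
have -> : \sum_(a < k.+1) (if (a < k.+1)%N then d k.+1 a else 0) * Cov a l.+1 =
   \sum_(a < k.+1) d k.+1 a * N a l.+1 - 'X * ((resF k.+1)^`() * resF l.+1).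
  rewrite resF_dt mulr_suml mulr_sumr -sumrB; apply: eq_bigr => a _.
  by rewrite ltn_ord /Cov -/(N a l.+1) /d; ring.
have -> : \sum_(a < l.+1) (if (a < l.+1)%N then d l.+1 a else 0) * Cov k.+1 a =
   \sum_(a < l.+1) d l.+1 a * N k.+1 a - 'X * (resF k.+1 * (resF l.+1)^`()).
  rewrite [(resF l.+1)^`()]resF_dt !mulr_sumr -sumrB; apply: eq_bigr => a _.
  by rewrite ltn_ord /Cov -/(N k.+1 a) /d; ring.
rewrite {1}/Cov -/(N k.+1 l.+1) derivB derivM derivX mul1r dN [(resF _ * resF _)^`()]derivM.
by rewrite -!phiE; ring.
Qed.

(** At t = 0, f is 1 + 1/z, whose powers have no positive exponents. *)
Lemma Cov_at0 k l : (Cov k l).[0] = 0.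
Proof.
rewrite /Cov hornerD hornerN hornerM hornerX mul0r subr0 horner_sum big1 // => m _.
rewrite !hornerM (coef_exp_at0 coef_zf_at0 l) coef_1X bin_small ?mulr0 //; last by lia.
by rewrite -polyC0 hornerC !mulr0.
Qed.

End Laurent.

(** * Approximation at rate 1/N *)

Section Approx.
Variables (R : realFieldType) (c : R).
Hypothesis c_ge0 : 0 <= c.

Definition invn (N : nat) : R := N%:R^-1.
Definition dom (N n : nat) := (0 < N)%N && (n%:R <= c * N%:R ^+ 2).
Definition tm (N n : nat) : R := n%:R * invn N ^+ 2.

Lemma eps_ge0 N : 0 <= invn N. Proof. by rewrite /invn invr_ge0. Qed.
Lemma eps_le1 N : invn N <= 1.
Proof. by case: N => [|N]; rewrite /invn ?invr0 // invf_le1 ?ler1n ?ltr0n. Qed.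
Lemma Neps N : (0 < N)%N -> N%:R * invn N = 1.
Proof. by move=> h; rewrite mulfV // pnatr_eq0 -lt0n. Qed.

Lemma tm_itv N n : dom N n -> 0 <= tm N n <= c.
Proof.
case/andP => hN hn; rewrite /tm mulr_ge0 ?exprn_ge0 ?eps_ge0 //=.
have h : 0 < (N%:R : R) ^+ 2 by rewrite exprn_gt0 // ltr0n.
by rewrite /invn exprVn ler_pdivrMr.
Qed.

Lemma domS N n : dom N n.+1 -> dom N n.
Proof.
case/andP=> hN hn; rewrite /dom hN /=; apply: le_trans hn.
by rewrite ler_nat.
Qed.

Lemma poly_bounded (G : {poly R}) :
  exists2 M, 0 <= M & forall x, 0 <= x <= c -> `|G.[x]| <= M.
Proof.
elim/poly_ind: G => [|G a [M M0 hM]].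
  by exists 0 => // x _; rewrite horner0 normr0.
exists (M * c + `|a|); first by rewrite addr_ge0 ?mulr_ge0.
move=> x hx; rewrite hornerMXaddC; apply: (le_trans (ler_normD _ _)).
rewrite lerD2r normrM; apply: ler_pM => //; first exact: hM.
by case/andP: hx => h1 h2; rewrite ger0_norm.
Qed.

Lemma poly_taylor (G : {poly R}) : exists2 K, 0 <= K & forall x h,
  0 <= x -> 0 <= h -> x + h <= c -> `|G.[x + h] - G.[x] - h * G^`().[x]| <= K * h ^+ 2.
Proof.
elim/poly_ind: G => [|G a [K K0 hK]].
  by exists 0 => // x h _ _ _; rewrite deriv0 !horner0 mulr0 !subr0 normr0 mul0r.
have [M M0 hM] := poly_bounded G^`().
exists (K * c + M); first by rewrite addr_ge0 ?mulr_ge0.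
move=> x h x0 h0 xh; rewrite derivMXaddC !hornerMXaddC hornerD hornerMX.
set g1 := G.[x + h]; set g0 := G.[x]; set g' := G^`().[x].
have -> : g1 * (x + h) + a - (g0 * x + a) - h * (g0 + g' * x) =
   (g1 - g0 - h * g') * (x + h) + g' * h ^+ 2 by ring.
apply: (le_trans (ler_normD _ _)); rewrite [X in _ <= X]mulrDl; apply: lerD.
  rewrite normrM mulrAC; apply: ler_pM => //; first exact: hK.
  by rewrite ger0_norm // addr_ge0.
rewrite normrM [`|h ^+ 2|]ger0_norm ?exprn_ge0 // ler_wpM2r ?exprn_ge0 //.
by apply: hM; rewrite x0 /=; apply: le_trans xh; rewrite lerDl.
Qed.

(** The bound is uniform over all n up to c N^2, because values at time c are obtained by
    integrating over all earlier times. *)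
Definition approx (g : nat -> nat -> R) (G : {poly R}) :=
  exists2 K, 0 <= K & forall N n, dom N n -> `|g N n - G.[tm N n]| <= K * invn N.

Lemma approx_ext g h G : approx g G -> (forall N n, dom N n -> g N n = h N n) -> approx h G.
Proof. by case=> K K0 hK e; exists K => // N n d; rewrite -e //; apply: hK. Qed.

Lemma approx_cst a : approx (fun _ _ => a) a%:P.
Proof. by exists 0 => // N n _; rewrite hornerC subrr normr0 mul0r. Qed.

Lemma approx0 : approx (fun _ _ => 0) 0.
Proof. exact: approx_cst. Qed.

Lemma approx1 : approx (fun _ _ => 1) 1.
Proof. exact: approx_cst. Qed.

Lemma approxD g h G H : approx g G -> approx h H -> approx (fun N n => g N n + h N n) (G + H).
Proof.
case=> K K0 hK [L L0 hL]; exists (K + L); first exact: addr_ge0.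
move=> N n d; rewrite hornerD mulrDl.
rewrite (_ : _ - _ = (g N n - G.[tm N n]) + (h N n - H.[tm N n])); last by ring.
by apply: (le_trans (ler_normD _ _)); apply: lerD; [apply: hK | apply: hL].
Qed.

Lemma approx_bounded g G : approx g G -> exists2 M, 0 <= M & forall N n, dom N n -> `|g N n| <= M.
Proof.
case=> K K0 hK; have [M M0 hM] := poly_bounded G.
exists (K + M); first exact: addr_ge0.
move=> N n d; rewrite -[g N n](subrK G.[tm N n]).
apply: (le_trans (ler_normD _ _)); apply: lerD; last exact/hM/tm_itv.
by apply: (le_trans (hK _ _ d)); rewrite ler_piMr ?eps_le1.
Qed.

Lemma approxM g h G H : approx g G -> approx h H -> approx (fun N n => g N n * h N n) (G * H).
Proof.
move=> ag [L L0 hL]; have [M M0 hM] := approx_bounded ag.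
case: ag => K K0 hK; have [M' M'0 hM'] := poly_bounded H.
exists (M * L + K * M'); first by rewrite addr_ge0 ?mulr_ge0.
move=> N n d; rewrite hornerM.
rewrite (_ : _ - _ = g N n * (h N n - H.[tm N n]) + (g N n - G.[tm N n]) * H.[tm N n]); last by ring.
apply: (le_trans (ler_normD _ _)); rewrite [X in _ <= X]mulrDl !normrM; apply: lerD.
  by rewrite -mulrA; apply: ler_pM => //; [exact: hM | exact: hL].
rewrite [K * M' * _]mulrAC; apply: ler_pM => //; first exact: hK.
exact/hM'/tm_itv.
Qed.

Lemma approx_eps : approx (fun N _ => invn N) 0.
Proof. by exists 1 => // N n _; rewrite horner0 subr0 mul1r ger0_norm ?eps_ge0. Qed.

Lemma approx_epsM g G : approx g G -> approx (fun N n => invn N * g N n) 0.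
Proof. by move=> h; rewrite -(mul0r G); apply: approxM h; apply: approx_eps. Qed.

Lemma approx_lim0 g G G' : approx g G -> G = G' -> approx g G'.
Proof. by move=> h <-. Qed.

Lemma approxN g G : approx g G -> approx (fun N n => - g N n) (- G).
Proof.
move=> h; apply: (approx_lim0 (G := (-1)%:P * G)); last by rewrite polyCN mulN1r.
by apply: approx_ext (approxM (approx_cst (-1)) h) _ => N n _; rewrite mulN1r.
Qed.

Lemma approx_sum (I : Type) (r : seq I) (g : I -> nat -> nat -> R) G :
  (forall i, approx (g i) (G i)) ->
  approx (fun N n => \sum_(i <- r) g i N n) (\sum_(i <- r) G i).
Proof.
move=> h; elim: r => [|i r IH].
  by rewrite big_nil; apply: approx_ext approx0 _ => N n _; rewrite big_nil.
rewrite big_cons; apply: approx_ext (approxD (h i) IH) _ => N n _.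
by rewrite big_cons.
Qed.

(** Error analysis of an Euler scheme with step N^-2. Each step adds at most K N^-3 from the slope
    and T N^-4 from Taylor's formula, and there are at most c N^2 steps. The slope is approximated
    independently of g, so errors add up without amplification. *)
Lemma approx_int g h G :
  (forall N n, dom N n.+1 -> g N n.+1 = g N n + invn N ^+ 2 * h N n) ->
  approx h G^`() ->
  (exists2 K, 0 <= K & forall N, (0 < N)%N -> `|g N 0 - G.[0]| <= K * invn N) ->
  approx g G.
Proof.
move=> hg [K K0 hK] [L L0 hL]; have [T T0 hT] := poly_taylor G.
exists (L + (K + T) * c); first by rewrite addr_ge0 ?mulr_ge0 ?addr_ge0.
move=> N n d; suff H : `|g N n - G.[tm N n]| <= (L + (K + T) * tm N n) * invn N.
  apply: (le_trans H); rewrite ler_wpM2r ?eps_ge0 // lerD2l ler_wpM2l ?addr_ge0 //.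
  by case/andP: (tm_itv d).
elim: n d => [|n IH] d.
  by rewrite /tm mul0r mulr0 addr0; apply: hL; case/andP: d.
have d' := domS d; have {}IH := IH d'.
have tS : tm N n.+1 = tm N n + invn N ^+ 2 by rewrite /tm mulrSr mulrDl mul1r.
have [h0 _] := andP (tm_itv d'); have [_ h1] := andP (tm_itv d).
rewrite hg // tS; rewrite tS in h1.
have e0 := eps_ge0 N; have e1 := eps_le1 N.
have e20 : 0 <= invn N ^+ 2 by rewrite exprn_ge0.
have hTx := hT _ _ h0 e20 h1; have hKx := hK _ _ d'.
set e := invn N in hTx hKx IH e0 e1 e20 *; set t := tm N n in hTx hKx IH *.
set G1 := G.[t + _] in hTx *; set G0 := G.[t] in hTx IH *; set G' := _.[t] in hTx hKx.
rewrite (_ : g N n + _ - _ = (g N n - G0) + e ^+ 2 * (h N n - G') - (G1 - G0 - e ^+ 2 * G')); last by ring.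
apply: (le_trans (ler_normB _ _)).
apply: (@le_trans _ _ ((L + (K + T) * t) * e + e ^+ 2 * (K * e) + T * (e ^+ 2) ^+ 2)).
  apply: lerD => //; apply: (le_trans (ler_normD _ _)); apply: lerD => //.
  by rewrite normrM ger0_norm // ler_wpM2l.
have : T * (e ^+ 2) ^+ 2 <= T * e ^+ 3.
  by rewrite -exprM ler_wpM2l //; apply: ler_wiXn2l.
move=> h4; rewrite [X in _ <= X](_ : _ = (L + (K + T) * t) * e + e ^+ 2 * (K * e) + T * e ^+ 3); last by ring.
by rewrite lerD2l.
Qed.

End Approx.

(** * Moments along the Markov chain *)

Section WickOps.
Variable R : realFieldType.
Local Notation A := {poly R}.

(** The limiting covariance of k y^(k-1) and l y^(l-1) at a jump position y, since [phi m.+1] is the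
    limiting mean of y^m. *)
Definition qvar k l : A := k%:R * l%:R * (phi R (k + l).-1 - phi R k * phi R l).

(* [contract g W s] is the sum over j of [g s_j] times [W] at [s] without [s_j];
   the entries already passed are kept in the continuation [W], here and in
   [driftU] and [qvarU]. *)
Fixpoint contract (g : nat -> A) (W : seq nat -> A) (s : seq nat) : A :=
  if s is l :: t then g l * W t + contract g (fun r => W (l :: r)) t else 0.

Fixpoint driftU (W : seq nat -> A) (s : seq nat) : A :=
  if s is k :: t then
    \sum_(a < k) drift R k a * W ((a : nat) :: t) + driftU (fun r => W (k :: r)) t
  else 0.

Fixpoint qvarU (W : seq nat -> A) (s : seq nat) : A :=
  if s is k :: t then contract (qvar k) W t + qvarU (fun r => W (k :: r)) t else 0.

Lemma eq_contract g W W' s : (forall r, W r = W' r) -> contract g W s = contract g W' s.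
Proof.
elim: s W W' => //= l t IH W W' h; rewrite h; congr (_ + _).
by apply: IH => r.
Qed.

Lemma eq_driftU W W' s : (forall r, W r = W' r) -> driftU W s = driftU W' s.
Proof.
elim: s W W' => //= l t IH W W' h; congr (_ + _); last by apply: IH => r.
by apply: eq_bigr => a _; rewrite h.
Qed.

Lemma eq_qvarU W W' s : (forall r, W r = W' r) -> qvarU W s = qvarU W' s.
Proof.
elim: s W W' => //= l t IH W W' h; congr (_ + _); last by apply: IH => r.
exact: eq_contract.
Qed.

End WickOps.

Section Expansion.
Variables (R : comNzRingType) (e : R) (x : nat -> R) (y : nat -> {poly R}).

Definition xprod (s : seq nat) : R := \prod_(k <- s) x k.

Fixpoint d1 (s : seq nat) : {poly R} :=
  if s is k :: t then xprod t *: y k + x k *: d1 t else 0.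

Fixpoint d2 (s : seq nat) : {poly R} :=
  if s is k :: t then y k * d1 t + x k *: d2 t else 0.

Fixpoint d3 (s : seq nat) : {poly R} :=
  if s is k :: t then y k * d2 t + (x k *: d3 t + e *: (y k * d3 t)) else 0.

(** To be used with e = 1/N over a time step N^-2. The mean of [d1] is of order 1/N because the y
    are centred, so [d1] and [d2] both contribute to the limit. All orders from three on are
    collected in [d3], which therefore contains e itself. *)
Lemma prod_expand s : \prod_(k <- s) ((x k)%:P + e *: y k) =
  (xprod s)%:P + (e *: d1 s + (e ^+ 2 *: d2 s + e ^+ 3 *: d3 s)).
Proof.
elim: s => [|k t IH]; first by rewrite /xprod !big_nil /= !scaler0 !addr0.
rewrite big_cons IH /xprod big_cons -/(xprod t) /= -!mul_polyC polyCM !polyC_exp.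
by ring.
Qed.

End Expansion.

(** * Moments of an abstract chain *)

Section Model.
Variable R : realFieldType.

(** Normalised power sums equal 1 at index 0; for an arbitrary P this is imposed. *)
Definition P1 (P : nat -> R) (a : nat) : R := if a is 0 then 1 else P a.

(** The binomial expansion of sum_j (y_j^k - (y_j - 1/N)^k) in normalised power sums, see
    [Qsum_Pw]. *)
Definition Qsum (N : nat) (P : nat -> R) (k : nat) : R :=
  \sum_(r < k) (-1) ^+ r * 'C(k, r.+1)%:R * invn R N ^+ r * P1 P (k - r.+1).

(* When [P a] is N^-1 sum_j y_j^a for y = l / N, [ph N P m.+1] is the mean of y_i^m
   over the next jump position i ([key_identity]), and [jmean] extends this to
   polynomials in y_i. *)
Fixpoint phs N P m : seq R :=
  if m is m'.+1 then
    rcons (phs N P m') (m%:R^-1 * \sum_(k < m) Qsum N P k.+1 * (phs N P m')`_(m' - k))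
  else [:: 1].

Definition ph N P m : R := (phs N P m)`_m.

Lemma size_phs N P m : size (phs N P m) = m.+1.
Proof. by elim: m => //= m IH; rewrite size_rcons IH. Qed.

Lemma nth_phs N P m i : (i <= m)%N -> (phs N P m)`_i = ph N P i.
Proof.
elim: m => [|m IH]; first by rewrite leqn0 => /eqP ->.
rewrite leq_eqVlt => /orP[/eqP -> //|hi] /=.
by rewrite nth_rcons size_phs hi IH.
Qed.

Lemma ph_rec N P m :
  m%:R * ph N P m = \sum_(k < m) Qsum N P k.+1 * ph N P (m - k.+1).
Proof.
case: m => [|m]; first by rewrite big_ord0 mul0r.
rewrite /ph /= nth_rcons size_phs ltnn eqxx mulrA mulfV ?pnatr_eq0 // mul1r.
apply: eq_bigr => k _; rewrite subSS nth_phs //; exact: leq_subr.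
Qed.

Lemma Qsum1 N P : Qsum N P 1 = 1.
Proof. by rewrite /Qsum big_ord1 !expr0 !mul1r. Qed.

Lemma ph1 N P : ph N P 1 = 1.
Proof. by have := ph_rec N P 1; rewrite big_ord1 Qsum1 !mul1r. Qed.

Definition jmean N P (h : {poly R}) : R := \sum_(i < size h) h`_i * ph N P i.+1.

Lemma jmean_widen N P (h : {poly R}) n : (size h <= n)%N -> jmean N P h = \sum_(i < n) h`_i * ph N P i.+1.
Proof.
move=> hn; rewrite /jmean (big_ord_widen n (fun i => h`_i * ph N P i.+1) hn) big_mkcond /=.
by apply: eq_bigr => i _; case: ltnP => // hi; rewrite nth_default ?mul0r.
Qed.

Lemma jmeanD N P (g h : {poly R}) : jmean N P (g + h) = jmean N P g + jmean N P h.
Proof.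
pose n := maxn (size g) (size h).
rewrite (jmean_widen N P (size_polyD g h)) (@jmean_widen N P g n) ?leq_maxl //.
rewrite (@jmean_widen N P h n) ?leq_maxr // -big_split.
by apply: eq_bigr => i _; rewrite coefD mulrDl.
Qed.

Lemma jmeanZ N P a (h : {poly R}) : jmean N P (a *: h) = a * jmean N P h.
Proof.
rewrite (jmean_widen N P (size_scale_leq a h)) /jmean mulr_sumr.
by apply: eq_bigr => i _; rewrite coefZ mulrA.
Qed.

Lemma jmeanC N P a : jmean N P a%:P = a.
Proof.
by rewrite (@jmean_widen N P _ 1) ?size_polyC_leq1 // big_ord1 coefC ph1 mulr1.
Qed.

(** The difference quotient N ((y + 1/N)^a - y^a), see [jump_horner]. *)
Definition jump N a : {poly R} :=
  \sum_(r < a) ('C(a, r.+1)%:R * invn R N ^+ r) *: 'X^(a - r.+1).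

Definition shiftP N (P : nat -> R) (y : R) : nat -> R :=
  fun a => P a + invn R N ^+ 2 * (jump N a).[y].

(* [E N n] abstracts the expectation of functions of the rescaled power sums after
   n boxes have been added. *)
Record chain_expectation (E : nat -> nat -> ((nat -> R) -> R) -> R) : Prop := {
  E_lin : forall N n a F G, (0 < N)%N ->
    E N n (fun P => a * F P + G P) = a * E N n F + E N n G;
  E_ext : forall N n F G, (forall P, F P = G P) -> E N n F = E N n G;
  E_one : forall N n, (0 < N)%N -> E N n (fun _ => 1) = 1;
  E_init : forall N F, (0 < N)%N ->
    E N 0 F = F (fun a => invn R N ^+ a.+1 * \sum_(i < N) i%:R ^+ a);
  E_step : forall N n F (H : (nat -> R) -> {poly R}), (0 < N)%N ->
    (forall P y, F (shiftP N P y) = (H P).[y]) ->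
    E N n.+1 F = E N n (fun P => jmean N P (H P)) }.

Variables (c : R) (c_ge0 : 0 <= c).
Variables (E : nat -> nat -> ((nat -> R) -> R) -> R) (hE : chain_expectation E).

Definition RV := nat -> nat -> (nat -> R) -> R.
Local Notation apx := (approx c).
Local Notation dom := (dom c).
Local Notation eps := (invn R).

Lemma dom_gt0 N n : dom N n -> (0 < N)%N. Proof. by case/andP. Qed.

Lemma E_eq N n F G : (forall P, F P = G P) -> E N n F = E N n G.
Proof. exact: (E_ext hE). Qed.

Lemma E_next N n F (H : (nat -> R) -> {poly R}) : (0 < N)%N ->
  (forall P y, F (shiftP N P y) = (H P).[y]) ->
  E N n.+1 F = E N n (fun P => jmean N P (H P)).
Proof. exact: (E_step hE). Qed.

Lemma E_D N n F G : (0 < N)%N -> E N n (fun P => F P + G P) = E N n F + E N n G.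
Proof.
move=> hN; rewrite -[E N n F]mul1r -(E_lin hE) //; apply: E_eq => P.
by rewrite mul1r.
Qed.

Lemma E_0 N n : (0 < N)%N -> E N n (fun _ => 0) = 0.
Proof.
move=> hN; have := E_D n (fun _ => 0) (fun _ => 0) hN.
rewrite (@E_eq _ _ _ (fun _ => 0)) => [|P]; last by rewrite addr0.
by move/eqP; rewrite eq_sym -subr_eq0 addrK => /eqP.
Qed.

Lemma E_Z N n a F : (0 < N)%N -> E N n (fun P => a * F P) = a * E N n F.
Proof.
move=> hN; rewrite -[RHS]addr0 -(E_0 n hN) -(E_lin hE) //; apply: E_eq => P.
by rewrite addr0.
Qed.

Lemma E_C N n a : (0 < N)%N -> E N n (fun _ => a) = a.
Proof.
move=> hN; rewrite -[RHS]mulr1 -(E_one hE n hN) -E_Z //.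
by apply: E_eq => P; rewrite mulr1.
Qed.

Lemma E_sum N n (I : Type) (r : seq I) F : (0 < N)%N ->
  E N n (fun P => \sum_(i <- r) F i P) = \sum_(i <- r) E N n (F i).
Proof.
move=> hN; elim: r => [|i r IH].
  by rewrite big_nil -[RHS](E_0 n hN); apply: E_eq => P; rewrite big_nil.
by rewrite big_cons -IH -E_D //; apply: E_eq => P; rewrite big_cons.
Qed.

Definition beta a N n := E N n (fun P => P a).
(** With P a = N^(-a-1) p_a this is N^-a (p_a - E p_a), the normalisation of the theorem. *)
Definition fluct a : RV := fun N n P => N%:R * (P a - beta a N n).
Definition mon ks : RV := fun N n P => \prod_(k <- ks) fluct k N n P.
Definition mom ks N n := E N n (mon ks N n).
Definition pos (ks : seq nat) := all (fun k => 0 < k)%N ks.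
Definition nice g := exists G, apx g G.

Lemma E_fluct N n a : (0 < N)%N -> E N n (fluct a N n) = 0.
Proof.
move=> hN; rewrite /fluct E_Z //.
rewrite (E_D n (fun P => P a) (fun _ => - beta a N n)) // E_C //.
by rewrite subrr mulr0.
Qed.

(* Combinations of products of fluctuations of total weight at most [d], with
   coefficients converging at rate 1/N. *)
Inductive Span d : RV -> Prop :=
| Sp0 : Span d (fun _ _ _ => 0)
| SpM F g ks : Span d F -> nice g -> pos ks -> (sumn ks <= d)%N ->
    Span d (fun N n P => F N n P + g N n * mon ks N n P)
| SpE F G : Span d F -> (forall N n P, dom N n -> F N n P = G N n P) -> Span d G.

Lemma Span_le d e F : (d <= e)%N -> Span d F -> Span e F.
Proof.
move=> de; elim=> [|{}F g ks _ IH hg hk hd|{}F G _ IH h].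
- exact: Sp0.
- by apply: SpM => //; apply: leq_trans de.
- exact: SpE h.
Qed.

Lemma Span_mon d ks : pos ks -> (sumn ks <= d)%N -> Span d (mon ks).
Proof.
move=> h1 h2; have n1 : nice (fun _ _ => 1) by exists 1; apply: approx1.
by apply: SpE (SpM (Sp0 d) n1 h1 h2) _ => N n P _; rewrite add0r mul1r.
Qed.

Lemma Span_D d F G : Span d F -> Span d G -> Span d (fun N n P => F N n P + G N n P).
Proof.
move=> hF; elim=> [|{}G g ks _ IH hg hk hd|{}G G' _ IH h].
- by apply: SpE hF _ => N n P _; rewrite addr0.
- by apply: SpE (SpM IH hg hk hd) _ => N n P _; rewrite addrA.
- by apply: SpE IH _ => N n P d'; rewrite h.
Qed.

Lemma nice_mul g h : nice g -> nice h -> nice (fun N n => g N n * h N n).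
Proof. by move=> [G hG] [H hH]; exists (G * H); apply: approxM. Qed.

Lemma nice_add g h : nice g -> nice h -> nice (fun N n => g N n + h N n).
Proof. by move=> [G hG] [H hH]; exists (G + H); apply: approxD. Qed.

Lemma nice_opp g : nice g -> nice (fun N n => - g N n).
Proof. by move=> [G hG]; exists (- G); apply: approxN. Qed.

Lemma nice_cst a : nice (fun _ _ => a).
Proof. by exists a%:P; apply: approx_cst. Qed.

Lemma nice_eps : nice (fun N _ => eps N).
Proof. by exists 0; apply: approx_eps. Qed.

Lemma nice_exp g k : nice g -> nice (fun N n => g N n ^+ k).
Proof.
move=> hg; elim: k => [|k [G hG]].
  by exists 1; apply: approx_ext (approx1 c) _ => *; rewrite expr0.
have [H hH] := nice_mul hg (ex_intro _ _ hG).
by exists H; apply: approx_ext hH _ => *; rewrite exprS.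
Qed.

Lemma mon_cat s t N n P : mon (s ++ t) N n P = mon s N n P * mon t N n P.
Proof. exact: big_cat. Qed.

Lemma Span_M d e F G : Span d F -> Span e G -> Span (d + e) (fun N n P => F N n P * G N n P).
Proof.
move=> hF hG; elim: hF => [|{}F g ks _ IH hg hk hd|{}F F' _ IH h].
- by apply: SpE (Sp0 _) _ => N n P _; rewrite mul0r.
- apply: (@SpE _ (fun N n P => F N n P * G N n P + g N n * mon ks N n P * G N n P)); last first.
    by move=> *; rewrite mulrDl.
  apply: Span_D => //; elim: hG => [|{IH}{}G h ls _ IH hh hl he|{IH}{}G G' _ IH h].
  + by apply: SpE (Sp0 _) _ => N n P _; rewrite mulr0.
  + have hp : pos (ks ++ ls) by rewrite /pos all_cat; apply/andP.
    have hs : (sumn (ks ++ ls) <= d + e)%N by rewrite sumn_cat leq_add.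
    apply: SpE (SpM IH (nice_mul hg hh) hp hs) _ => N n P _.
    by rewrite mon_cat; ring.
  + by apply: SpE IH _ => N n P d'; rewrite h.
- by apply: SpE IH _ => N n P d'; rewrite h.
Qed.

Lemma Span_C d g : nice g -> Span d (fun N n _ => g N n).
Proof.
move=> hg; apply: SpE (SpM (ks := [::]) (Sp0 d) hg isT (leq0n d)) _ => N n P _.
by rewrite /mon big_nil mulr1 add0r.
Qed.

Lemma Span_fluct d a : (0 < a <= d)%N -> Span d (fluct a).
Proof.
case/andP=> a0 ad.
apply: SpE (Span_mon (ks := [:: a]) (d := d) _ _) _; rewrite /pos /= ?a0 ?addn0 //.
by move=> N n P _; rewrite /mon big_seq1.
Qed.

Lemma Span_Z d g F : nice g -> Span d F -> Span d (fun N n P => g N n * F N n P).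
Proof. by move=> hg hF; apply: (Span_M (d := 0)) => //; apply: Span_C. Qed.

Lemma Span_sum d (I : eqType) (r : seq I) (F : I -> RV) : (forall i, i \in r -> Span d (F i)) ->
  Span d (fun N n P => \sum_(i <- r) F i N n P).
Proof.
elim: r => [|i r IH] h.
  by apply: SpE (Sp0 d) _ => N n P _; rewrite big_nil.
apply: (@SpE _ (fun N n P => F i N n P + \sum_(j <- r) F j N n P)); last first.
  by move=> *; rewrite big_cons.
apply: Span_D; first by apply: h; rewrite mem_head.
by apply: IH => j hj; apply: h; rewrite in_cons hj orbT.
Qed.

(** * From weight D to weight D + 1 *)

Section Level.
Variables (D : nat) (W : seq nat -> {poly R}).
Hypothesis hbeta : forall a, (a <= D)%N -> apx (beta a) (mlim R a).
Hypothesis hmom : forall ks, pos ks -> (sumn ks <= D)%N -> apx (mom ks) (W ks).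

Lemma nice_E d F : (d <= D)%N -> Span d F -> nice (fun N n => E N n (F N n)).
Proof.
move=> dD; elim=> [|{}F g ks _ IH hg hk hd|{}F G _ [H hH] h].
- by exists 0; apply: approx_ext (approx0 c) _ => N n /dom_gt0 hN; rewrite E_0.
- have hm : nice (mom ks) by eexists; apply: hmom => //; apply: leq_trans dD.
  have [H hH] := nice_add IH (nice_mul hg hm).
  by exists H; apply: approx_ext hH _ => N n /dom_gt0 hN; rewrite E_D // E_Z.
- by exists H; apply: approx_ext hH _ => N n d'; apply: E_eq => P; rewrite h.
Qed.

Definition dlin (ga : nat -> nat -> nat -> R) : RV :=
  fun N n P => \sum_(a < D) ga a.+1 N n * fluct a.+1 N n P.

(** A first-order expansion in the fluctuations. After centring and multiplication by N the term
    [al] is gone, the linear term is of order 1 and the remainder of order 1/N; this is the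
    precision needed for the drift of moments. *)
Definition Lin d (F : RV) (f0 : {poly R}) (fa : nat -> {poly R}) :=
  exists al ga Rem, [/\ apx al f0, (forall a, apx (ga a) (fa a)),
    (forall a N n, (d < a)%N -> ga a N n = 0), Span d Rem &
    forall N n P, dom N n ->
      F N n P = al N n + eps N * dlin ga N n P + eps N ^+ 2 * Rem N n P].

Lemma Lin_lim d F f0 fa g0 ga : Lin d F f0 fa -> f0 = g0 -> (forall a, fa a = ga a) -> Lin d F g0 ga.
Proof.
move=> [al [g [Rem [h1 h2 h3 h4 h5]]]] <- e; exists al, g, Rem; split=> // a.
by rewrite -e.
Qed.

Lemma Lin_ext d F G f0 fa : Lin d F f0 fa ->
  (forall N n P, dom N n -> F N n P = G N n P) -> Lin d G f0 fa.
Proof.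
move=> [al [g [Rem [h1 h2 h3 h4 h5]]]] e; exists al, g, Rem; split=> // N n P dm.
by rewrite -e ?h5.
Qed.

Lemma Lin_le d e F f0 fa : (d <= e)%N -> Lin d F f0 fa -> Lin e F f0 fa.
Proof.
move=> de [al [g [Rem [h1 h2 h3 h4 h5]]]]; exists al, g, Rem; split=> //.
  by move=> a N n h; apply: h3; apply: leq_ltn_trans h.
exact: Span_le h4.
Qed.

Lemma nice_ga ga (fa : nat -> {poly R}) : (forall a, apx (ga a) (fa a)) -> forall a, nice (ga a).
Proof. by move=> h a; exists (fa a). Qed.

Lemma Span_dlin d ga (fa : nat -> {poly R}) : (forall a, apx (ga a) (fa a)) ->
  (forall a N n, (d < a)%N -> ga a N n = 0) -> Span d (dlin ga).
Proof.
move=> h1 h2; apply: (@Span_sum d 'I_D (index_enum _)) => a _.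
case: (leqP a.+1 d) => had.
  by apply: Span_Z; [apply: nice_ga h1 _ | apply: Span_fluct].
by apply: SpE (Sp0 d) _ => N n P _; rewrite h2 ?mul0r.
Qed.

Lemma Lin_C g G : apx g G -> Lin 0 (fun N n _ => g N n) G (fun _ => 0).
Proof.
move=> hg; exists g, (fun _ _ _ => 0), (fun _ _ _ => 0); split=> //.
- by move=> a; apply: approx0.
- exact: Sp0.
by move=> N n P _; rewrite /dlin big1 ?mulr0 ?addr0 // => a _; rewrite mul0r.
Qed.

Lemma Lin_D d F G f0 fa g0 ga : Lin d F f0 fa -> Lin d G g0 ga ->
  Lin d (fun N n P => F N n P + G N n P) (f0 + g0) (fun a => fa a + ga a).
Proof.
move=> [al [u [Rem [h1 h2 h3 h4 h5]]]] [al' [u' [Rem' [h1' h2' h3' h4' h5']]]].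
exists (fun N n => al N n + al' N n), (fun a N n => u a N n + u' a N n),
  (fun N n P => Rem N n P + Rem' N n P); split.
- exact: approxD.
- by move=> a; apply: approxD.
- by move=> a N n h; rewrite h3 ?h3' ?addr0.
- exact: Span_D.
move=> N n P dm; rewrite h5 // h5' //.
have -> : dlin (fun a N n => u a N n + u' a N n) N n P = dlin u N n P + dlin u' N n P.
  by rewrite /dlin -big_split; apply: eq_bigr => a _; rewrite mulrDl.
by ring.
Qed.

Lemma Lin_M d e F G f0 fa g0 ga : Lin d F f0 fa -> Lin e G g0 ga ->
  Lin (d + e) (fun N n P => F N n P * G N n P) (f0 * g0) (fun a => f0 * ga a + g0 * fa a).
Proof.
move=> [al [u [Rem [h1 h2 h3 h4 h5]]]] [al' [u' [Rem' [h1' h2' h3' h4' h5']]]].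
exists (fun N n => al N n * al' N n), (fun a N n => al N n * u' a N n + al' N n * u a N n),
  (fun N n P => al N n * Rem' N n P + al' N n * Rem N n P
     + (dlin u N n P * dlin u' N n P + eps N * (dlin u N n P * Rem' N n P)
     + eps N * (Rem N n P * dlin u' N n P) + eps N ^+ 2 * (Rem N n P * Rem' N n P))); split.
- exact: approxM.
- by move=> a; apply: approxD; apply: approxM.
- by move=> a N n h; rewrite h3 ?h3' ?mulr0 ?addr0 //; lia.
- have na : nice al by exists f0. have na' : nice al' by exists g0.
  have su := Span_dlin h2 h3; have su' := Span_dlin h2' h3'.
  have dd : (d <= d + e)%N by lia. have ee : (e <= d + e)%N by lia.
  apply: Span_D; first apply: Span_D.
  + by apply: Span_Z => //; apply: Span_le h4'.
  + by apply: Span_Z => //; apply: Span_le h4.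
  apply: Span_D; first apply: Span_D; first apply: Span_D.
  + exact: Span_M.
  + by apply: Span_Z nice_eps _; apply: Span_M.
  + by apply: Span_Z nice_eps _; apply: Span_M.
  + by apply: Span_Z (nice_exp 2 nice_eps) _; apply: Span_M.
move=> N n P dm; rewrite h5 // h5' //.
have -> : dlin (fun a N n => al N n * u' a N n + al' N n * u a N n) N n P
   = al N n * dlin u' N n P + al' N n * dlin u N n P.
  by rewrite /dlin !mulr_sumr -big_split; apply: eq_bigr => a _ /=; ring.
by ring.
Qed.

Lemma Lin_Z d g G F f0 fa : apx g G -> Lin d F f0 fa ->
  Lin d (fun N n P => g N n * F N n P) (G * f0) (fun a => G * fa a).
Proof.
move=> hg hF; apply: Lin_lim (Lin_M (Lin_C hg) hF) _ _ => // a.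
by rewrite mulr0 addr0.
Qed.

Lemma Lin_sum d (I : eqType) (r : seq I) F f0 fa :
  (forall i, i \in r -> Lin d (F i) (f0 i) (fa i)) ->
  Lin d (fun N n P => \sum_(i <- r) F i N n P) (\sum_(i <- r) f0 i)
    (fun a => \sum_(i <- r) fa i a).
Proof.
elim: r => [|i r IH] h.
  apply: Lin_lim (Lin_ext (Lin_le (leq0n d) (Lin_C (approx0 c))) _) _ _.
  - by move=> *; rewrite big_nil.
  - by rewrite big_nil.
  - by move=> a; rewrite big_nil.
have hi : Lin d (F i) (f0 i) (fa i) by apply: h; rewrite mem_head.
have {}IH : Lin d (fun N n P => \sum_(i <- r) F i N n P) (\sum_(i <- r) f0 i)
    (fun a => \sum_(i <- r) fa i a).
  by apply: IH => j hj; apply: h; rewrite in_cons hj orbT.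
apply: Lin_lim (Lin_ext (Lin_D hi IH) _) _ _.
- by move=> *; rewrite big_cons.
- by rewrite big_cons.
- by move=> a; rewrite big_cons.
Qed.

Lemma Lin_P a : (a <= D)%N ->
  Lin a (fun _ _ P => P1 P a) (mlim R a) (fun b => ((b == a) && (0 < a)%N)%:R).
Proof.
case: a => [|a] haD.
  apply: Lin_lim (Lin_C (approx1 c)) _ _ => [|b]; first by rewrite mlim0.
  by rewrite andbF.
exists (beta a.+1), (fun b _ _ => (b == a.+1)%:R), (fun _ _ _ => 0); split.
- exact: hbeta.
- by move=> b; rewrite andbT; case: eqP => _; [apply: approx1 | apply: approx0].
- by move=> b N n h; rewrite gtn_eqF.
- exact: Sp0.
move=> N n P /dom_gt0 hN; rewrite mulr0 addr0 /dlin (bigD1 (Ordinal haD)) //= big1.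
  by rewrite eqxx mul1r addr0 /fluct mulrA [eps N * _]mulrC Neps // mul1r addrC subrK.
by move=> i; rewrite -val_eqE /= => h; rewrite eqSS (negbTE h) mul0r.
Qed.

Definition Qsum_lin k (a : nat) : {poly R} := if (a == k) && (0 < k)%N then k.+1%:R else 0.

Lemma Lin_Qsum k : (k <= D)%N ->
  Lin k (fun N _ P => Qsum N P k.+1) (k.+1%:R * mlim R k) (Qsum_lin k).
Proof.
move=> hk.
have h1 (r : 'I_k.+1) : r \in index_enum 'I_k.+1 ->
  Lin k (fun N n P => (-1) ^+ r * 'C(k.+1, r.+1)%:R * eps N ^+ r * P1 P (k.+1 - r.+1))
   ((if r == ord0 then k.+1%:R else 0) * mlim R k)
   (fun a => if r == ord0 then Qsum_lin k a else 0).
  move=> _; rewrite -val_eqE; case: r => -[|r] hr /=.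
    apply: Lin_lim (Lin_ext (Lin_Z (approx_cst c k.+1%:R) (Lin_P hk)) _) _ _.
    + by move=> N n P _; rewrite expr0 expr0 mul1r mulr1 bin1 subSS subn0.
    + by rewrite polyC_natr.
    + by move=> a; rewrite polyC_natr /Qsum_lin; case: ifP => _; rewrite ?mulr1 ?mulr0.
  have hr' : (k.+1 - r.+2 <= D)%N by lia.
  have hr2 : (k.+1 - r.+2 <= k)%N by lia.
  have [H hH] : nice (fun N _ => (-1) ^+ r.+1 * 'C(k.+1, r.+2)%:R * eps N ^+ r).
    apply: nice_mul; first exact: nice_cst.
    exact: nice_exp nice_eps.
  apply: Lin_lim (Lin_ext (Lin_Z (approx_epsM c_ge0 hH) (Lin_le hr2 (Lin_P hr'))) _) _ _.
  + by move=> N n P _; rewrite !exprS; ring.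
  + by rewrite !mul0r.
  + by move=> a; rewrite mul0r.
apply: Lin_lim (Lin_ext (Lin_sum h1) _) _ _ => //.
- by rewrite -mulr_suml big_ord_recl /= big1 ?addr0.
- by move=> a; rewrite big_ord_recl /= big1 ?addr0.
Qed.

(** The partial derivative of phi_m in P_a. To leading order [ph_rec] says that sum_m phi_m x^m =
    exp (sum_k P_k x^(k+1)), and d/dP_a multiplies this series by x^(a+1). [ph_lin_rec] is the
    linearised recursion. *)
Definition ph_lin m (a : nat) : {poly R} := if (0 < a < m)%N then phi R (m - a.+1) else 0.

Lemma ph_lin_rec m a : m%:R * ph_lin m a =
  \sum_(k < m) (k.+1%:R * mlim R k * ph_lin (m - k.+1) a + phi R (m - k.+1) * Qsum_lin k a).
Proof.
rewrite big_split /= {1}/ph_lin; case: ifP => [/andP[a0 boxmom]|ham]; last first.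
  rewrite mulr0 big1 ?add0r ?big1 // => -[k hk] _ /=.
    by rewrite /Qsum_lin ifF ?mulr0 //; lia.
  by rewrite /ph_lin ifF ?mulr0 //; lia.
rewrite (bigID (fun k : 'I_m => k < m - a.+1)%N) /= [X in _ + X + _]big1 ?addr0; last first.
  by move=> [k hk] /= h; rewrite /ph_lin ifF ?mulr0 //; lia.
rewrite (eq_bigr (fun k : 'I_m => k.+1%:R * mlim R k * phi R (m - a.+1 - k.+1))); last first.
  move=> [k hk] /= h; rewrite /ph_lin ifT; last by lia.
  by congr (_ * phi R _); lia.
rewrite -(big_ord_widen m (fun k => k.+1%:R * mlim R k * phi R (m - a.+1 - k.+1))); last by lia.
rewrite -phi_rec (bigD1 (Ordinal boxmom)) //= big1 ?addr0.
  rewrite /Qsum_lin eqxx a0 /= [phi _ _ * a.+1%:R]mulrC -mulrDl -natrD.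
  by congr (_%:R * _); lia.
move=> [k hk]; rewrite -val_eqE /= => h.
by rewrite /Qsum_lin eq_sym (negbTE h) mulr0.
Qed.

(** The weight is m - 1 and not m: in [ph_rec] the factor [Qsum N P k.+1] has weight only k. *)
Lemma Lin_ph m : (m.-1 <= D)%N -> Lin m.-1 (fun N _ P => ph N P m) (phi R m) (ph_lin m).
Proof.
elim/ltn_ind: m => m IH hm.
case: m IH hm => [|m] IH hm.
  by apply: Lin_lim (Lin_C (approx1 c)) _ _ => // a; rewrite /ph_lin ltn0 andbF.
rewrite /= in hm *.
have h1 (k : 'I_m.+1) : k \in index_enum 'I_m.+1 ->
   Lin m (fun N _ P => Qsum N P k.+1 * ph N P (m.+1 - k.+1))
     (k.+1%:R * mlim R k * phi R (m.+1 - k.+1))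
     (fun a => k.+1%:R * mlim R k * ph_lin (m.+1 - k.+1) a + phi R (m.+1 - k.+1) * Qsum_lin k a).
  case: k => k hk _ /=.
  have hq : (k <= D)%N by lia.
  have hd : (k + (m.+1 - k.+1).-1 <= m)%N by lia.
  apply: (Lin_le hd); apply: Lin_M; first exact: Lin_Qsum.
  by apply: IH; lia.
have := Lin_Z (approx_cst c (m.+1%:R^-1)) (Lin_sum h1).
move=> h; apply: Lin_lim (Lin_ext h _) _ _.
- by move=> N n P _; rewrite -ph_rec mulrA mulVf ?pnatr_eq0 // mul1r.
- rewrite -phi_rec mulrA -polyC_natr -polyCM mulVf ?pnatr_eq0 // polyC1 mul1r //.
- by move=> a; rewrite -ph_lin_rec mulrA -polyC_natr -polyCM mulVf ?pnatr_eq0 // polyC1 mul1r.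
Qed.

Definition PRV := nat -> nat -> (nat -> R) -> {poly R}.

(** The jump position y, the variable of the polynomial, has weight 1. This is consistent with
    averaging: [jmean] replaces y^i by [ph] at i + 1, of weight i. *)
Definition PSpan d (H : PRV) :=
  (forall i N n P, dom N n -> (d < i)%N -> (H N n P)`_i = 0) /\
  (forall i, (i <= d)%N -> Span (d - i) (fun N n P => (H N n P)`_i)).

Lemma PSpan_le d e H : (d <= e)%N -> PSpan d H -> PSpan e H.
Proof.
move=> de [h1 h2]; split=> [i N n P dm hi|i hi].
  by apply: h1 => //; apply: leq_ltn_trans hi.
case: (leqP i d) => hid; first by apply: Span_le (h2 i hid); lia.
by apply: SpE (Sp0 _) _ => N n P dm; rewrite h1.
Qed.

Lemma PSpan_C d F : Span d F -> PSpan d (fun N n P => (F N n P)%:P).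
Proof.
move=> hF; split=> [i N n P dm hi|[|i] hi].
- by rewrite coefC; case: i hi.
- by rewrite subn0; apply: SpE hF _ => N n P _; rewrite coefC.
- by apply: SpE (Sp0 _) _ => N n P _; rewrite coefC.
Qed.

Lemma PSpan0 d : PSpan d (fun _ _ _ => 0).
Proof.
split=> [i *|i _]; first by rewrite coef0.
by apply: SpE (Sp0 _) _ => N n P _; rewrite coef0.
Qed.

Lemma PSpan_D d G H : PSpan d G -> PSpan d H -> PSpan d (fun N n P => G N n P + H N n P).
Proof.
move=> [h1 h2] [h1' h2']; split=> [i N n P dm hi|i hi].
  by rewrite coefD h1 ?h1' ?addr0.
apply: SpE (Span_D (h2 i hi) (h2' i hi)) _ => N n P _.
by rewrite coefD.
Qed.

Lemma PSpan_M d e G H : PSpan d G -> PSpan e H -> PSpan (d + e) (fun N n P => G N n P * H N n P).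
Proof.
move=> [h1 h2] [h1' h2']; split=> [i N n P dm hi|i hi].
  rewrite coefM big1 // => -[j hj] _ /=; case: (ltnP d j) => hd.
    by rewrite h1 ?mul0r.
  by rewrite h1' ?mulr0 //; lia.
apply: SpE (Span_sum (r := index_enum 'I_i.+1)
  (F := fun j N n P => (G N n P)`_j * (H N n P)`_(i - j)) _) _; last first.
  by move=> N n P _; rewrite coefM.
move=> -[j hj] _ /=.
case: (leqP j d) => hd; last by apply: SpE (Sp0 _) _ => N n P dm; rewrite h1 ?mul0r.
case: (leqP (i - j) e) => he; last by apply: SpE (Sp0 _) _ => N n P dm; rewrite h1' ?mulr0.
by apply: Span_le (Span_M (h2 _ hd) (h2' _ he)); lia.
Qed.

Lemma PSpan_Z d e F H : Span d F -> PSpan e H -> PSpan (d + e) (fun N n P => F N n P *: H N n P).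
Proof.
move=> hF hH; have [h1 h2] := PSpan_M (PSpan_C hF) hH.
split=> [i N n P dm hi|i hi]; first by rewrite -mul_polyC h1.
by apply: SpE (h2 i hi) _ => N n P _; rewrite mul_polyC.
Qed.

Lemma size_le_coef0 (p : {poly R}) d : (forall i, (d < i)%N -> p`_i = 0) -> (size p <= d.+1)%N.
Proof. by move=> h; apply/leq_sizeP => j hj; apply: h. Qed.

Lemma Span_jmean d H : (d <= D)%N -> PSpan d H -> Span d (fun N n P => jmean N P (H N n P)).
Proof.
move=> dD [h1 h2].
apply: SpE (Span_sum (r := index_enum 'I_d.+1)
  (F := fun i N n P => (H N n P)`_i * ph N P i.+1) _) _; last first.
  move=> N n P dm; rewrite (@jmean_widen _ _ _ d.+1) //.
  by apply: size_le_coef0 => i; apply: h1.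
move=> -[i hi] _ /=; have hid : (i <= d)%N by [].
have hiD : (i.+1.-1 <= D)%N by apply: leq_trans dD.
have hph : Span i (fun N n P => ph N P i.+1).
  have [al [ga [Rem [n1 n2 n3 n4 n5]]]] := Lin_ph hiD.
  apply: (@SpE _ (fun N n P => al N n + (eps N * dlin ga N n P + eps N ^+ 2 * Rem N n P))); last first.
    by move=> N n P dm; rewrite (n5 N n) // addrA.
  apply: Span_D; first by apply: Span_C; exists (phi R i.+1).
  apply: Span_D; first by apply: Span_Z nice_eps _; apply: Span_dlin n2 n3.
  exact: Span_Z (nice_exp 2 nice_eps) _.
by apply: Span_le (Span_M (h2 i hid) hph); lia.
Qed.

Definition Det d (H : nat -> nat -> {poly R}) (h : {poly {poly R}}) :=
  (forall i N n, dom N n -> (d < i)%N -> (H N n)`_i = 0) /\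
  (forall i, apx (fun N n => (H N n)`_i) h`_i).

Lemma Det_PSpan d H h : Det d H h -> PSpan d (fun N n _ => H N n).
Proof.
move=> [h1 h2]; split=> [i N n P dm|i _]; first exact: h1.
by apply: Span_C; exists h`_i.
Qed.

Lemma Det_M d e G H g h : Det d G g -> Det e H h -> Det (d + e) (fun N n => G N n * H N n) (g * h).
Proof.
move=> [h1 h2] [h1' h2']; split=> [i N n dm hi|i].
  rewrite coefM big1 // => -[j hj] _ /=; case: (ltnP d j) => hd.
    by rewrite h1 ?mul0r.
  by rewrite h1' ?mulr0 //; lia.
rewrite coefM; apply: approx_ext (approx_sum _ (fun j : 'I_i.+1 => approxM c_ge0 (h2 j) (h2' (i - j)%N))) _.
by move=> N n dm; rewrite coefM.
Qed.

Definition Lam d (h : {poly {poly R}}) := \sum_(i < d.+1) h`_i * phi R i.+1.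

Lemma Lin_jmean d H h : (d <= D)%N -> Det d H h ->
  Lin d (fun N n P => jmean N P (H N n)) (Lam d h) (fun a => \sum_(i < d.+1) h`_i * ph_lin i.+1 a).
Proof.
move=> dD [h1 h2].
have hl (i : 'I_d.+1) : i \in index_enum 'I_d.+1 ->
   Lin d (fun N n P => (H N n)`_i * ph N P i.+1) (h`_i * phi R i.+1) (fun a => h`_i * ph_lin i.+1 a).
  case: i => i hi _ /=; apply: Lin_Z => //.
  by apply: (@Lin_le i) => //; apply: (@Lin_ph i.+1); apply: leq_trans dD.
apply: Lin_ext (Lin_sum hl) _ => N n P dm.
rewrite (@jmean_widen _ _ _ d.+1) //; apply: size_le_coef0 => i; exact: h1.
Qed.

Lemma E_Lin d F f0 fa : (d <= D)%N -> Lin d F f0 fa -> apx (fun N n => E N n (F N n)) f0.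
Proof.
move=> dD [al [ga [Rem [n1 n2 n3 n4 n5]]]].
have [H hH] := nice_E dD n4.
apply: approx_lim0 (approx_ext (approxD n1 (approx_epsM c_ge0 (approx_epsM c_ge0 hH))) _) _; last by rewrite addr0.
move=> N n dm; have hN := dom_gt0 dm.
rewrite [E N n (F N n)](@E_eq _ _ _ (fun P => (al N n + eps N * dlin ga N n P) + eps N ^+ 2 * Rem N n P)); last first.
  by move=> P; rewrite n5.
rewrite E_D // E_D // E_C // !E_Z //.
have -> : E N n (dlin ga N n) = 0.
  rewrite E_sum // big1 // => a _; by rewrite E_Z // E_fluct ?mulr0.
by rewrite mulr0 addr0 mulrA expr2.
Qed.

Lemma E_Lead d F f0 fa ks : Lin d F f0 fa -> pos ks -> (d + sumn ks <= D)%N ->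
  apx (fun N n => E N n (fun P => F N n P * mon ks N n P)) (f0 * W ks).
Proof.
move=> [al [ga [Rem [n1 n2 n3 n4 n5]]]] hks hd.
have sd := Span_dlin n2 n3.
have sm := Span_mon hks (leqnn _).
have sR : Span d (fun N n P => dlin ga N n P + eps N * Rem N n P).
  by apply: Span_D => //; apply: Span_Z nice_eps _.
have [H hH] := nice_E hd (Span_M sR sm).
have hks' : (sumn ks <= D)%N by lia.
apply: approx_lim0 (approx_ext (approxD (approxM c_ge0 n1 (hmom hks hks')) (approx_epsM c_ge0 hH)) _) _; last by rewrite addr0.
move=> N n dm; have hN := dom_gt0 dm.
rewrite /mom -!E_Z // -E_D //; apply: E_eq => P; rewrite n5 //.
by ring.
Qed.

Lemma mon_ins a pre post N n P :
  mon (pre ++ a :: post) N n P = fluct a N n P * mon (pre ++ post) N n P.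
Proof. by rewrite !mon_cat /mon big_cons mulrCA. Qed.

(** Fluctuations have mean 0, so E F agrees with [al] up to order N^-2. In F - E F there remains the
    linear part, whose factor 1/N cancels the N in front. The split into [pre] and [post] records
    where the new fluctuation is inserted. *)
Lemma E_centered d F f0 fa pre post : Lin d F f0 fa -> (d <= D)%N ->
  pos (pre ++ post) -> (d + sumn (pre ++ post) <= D)%N ->
  apx (fun N n => N%:R * E N n (fun P => (F N n P - E N n (F N n)) * mon (pre ++ post) N n P))
      (\sum_(a < d) fa a.+1 * W (pre ++ a.+1 :: post)).
Proof.
move=> [al [ga [Rem [n1 n2 n3 n4 n5]]]] dD hks hd.
have [H hH] := nice_E dD n4.
have sm := Span_mon hks (leqnn _).
have hks' : (sumn (pre ++ post) <= D)%N by lia.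
have nm : nice (mom (pre ++ post)) by eexists; apply: hmom.
have [M hM] := nice_add (nice_E hd (Span_M n4 sm)) (nice_opp (nice_mul (ex_intro _ _ hH) nm)).
have hsum : apx (fun N n => \sum_(a < d) ga a.+1 N n * mom (pre ++ a.+1 :: post) N n)
   (\sum_(a < d) fa a.+1 * W (pre ++ a.+1 :: post)).
  apply: approx_sum => a; apply: approxM => //; apply: hmom.
    by move: hks; rewrite /pos !all_cat /= => /andP[-> ->].
  by move: hd; rewrite !sumn_cat /=; have := ltn_ord a; lia.
apply: approx_lim0 (approx_ext (approxD hsum (approx_epsM c_ge0 hM)) _) _; last by rewrite addr0.
move=> N n dm; have hN := dom_gt0 dm.
have EF : E N n (F N n) = al N n + eps N ^+ 2 * E N n (Rem N n).
  rewrite (@E_eq _ _ _ (fun P => (al N n + eps N * dlin ga N n P) + eps N ^+ 2 * Rem N n P)); last first.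
    by move=> P; rewrite n5.
  rewrite E_D // E_D // E_C // !E_Z //.
  have -> : E N n (dlin ga N n) = 0.
    rewrite E_sum // big1 // => a _; by rewrite E_Z // E_fluct ?mulr0.
  by rewrite mulr0 addr0.
rewrite -E_Z // EF.
have -> : \sum_(a < d) ga a.+1 N n * mom (pre ++ a.+1 :: post) N n
   = E N n (fun P => dlin ga N n P * mon (pre ++ post) N n P).
  have -> : E N n (fun P => dlin ga N n P * mon (pre ++ post) N n P) =
     \sum_(a < D) ga a.+1 N n * mom (pre ++ a.+1 :: post) N n.
    under eq_bigr => a _ do rewrite -E_Z //.
    rewrite -E_sum //; apply: E_eq => P; rewrite mulr_suml.
    by apply: eq_bigr => a _; rewrite mon_ins mulrA.
  rewrite (big_ord_widen D (fun a => ga a.+1 N n * mom (pre ++ a.+1 :: post) N n)) //.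
  rewrite big_mkcond /=; apply: eq_bigr => a _; case: ltnP => // h.
  by rewrite n3 ?mul0r.
rewrite /mom -mulN1r -!E_Z // -E_D // -E_Z // -E_D //; apply: E_eq => P; rewrite n5 //.
have e1 := Neps R hN.
set e := eps N in e1 *; set r := Rem N n P; set Er := E N n _; set m := mon _ _ _ _; set l := dlin _ _ _ _.
transitivity ((N%:R * e) * l * m + (N%:R * e) * e * (r * m - Er * m)); first by rewrite e1; ring.
by rewrite E_Z // -/Er; ring.
Qed.

Definition Jbar k N n := E N n (fun P => jmean N P (jump N k)).
Definition cjump k N n := jump N k - (Jbar k N n)%:P.

Lemma Det_jump k : (0 < k)%N -> Det k.-1 (fun N _ => jump N k) (k%:R *: 'X^(k.-1)).
Proof.
case: k => // k _; split=> [i N n dm hi|i].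
  rewrite /jump coef_sum big1 // => -[r hr] _ /=; rewrite coefZ coefXn gtn_eqF ?mulr0 //.
  by move: hi => /=; lia.
rewrite /jump coefZ coefXn.
have h (r : 'I_k.+1) : apx (fun N _ => 'C(k.+1, r.+1)%:R * eps N ^+ r * (i == (k.+1 - r.+1)%N)%:R)
   (if r == ord0 then k.+1%:R * (i == k)%:R else 0).
  rewrite -val_eqE; case: r => -[|r] hr /=.
    apply: approx_lim0 (approx_ext (approx_cst c (k.+1%:R * (i == k)%:R)) _) _.
      by move=> N n _; rewrite bin1 expr0 mulr1 subSS subn0.
    by rewrite polyCM !polyC_natr.
  have [H hH] : nice (fun N _ => 'C(k.+1, r.+2)%:R * eps N ^+ r * (i == (k.+1 - r.+2)%N)%:R).
    by apply: nice_mul (nice_cst _); apply: nice_mul (nice_cst _) (nice_exp _ nice_eps).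
  by apply: approx_ext (approx_epsM c_ge0 hH) _ => N n _; rewrite exprS; ring.
apply: approx_lim0 (approx_ext (approx_sum (index_enum _) h) _) _.
  by move=> N n _; rewrite coef_sum; apply: eq_bigr => r _; rewrite coefZ coefXn.
by rewrite big_ord_recl /= big1 ?addr0.
Qed.

(** The gain of one level: the jump polynomial has degree k - 1, so k = D + 1 is reached with
    information up to weight D. *)
Lemma Lin_jump k : (0 < k <= D.+1)%N ->
  Lin k.-1 (fun N _ P => jmean N P (jump N k)) (k%:R * phi R k) (fun a => k%:R * ph_lin k a).
Proof.
case/andP=> k0 kD; have kD' : (k.-1 <= D)%N by lia.
have hpick (f : nat -> {poly R}) : \sum_(i < k.-1.+1) (k%:R *: 'X^(k.-1))`_i * f i.+1 = k%:R * f k.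
  have hk : (k.-1 < k.-1.+1)%N by [].
  rewrite (bigD1 (Ordinal hk)) //= big1 ?addr0.
    by rewrite coefZ coefXn eqxx mulr1 prednK.
  by move=> i; rewrite -val_eqE /= => /negbTE h; rewrite coefZ coefXn h mulr0 mul0r.
apply: Lin_lim (Lin_jmean kD' (Det_jump k0)) _ _; first exact: hpick.
by move=> a; apply: (hpick (ph_lin^~ a)).
Qed.

Lemma apx_Jbar k : (0 < k <= D.+1)%N -> apx (Jbar k) (k%:R * phi R k).
Proof. by move=> hk; apply: E_Lin (Lin_jump hk); lia. Qed.

Lemma Det_cjump k : (0 < k <= D.+1)%N -> Det k.-1 (cjump k) (k%:R *: 'X^(k.-1) - (k%:R * phi R k)%:P).
Proof.
move=> hk; have k0 : (0 < k)%N by case/andP: hk.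
have [h1 h2] := Det_jump k0; split=> [i N n dm hi|i].
  by rewrite /cjump coefB (h1 _ _ n) // coefC gtn_eqF ?subr0 //; lia.
have hJ : apx (fun N n => if i == 0 then Jbar k N n else 0) (if i == 0 then k%:R * phi R k else 0).
  by case: eqP => _; [apply: apx_Jbar | apply: approx0].
apply: approx_lim0 (approx_ext (approxD (h2 i) (approxN c_ge0 hJ)) _) _.
  by move=> N n _; rewrite /cjump coefB coefC.
by rewrite coefB [in RHS]coefC.
Qed.

Lemma Lam_cjump k l : (0 < k)%N -> (0 < l)%N ->
  Lam (k.-1 + l.-1) ((k%:R *: 'X^(k.-1) - (k%:R * phi R k)%:P) *
                     (l%:R *: 'X^(l.-1) - (l%:R * phi R l)%:P)) = qvar R k l.
Proof.
case: k => // k _; case: l => // l _; rewrite /= /Lam.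
set P1' := (_ - _) * _.
have -> : P1' = (k.+1%:R * l.+1%:R) *: ('X^(k + l) - phi R l.+1 *: 'X^k - phi R k.+1 *: 'X^l
   + (phi R k.+1 * phi R l.+1)%:P).
  by rewrite /P1' exprD -!mul_polyC !polyCM; ring.
pose f (p : {poly {poly R}}) := \sum_(i < (k + l).+1) p`_i * phi R i.+1.
have fD p q : f (p + q) = f p + f q.
  by rewrite /f -big_split; apply: eq_bigr => i _; rewrite coefD mulrDl.
have fZ a p : f (a *: p) = a * f p.
  by rewrite /f mulr_sumr; apply: eq_bigr => i _; rewrite coefZ mulrA.
have fX j : (j <= k + l)%N -> f 'X^j = phi R j.+1.
  move=> hj; have hj' : (j < (k + l).+1)%N by [].
  rewrite /f (bigD1 (Ordinal hj')) //= big1 ?addr0; first by rewrite coefXn eqxx mul1r.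
  by move=> i; rewrite -val_eqE /= => /negbTE h; rewrite coefXn h mul0r.
have fC a : f a%:P = a.
  have -> : a%:P = a *: 'X^0 by rewrite -mul_polyC expr0 mulr1.
  by rewrite fZ fX // phi1 mulr1.
rewrite -/(f _) fZ !fD -!scaleNr !fZ fC !fX; try lia.
rewrite /qvar (_ : (k.+1 + l.+1).-1 = (k + l).+1)%N; last by lia.
by ring.
Qed.

Local Notation xx N n P := (fun k => fluct k N n P).
Local Notation yy N n := (fun k => cjump k N n).

(** Every term of [d1], [d2], [d3] contains a centred jump, which lowers the weight by at least one.
    For empty t the truncated predecessor would miss this, but then G is 0. *)
Lemma PSpan_XZ k t (G : PRV) : (0 < k)%N -> pos t ->
  (t = [::] -> forall N n P, G N n P = 0) ->
  PSpan (sumn t).-1 G -> PSpan (k + sumn t).-1 (fun N n P => fluct k N n P *: G N n P).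
Proof.
move=> k0 ht h0 hG; case: t ht h0 hG => [|l t] ht h0 hG.
  have [p1 p2] := PSpan0 (k + 0).-1; split=> [i N n P dm hi|i hi].
    by rewrite h0 // scaler0 coef0.
  by apply: SpE (p2 i hi) _ => N n P _; rewrite h0 // scaler0.
have hX : Span k (fluct k) by apply: Span_fluct; rewrite k0 leqnn.
by apply: PSpan_le (PSpan_Z hX hG); move: ht; rewrite /=; lia.
Qed.

Lemma PSpan_d1 ks : pos ks -> (sumn ks <= D.+1)%N ->
  PSpan (sumn ks).-1 (fun N n P => d1 (xx N n P) (yy N n) ks).
Proof.
elim: ks => [|k t IH] /=; first by move=> _ _; apply: PSpan0.
case/andP=> k0 ht hs; have hk : (0 < k <= D.+1)%N by lia.
have hs' : (sumn t <= D.+1)%N by lia.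
have hy := Det_PSpan (Det_cjump hk).
apply: PSpan_D; first by apply: PSpan_le (PSpan_Z (Span_mon ht (leqnn _)) hy); lia.
by apply: PSpan_XZ => // [-> //|]; apply: IH.
Qed.

Lemma PSpan_d2 ks : pos ks -> (sumn ks <= D.+1)%N ->
  PSpan (sumn ks).-1 (fun N n P => d2 (xx N n P) (yy N n) ks).
Proof.
elim: ks => [|k t IH] /=; first by move=> _ _; apply: PSpan0.
case/andP=> k0 ht hs; have hk : (0 < k <= D.+1)%N by lia.
have hs' : (sumn t <= D.+1)%N by lia.
have hy := Det_PSpan (Det_cjump hk).
apply: PSpan_D; first by apply: PSpan_le (PSpan_M hy (PSpan_d1 ht hs')); lia.
by apply: PSpan_XZ => // [-> //|]; apply: IH.
Qed.

Lemma PSpan_d3 ks : pos ks -> (sumn ks <= D.+1)%N ->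
  PSpan (sumn ks).-1 (fun N n P => d3 (eps N) (xx N n P) (yy N n) ks).
Proof.
elim: ks => [|k t IH] /=; first by move=> _ _; apply: PSpan0.
case/andP=> k0 ht hs; have hk : (0 < k <= D.+1)%N by lia.
have hs' : (sumn t <= D.+1)%N by lia.
have hy := Det_PSpan (Det_cjump hk).
apply: PSpan_D; first by apply: PSpan_le (PSpan_M hy (PSpan_d2 ht hs')); lia.
apply: PSpan_D; first by apply: PSpan_XZ => // [-> //|]; apply: IH.
have he : Span 0 (fun N _ _ => eps N) := Span_C 0 nice_eps.
by apply: PSpan_le (PSpan_Z he (PSpan_M hy (IH ht hs'))); lia.
Qed.

Lemma jmean0 N P : jmean N P 0 = 0.
Proof. by rewrite -polyC0 jmeanC. Qed.

Lemma jmean_cjump N n P k : jmean N P (cjump k N n) = jmean N P (jump N k) - Jbar k N n.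
Proof. by rewrite /cjump jmeanD -polyCN jmeanC. Qed.

(** The list [pre] holds the entries already passed, as the continuation does in [driftU]. The entry
    k is replaced by its centred jump, to which [E_centered] applies. *)
Lemma lim_d1 ks pre : pos pre -> pos ks -> (sumn pre + sumn ks <= D.+1)%N ->
  apx (fun N n => N%:R * E N n (fun P => mon pre N n P * jmean N P (d1 (xx N n P) (yy N n) ks)))
      (driftU (fun r => W (pre ++ r)) ks).
Proof.
elim: ks pre => [|k t IH] pre hp /=.
  move=> _ _; apply: approx_ext (approx0 c) _ => N n /dom_gt0 hN.
  rewrite (@E_eq _ _ _ (fun _ => 0)) ?E_0 ?mulr0 // => P.
  by rewrite jmean0 mulr0.
case/andP=> k0 ht hs; have hk : (0 < k <= D.+1)%N by lia.
have hpt : pos (pre ++ t) by rewrite /pos all_cat; apply/andP.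
have hc : apx (fun N n => N%:R * E N n (fun P => (jmean N P (jump N k) - Jbar k N n) * mon (pre ++ t) N n P))
   (\sum_(a < k.-1) k%:R * ph_lin k a.+1 * W (pre ++ a.+1 :: t)).
  by apply: (E_centered (Lin_jump hk)) => //; rewrite ?sumn_cat; lia.
have hpr : pos (rcons pre k) by rewrite /pos all_rcons k0.
have hsr : (sumn (rcons pre k) + sumn t <= D.+1)%N by rewrite sumn_rcons; lia.
apply: approx_lim0 (approx_ext (approxD hc (IH _ hpr ht hsr)) _) _.
  move=> N n dm; have hN := dom_gt0 dm.
  rewrite -mulrDr -E_D //; congr (_ * _); apply: E_eq => P.
  rewrite jmeanD !jmeanZ jmean_cjump mon_cat -[xprod _ _]/(mon t N n P).
  by rewrite /mon -cats1 big_cat big_seq1 /=; ring.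
congr (_ + _); last by apply: eq_driftU => r; rewrite cat_rcons.
case: k {hk hc hpr hsr hs} k0 => // k _ /=; rewrite big_ord_recl /= mul0r add0r.
by apply: eq_bigr => a _; rewrite /drift /ph_lin /bump /=; case: ifP; rewrite ?mulr0.
Qed.

Lemma lim_yd1 k ks pre : (0 < k)%N -> pos pre -> pos ks -> (k + sumn pre + sumn ks <= D.+1)%N ->
  apx (fun N n => E N n (fun P => mon pre N n P * jmean N P (cjump k N n * d1 (xx N n P) (yy N n) ks)))
      (contract (qvar R k) (fun r => W (pre ++ r)) ks).
Proof.
move=> k0; elim: ks pre => [|l t IH] pre hp /=.
  move=> _ _; apply: approx_ext (approx0 c) _ => N n /dom_gt0 hN.
  rewrite (@E_eq _ _ _ (fun _ => 0)) ?E_0 // => P.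
  by rewrite mulr0 jmean0 mulr0.
case/andP=> l0 ht hs.
have hk : (0 < k <= D.+1)%N by lia.
have hl : (0 < l <= D.+1)%N by lia.
have hpt : pos (pre ++ t) by rewrite /pos all_cat; apply/andP.
have hkl : (k.-1 + l.-1 <= D)%N by lia.
have hd : (k.-1 + l.-1 + sumn (pre ++ t) <= D)%N by rewrite sumn_cat; lia.
have hc := E_Lead (Lin_jmean hkl (Det_M (Det_cjump hk) (Det_cjump hl))) hpt hd.
rewrite Lam_cjump // in hc.
have hpr : pos (rcons pre l) by rewrite /pos all_rcons l0.
have hsr : (k + sumn (rcons pre l) + sumn t <= D.+1)%N by rewrite sumn_rcons; lia.
apply: approx_lim0 (approx_ext (approxD hc (IH _ hpr ht hsr)) _) _.
  move=> N n dm; have hN := dom_gt0 dm.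
  rewrite -E_D //; apply: E_eq => P.
  rewrite [cjump k N n * (_ *: _ + _)]mulrDr -!scalerAr jmeanD !jmeanZ mon_cat -[xprod _ _]/(mon t N n P).
  by rewrite /mon -cats1 big_cat big_seq1 /=; ring.
by congr (_ + _); apply: eq_contract => r; rewrite cat_rcons.
Qed.

Lemma lim_d2 ks pre : pos pre -> pos ks -> (sumn pre + sumn ks <= D.+1)%N ->
  apx (fun N n => E N n (fun P => mon pre N n P * jmean N P (d2 (xx N n P) (yy N n) ks)))
      (qvarU (fun r => W (pre ++ r)) ks).
Proof.
elim: ks pre => [|k t IH] pre hp /=.
  move=> _ _; apply: approx_ext (approx0 c) _ => N n /dom_gt0 hN.
  rewrite (@E_eq _ _ _ (fun _ => 0)) ?E_0 // => P.
  by rewrite jmean0 mulr0.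
case/andP=> k0 ht hs.
have hks : (k + sumn pre + sumn t <= D.+1)%N by lia.
have hpr : pos (rcons pre k) by rewrite /pos all_rcons k0.
have hsr : (sumn (rcons pre k) + sumn t <= D.+1)%N by rewrite sumn_rcons; lia.
apply: approx_lim0 (approx_ext (approxD (lim_yd1 k0 hp ht hks) (IH _ hpr ht hsr)) _) _.
  move=> N n dm; have hN := dom_gt0 dm.
  rewrite -E_D //; apply: E_eq => P; rewrite jmeanD jmeanZ.
  by rewrite /mon -cats1 big_cat big_seq1 /=; ring.
by congr (_ + _); apply: eq_qvarU => r; rewrite cat_rcons.
Qed.

Lemma beta_step N n k : (0 < N)%N -> beta k N n.+1 = beta k N n + eps N ^+ 2 * Jbar k N n.
Proof.
move=> hN; rewrite {1}/beta (@E_next _ _ _ (fun P => (P k)%:P + eps N ^+ 2 *: jump N k)) //.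
  rewrite /beta /Jbar -E_Z // -E_D //; apply: E_eq => P.
  by rewrite jmeanD jmeanC jmeanZ.
by move=> P y; rewrite /shiftP hornerD hornerC hornerZ.
Qed.

(** A jump changes P k by N^-2 times [jump], and its mean by N^-2 times [Jbar]. Hence a fluctuation
    gains 1/N times the centred jump, and [prod_expand] applies with e = 1/N. *)
Lemma mom_step N n ks : (0 < N)%N -> mom ks N n.+1 = mom ks N n + eps N ^+ 2 *
  (N%:R * E N n (fun P => jmean N P (d1 (xx N n P) (yy N n) ks))
   + (E N n (fun P => jmean N P (d2 (xx N n P) (yy N n) ks))
     + eps N * E N n (fun P => jmean N P (d3 (eps N) (xx N n P) (yy N n) ks)))).
Proof.
move=> hN; have e1 := Neps R hN.
rewrite {1}/mom (@E_next _ _ _ (fun P => \prod_(k <- ks) ((fluct k N n P)%:P + eps N *: cjump k N n))) //.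
  rewrite (@E_eq _ _ _ (fun P => mon ks N n P + (eps N * jmean N P (d1 (xx N n P) (yy N n) ks)
    + (eps N ^+ 2 * jmean N P (d2 (xx N n P) (yy N n) ks)
      + eps N ^+ 3 * jmean N P (d3 (eps N) (xx N n P) (yy N n) ks))))); last first.
    by move=> P; rewrite prod_expand !jmeanD jmeanC !jmeanZ.
  rewrite E_D // E_D // E_D // !E_Z // -/(mom ks N n).
  by rewrite -[eps N * E _ _ _]mul1r -{1}e1; ring.
move=> P y; rewrite horner_prod; apply: eq_bigr => k _.
rewrite hornerD hornerC hornerZ /fluct beta_step // /cjump hornerD hornerN hornerC /shiftP.
set e := eps N in e1 *.
transitivity (N%:R * (P k - beta k N n) + (N%:R * e) * e * ((jump N k).[y] - Jbar k N n)); first by ring.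
by rewrite e1 mul1r.
Qed.

(** Comparison with the telescoping sum of (i+1)^(a+1) - i^(a+1), which lies between (a+1) i^a and
    (a+1) (i+1)^a. *)
Lemma power_sum_approx a N : (0 < N)%N ->
  `|eps N ^+ a.+1 * (\sum_(i < N) i%:R ^+ a) - a.+1%:R^-1| <= eps N.
Proof.
move=> hN; set S := \sum_(i < N) _.
have dif i : i.+1%:R ^+ a.+1 - i%:R ^+ a.+1 = \sum_(j < a.+1) i.+1%:R ^+ (a - j) * i%:R ^+ j :> R.
  by rewrite subrXX -natrB // subSnn mul1r; apply: eq_bigr => j _.
have cst (z : R) : a.+1%:R * z = \sum_(j < a.+1) z.
  by rewrite sumr_const card_ord mulr_natl.
have bnd1 i : a.+1%:R * i%:R ^+ a <= i.+1%:R ^+ a.+1 - i%:R ^+ a.+1 :> R.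
  rewrite dif cst; apply: ler_sum => -[j hj] _ /=.
  rewrite -{1}(@subnK j a) // exprD ler_pM ?exprn_ge0 //.
  by rewrite lerXn2r ?nnegrE // ler_nat.
have bnd2 i : i.+1%:R ^+ a.+1 - i%:R ^+ a.+1 <= a.+1%:R * i.+1%:R ^+ a :> R.
  rewrite dif cst; apply: ler_sum => -[j hj] _ /=.
  rewrite -[X in _ <= _ ^+ X](@subnK j a) // exprD ler_pM ?exprn_ge0 //.
  by rewrite lerXn2r ?nnegrE // ler_nat.
have tel : N%:R ^+ a.+1 = \sum_(i < N) (i.+1%:R ^+ a.+1 - i%:R ^+ a.+1) :> R.
  rewrite -(big_mkord xpredT (fun i => i.+1%:R ^+ a.+1 - i%:R ^+ a.+1 : R)).
  by rewrite (telescope_sumr (fun i => i%:R ^+ a.+1)) // expr0n subr0.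
have low : a.+1%:R * S <= N%:R ^+ a.+1.
  by rewrite tel mulr_sumr; apply: ler_sum => i _; apply: bnd1.
have up : N%:R ^+ a.+1 <= a.+1%:R * (S + N%:R ^+ a).
  apply: (@le_trans _ _ (a.+1%:R * \sum_(i < N) i.+1%:R ^+ a)).
    by rewrite tel mulr_sumr; apply: ler_sum => i _; apply: bnd2.
  rewrite ler_wpM2l //.
  apply: (@le_trans _ _ (\sum_(i < N.+1) i%:R ^+ a)); last by rewrite big_ord_recr.
  by rewrite big_ord_recl lerDr exprn_ge0.
have eN : eps N ^+ a.+1 * N%:R ^+ a.+1 = 1 by rewrite -exprMn mulrC Neps ?expr1n.
have eN' : eps N ^+ a.+1 * N%:R ^+ a = eps N.
  by rewrite exprS -mulrA -exprMn [eps N * N%:R]mulrC Neps ?expr1n ?mulr1.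
have e0 : 0 <= eps N ^+ a.+1 by rewrite exprn_ge0 // eps_ge0.
have a0 : (0 : R) < a.+1%:R by rewrite ltr0n.
have hi : eps N ^+ a.+1 * S <= a.+1%:R^-1.
  rewrite -(ler_pM2l a0) mulfV ?pnatr_eq0 // mulrCA -[X in _ <= X]eN.
  exact: ler_wpM2l.
have lo : a.+1%:R^-1 <= eps N ^+ a.+1 * (S + N%:R ^+ a).
  rewrite -(ler_pM2l a0) mulfV ?pnatr_eq0 // mulrCA -[X in X <= _]eN.
  exact: ler_wpM2l.
rewrite mulrDr eN' in lo.
rewrite ler_norml lerNl opprB lerBlDl lo /=.
by apply: le_trans (eps_ge0 R N); rewrite subr_le0.
Qed.

Lemma apx_beta k : apx (Jbar k) (k%:R * phi R k) -> apx (beta k) (mlim R k).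
Proof.
move=> hJ; apply: (approx_int c_ge0 (h := Jbar k)).
- by move=> N n /dom_gt0 hN; apply: beta_step.
- by rewrite deriv_mlim.
exists 1 => // N hN; rewrite mul1r mlim_at0 /beta (E_init hE) //.
exact: power_sum_approx.
Qed.

Lemma mom_at0 k t N : (0 < N)%N -> mom (k :: t) N 0 = 0.
Proof.
move=> hN; rewrite /mom (E_init hE) // /mon big_cons /fluct /beta (E_init hE) //.
by rewrite subrr mulr0 mul0r.
Qed.

(** On the right of the differential equation W is evaluated only at lists of weight at most D, so
    the limit of the increments is already known. The initial value is 0 because the chain starts
    from a fixed state. *)
Lemma apx_mom ks : pos ks -> ks != [::] -> (sumn ks <= D.+1)%N ->
  (W ks)^`() = driftU W ks + qvarU W ks -> (W ks).[0] = 0 -> apx (mom ks) (W ks).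
Proof.
move=> hp hne hs hd h0.
have h1 := @lim_d1 ks [::] isT hp hs.
have h2 := @lim_d2 ks [::] isT hp hs.
have hsD : ((sumn ks).-1 <= D)%N by lia.
have [H hH] := nice_E hsD (Span_jmean hsD (PSpan_d3 hp hs)).
have h12 := approxD h1 (approxD h2 (approx_epsM c_ge0 hH)).
apply: (approx_int c_ge0 _ (approx_lim0 (approx_ext h12 (fun _ _ _ => erefl)) _)).
- move=> N n /dom_gt0 hN; rewrite mom_step //; congr (_ + _ * (_ * _ + (_ + _)));
    by apply: E_eq => P; rewrite /mon big_nil mul1r.
- by rewrite addr0 hd.
exists 0 => // N hN; rewrite h0 subr0; case: ks hne {hp hs hd h0 h1 h2 hsD hH h12} => // k t _.
by rewrite mom_at0 // normr0 mul0r.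
Qed.

End Level.

End Model.

(** * Differentiation of Wick's formula *)

Section Wick.
Variable R : realFieldType.
Local Notation A := {poly R}.
Implicit Types (W : seq nat -> A) (s t : seq nat).

Lemma contractD_W g W W' s : contract g (fun r => W r + W' r) s = contract g W s + contract g W' s.
Proof.
elim: s W W' => [|l t IH] W W' /=; first by rewrite addr0.
by rewrite IH; ring.
Qed.

Lemma contractZ_W g a W s : contract g (fun r => a * W r) s = a * contract g W s.
Proof.
elim: s W => [|l t IH] W /=; first by rewrite mulr0.
by rewrite IH; ring.
Qed.

Lemma contract_sumW g n (W : nat -> seq nat -> A) s :
  contract g (fun r => \sum_(a < n) W a r) s = \sum_(a < n) contract g (W a) s.
Proof.
elim: s W => [|l t IH] W /=; first by rewrite big1.
by rewrite (IH (fun a r => W a (l :: r))) big_split mulr_sumr.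
Qed.

Lemma contractD g h W s : contract (fun l => g l + h l) W s = contract g W s + contract h W s.
Proof.
elim: s W => [|l t IH] W /=; first by rewrite addr0.
by rewrite IH; ring.
Qed.

Lemma contract_sum n (b : nat -> A) (g : nat -> nat -> A) W s :
  contract (fun l => \sum_(a < n) b a * g a l) W s = \sum_(a < n) b a * contract (g a) W s.
Proof.
elim: s W => [|l t IH] W /=; first by rewrite big1 // => a _; rewrite mulr0.
rewrite IH mulr_suml -big_split; apply: eq_bigr => a _ /=; ring.
Qed.

Lemma driftUD W W' s : driftU (fun r => W r + W' r) s = driftU W s + driftU W' s.
Proof.
elim: s W W' => [|l t IH] W W' /=; first by rewrite addr0.
rewrite IH (eq_bigr (fun a : 'I_l => drift R l a * W ((a : nat) :: t) + drift R l a * W' ((a : nat) :: t))).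
  by rewrite big_split /=; ring.
by move=> a _; rewrite mulrDr.
Qed.

Lemma driftUZ a W s : driftU (fun r => a * W r) s = a * driftU W s.
Proof.
elim: s W => [|l t IH] W /=; first by rewrite mulr0.
rewrite IH mulrDr mulr_sumr; congr (_ + _).
by apply: eq_bigr => b _; ring.
Qed.

Lemma qvarUD W W' s : qvarU (fun r => W r + W' r) s = qvarU W s + qvarU W' s.
Proof.
elim: s W W' => [|l t IH] W W' /=; first by rewrite addr0.
by rewrite IH contractD_W; ring.
Qed.

Lemma qvarUZ a W s : qvarU (fun r => a * W r) s = a * qvarU W s.
Proof.
elim: s W => [|l t IH] W /=; first by rewrite mulr0.
by rewrite IH contractZ_W mulrDr.
Qed.

Lemma contract_comm g h W s : contract g (contract h W) s = contract h (contract g W) s.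
Proof.
elim: s W => [//|l t IH] W /=.
by rewrite !contractD_W !contractZ_W IH; ring.
Qed.

(** Leibniz rule: the drift acts either on the entry paired by g or on an entry left to W. *)
Lemma driftU_contract g W s : driftU (contract g W) s =
  contract (fun l => \sum_(a < l) drift R l a * g a) W s + contract g (driftU W) s.
Proof.
elim: s W => [|l t IH] W /=; first by rewrite addr0.
rewrite driftUD driftUZ IH contractD_W.
rewrite (contract_sumW g l (fun a r => drift R l a * W (a :: r))).
rewrite (eq_bigr (fun a : 'I_l => drift R l a * g a * W t +
   drift R l a * contract g (fun r => W ((a : nat) :: r)) t)); last first.
  by move=> a _; rewrite mulrDr mulrA.
rewrite big_split /= -mulr_suml.
rewrite [X in _ = _ + (_ + (X + _))](eq_bigr (fun a : 'I_l => drift R l a * contract g (fun r => W ((a : nat) :: r)) t)).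
  by ring.
by move=> a _; rewrite contractZ_W.
Qed.

Lemma qvarU_contract g W s : qvarU (contract g W) s = contract g (qvarU W) s.
Proof.
elim: s W => [//|l t IH] W /=.
by rewrite qvarUD qvarUZ IH contractD_W contract_comm; ring.
Qed.

Lemma deriv_contract g W s : (contract g W s)^`() =
  contract (fun l => (g l)^`()) W s + contract g (fun r => (W r)^`()) s.
Proof.
elim: s W => [|l t IH] W /=; first by rewrite derivC addr0.
by rewrite derivD derivM IH; ring.
Qed.

(** Fitted to [deriv_wickP]: [deriv_Cov] requires positive indices, and the induction hypothesis
    applies to shorter lists. *)
Lemma eq_contract_pos g g' W W' s : pos s -> (forall l, (0 < l)%N -> g l = g' l) ->
  (forall r, pos r -> (size r < size s)%N -> W r = W' r) -> contract g W s = contract g' W' s.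
Proof.
elim: s W W' => [//|l t IH] W W' /= /andP[l0 ht] hg hW.
rewrite hg // hW //; congr (_ + _); apply: IH => // r hr hs.
by apply: hW => //=; rewrite l0.
Qed.

Lemma eq_contract_size g W W' s :
  (forall r, (size r < size s)%N -> W r = W' r) -> contract g W s = contract g W' s.
Proof.
elim: s W W' => [//|l t IH] W W' /= hW.
by rewrite hW //; congr (_ + _); apply: IH => // r hr; apply: hW.
Qed.

Fixpoint wickP_rec n s : A :=
  if n is n'.+1 then if s is k :: t then contract (Cov R k) (wickP_rec n') t else 1 else 1.

Definition wickP s := wickP_rec (size s) s.

Lemma wickP_rec_fuel m n s : (size s <= m)%N -> (size s <= n)%N -> wickP_rec m s = wickP_rec n s.
Proof.
elim: m n s => [|m IH] n [|k t] //=; [by case: n | by case: n |].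
case: n => [|n] h1; first by rewrite ltn0.
move=> h2; apply: eq_contract_size => r hr.
have h3 : (size r <= m)%N by lia.
have h4 : (size r <= n)%N by lia.
exact: IH h3 h4.
Qed.

Lemma wickP_cons k t : wickP (k :: t) = contract (Cov R k) wickP t.
Proof. by apply: eq_contract_size => r hr; apply: wickP_rec_fuel => //; exact: ltnW. Qed.

Lemma deriv_Cov k l : (0 < k)%N -> (0 < l)%N ->
  (Cov R k l)^`() = \sum_(a < k) drift R k a * Cov R a l
    + \sum_(a < l) drift R l a * Cov R k a + qvar R k l.
Proof. by case: k => // k _; case: l => // l _; rewrite Cov_dt /qvar addnS. Qed.

(** Induction by [wickP_cons]. In the derivative of [Cov R k l], the drift in k gives the drift of
    the head; the drift in l completes the Leibniz rule on the tail; [qvar] pairs the head with a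
    tail entry. The pairs inside the tail come from the induction hypothesis. *)
Lemma deriv_wickP s : pos s -> (wickP s)^`() = driftU wickP s + qvarU wickP s.
Proof.
have [n] := ubnP (size s); elim: n s => // n IH [|k t] /=.
  by move=> _ _; rewrite /wickP /= addr0 -polyC1 derivC.
move=> hs /andP[k0 ht].
rewrite wickP_cons deriv_contract.
rewrite (eq_driftU (W' := contract (Cov R k) wickP)); last by move=> r; rewrite wickP_cons.
rewrite (eq_qvarU (W' := contract (Cov R k) wickP)); last by move=> r; rewrite wickP_cons.
rewrite driftU_contract qvarU_contract.
rewrite (eq_contract_pos (g' := fun l => \sum_(a < k) drift R k a * Cov R a l
    + \sum_(a < l) drift R l a * Cov R k a + qvar R k l) (W' := wickP)) //; last first.
  by move=> l l0; apply: deriv_Cov.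
rewrite contractD contractD (contract_sum k (drift R k) (Cov R)).
rewrite (eq_contract_pos (s := t) (g := Cov R k) (W := fun r => (wickP r)^`()) (g' := Cov R k) (W' := fun r => driftU wickP r + qvarU wickP r)) //; last first.
  by move=> r hr hsz; apply: IH => //; lia.
rewrite contractD_W; under [in RHS]eq_bigr => a _ do rewrite wickP_cons.
by ring.
Qed.

Lemma contract_at0 g W s : (forall l, (g l).[0] = 0) -> (contract g W s).[0] = 0.
Proof.
move=> h; elim: s W => [|l t IH] W /=; first by rewrite horner0.
by rewrite hornerD hornerM h mul0r add0r IH.
Qed.

Lemma wickP_at0 s : s != [::] -> (wickP s).[0] = 0.
Proof. by case: s => // k t _; rewrite wickP_cons contract_at0 // => l; apply: Cov_at0. Qed.

End Wick.

Section Limit.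
Variables (R : realFieldType) (c : R) (c_ge0 : 0 <= c).
Variables (E : nat -> nat -> ((nat -> R) -> R) -> R) (hE : chain_expectation E).

Lemma moments_limit ks : pos ks -> approx c (mom E ks) (wickP R ks).
Proof.
(* Means and moments are treated together by induction on the weight: the centred jumps in the
   equation for the moments involve the means. *)
suff H D : (forall a, (a <= D)%N -> approx c (beta E a) (mlim R a)) /\
   (forall s, pos s -> (sumn s <= D)%N -> approx c (mom E s) (wickP R s)).
  by move=> hp; apply: (H (sumn ks)).2.
have mom_nil : approx c (mom E [::]) (wickP R [::]).
  apply: approx_ext (approx1 c) _ => N n /andP[hN _].
  rewrite /mom -[LHS](E_one hE n hN); apply: (E_ext hE) => P; by rewrite /mon big_nil.
elim: D => [|D [IH1 IH2]].
  split=> [[|a] // _|[|[|k] t] //= _ _].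
    apply: (apx_beta c_ge0 hE); rewrite mul0r; apply: approx_ext (approx0 c) _ => N n /andP[hN _].
    rewrite /Jbar -[LHS](E_0 hE n hN); apply: (E_ext hE) => P.
    by rewrite /jump big_ord0 jmean0.
split=> [a|s hs hd].
  rewrite leq_eqVlt => /orP[/eqP ->|]; last exact: IH1.
  by apply: (apx_beta c_ge0 hE); apply: (apx_Jbar c_ge0 hE IH1 IH2); rewrite /= leqnn.
case: s hs hd => [//|k t] hs hd.
by apply: (apx_mom c_ge0 hE IH1 IH2) => //; [apply: deriv_wickP | apply: wickP_at0].
Qed.

End Limit.

(** * The transition probabilities *)

Section PolyAux.
Variable R : realFieldType.

Lemma poly_eq0_off0 (p : {poly R}) : (forall v, v != 0 -> p.[v] = 0) -> p = 0.
Proof.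
move=> h; apply/eqP; apply/negPn/negP => p0.
pose s : seq R := [seq i.+1%:R | i <- iota 0 (size p)].
have us : uniq s.
  by rewrite map_inj_uniq ?iota_uniq // => i j /eqP; rewrite eqr_nat => /eqP [].
have rs : all (root p) s.
  by apply/allP => x /mapP[i _ ->]; rewrite /root h ?eqxx // pnatr_eq0.
by have := max_poly_roots p0 rs us; rewrite size_map size_iota ltnn.
Qed.

Lemma unit_coef_cancel (B q z : {poly R}) M : B`_0 = 1 -> B * q = 'X^M * z ->
  forall i, (i < M)%N -> q`_i = 0.
Proof.
move=> B0 h i; elim/ltn_ind: i => i IH hi.
have := congr1 (fun p : {poly R} => p`_i) h.
rewrite /= coefXnM hi coefM big_ord_recl /= B0 mul1r subn0 big1 ?addr0 // => j _.
by rewrite IH ?mulr0 //; have := ltn_ord j; rewrite /bump /=; lia.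
Qed.

Section Product.
Variables (N : nat) (z : 'I_N -> R).

Definition rprod : {poly R} := \prod_(j < N) (1 - (z j) *: 'X).
Definition rprod' i : {poly R} := \prod_(j < N | j != i) (1 - (z j) *: 'X).

Lemma rprodE i : rprod = (1 - z i *: 'X) * rprod' i.
Proof. by rewrite /rprod (bigD1 i). Qed.

Lemma rprod_geom i M : rprod' i = rprod * \sum_(m < M) (z i ^+ m) *: 'X^m + 'X^M * (z i ^+ M *: rprod' i).
Proof.
rewrite (rprodE i); set B := rprod' i.
have -> : \sum_(m < M) (z i ^+ m) *: 'X^m = \sum_(m < M) (z i *: 'X) ^+ m.
  by apply: eq_bigr => m _; rewrite exprZn.
rewrite -[(1 - _) * B * _]mulrA [B * _]mulrC mulrA.
rewrite -[1 - z i *: 'X]opprB mulNr -subrX1 exprZn -!mul_polyC; ring.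
Qed.

Lemma rprod_at0 : rprod`_0 = 1.
Proof.
rewrite -horner_coef0 /rprod horner_prod big1 // => j _.
by rewrite hornerD hornerN hornerZ hornerX mulr0 subr0 hornerC.
Qed.

(** Newton's identities: the logarithmic derivative of the product is minus the generating function
    of the power sums, here modulo X^M. *)
Lemma deriv_rprod M : exists Z, rprod^`() =
  - (rprod * \sum_(m < M) (\sum_(j < N) z j ^+ m.+1) *: 'X^m) + 'X^M * Z.
Proof.
exists (- \sum_(j < N) z j ^+ M.+1 *: rprod' j).
have -> : rprod^`() = - \sum_(j < N) z j *: rprod' j.
  rewrite /rprod /rprod'.
  have H (I : eqType) (r : seq I) (f : I -> R) : uniq r ->
     (\prod_(j <- r) (1 - f j *: 'X) : {poly R})^`() =
     - \sum_(j <- r) f j *: \prod_(k <- r | k != j) (1 - f k *: 'X).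
    elim: r => [_|i r IH /= /andP[ni ur]]; first by rewrite !big_nil -polyC1 derivC oppr0.
    rewrite !big_cons eqxx /= derivM IH // derivD derivN derivZ derivX -polyC1 derivC polyC1 add0r.
    have -> : \prod_(k <- r | k != i) (1 - f k *: 'X) = \prod_(k <- r) (1 - f k *: 'X) :> {poly R}.
      rewrite big_seq_cond [in RHS]big_seq; apply: eq_bigl => k.
      by case: (boolP (k \in r)) => //= hk; apply/eqP => e; rewrite -e hk in ni.
    rewrite (eq_big_seq (fun j => (1 - f i *: 'X) * (f j *: \prod_(k <- r | k != j) (1 - f k *: 'X)))
      (F1 := fun j => f j *: \prod_(k <- i :: r | k != j) (1 - f k *: 'X))).
      rewrite -mulr_sumr -!mul_polyC; ring.
    move=> j hj; rewrite big_cons ifT ?scalerAr //.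
    by apply: contraNneq ni => ->.
  by rewrite H ?index_enum_uniq.
rewrite mulrN -opprD; congr (- _).
rewrite mulr_sumr.
under [in RHS]eq_bigr do rewrite scaler_suml mulr_sumr.
rewrite exchange_big /= mulr_sumr -big_split; apply: eq_bigr => j _ /=.
rewrite {1}(rprod_geom j M) scalerDr exprS -scalerA.
congr (_ + _); last by rewrite -!scalerAr.
rewrite scalerAr scaler_sumr mulr_sumr; apply: eq_bigr => m _.
by rewrite scalerA exprS.
Qed.

End Product.
End PolyAux.

(** * Averages of y_i^m over the jump position *)

Section KeyIdentity.
Variables (R : realFieldType) (N : nat) (e : R).
Implicit Types y : 'I_N -> R.

Definition bump1 y i : 'I_N -> R := fun j => y j + (j == i)%:R * e.

Definition vdm y : R := \prod_(i < N) \prod_(j < N | (i < j)%N) (y j - y i).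

Definition setat y i t : 'I_N -> R := fun j => if j == i then t else y j.

Lemma vdm_setat y i : exists K, forall t, vdm (setat y i t) = K * \prod_(j < N | j != i) (t - y j).
Proof.
pose s : R := \prod_(j < N | (i < j)%N) (-1).
exists (s * \prod_(a < N | a != i) \prod_(b < N | (a < b)%N && (b != i)) (y b - y a)) => t.
rewrite /vdm (bigD1 i) //=.
have e1 : \prod_(j < N | (i < j)%N) (setat y i t j - setat y i t i) =
   s * \prod_(j < N | (i < j)%N) (t - y j).
  rewrite -big_split; apply: eq_bigr => j hj; rewrite /setat eqxx ifF /=; first by ring.
  by apply/eqP => eji; rewrite eji ltnn in hj.
have e2 : \prod_(a < N | a != i) \prod_(b < N | (a < b)%N) (setat y i t b - setat y i t a) =
  (\prod_(a < N | a != i) \prod_(b < N | (a < b)%N && (b != i)) (y b - y a)) *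
  \prod_(a < N | (a < i)%N) (t - y a).
  rewrite [X in _ = _ * X](_ : _ = \prod_(a < N | a != i) (if (a < i)%N then t - y a else 1)); last first.
    rewrite -big_mkcondr; apply: eq_bigl => a.
    by case: eqP => [->|]; rewrite ?ltnn.
  rewrite -big_split; apply: eq_bigr => a hai /=.
  case: ifP => hlt.
    rewrite (bigD1 i) //= mulrC; congr (_ * _); last by rewrite /setat eqxx (negbTE hai).
    by apply: eq_bigr => b /andP[_ hb]; rewrite /setat (negbTE hb) (negbTE hai).
  rewrite mulr1; apply: eq_big => [b|b hb].
    case: (b =P i) => [->|_]; first by rewrite hlt.
    by rewrite andbT.
  rewrite /setat (negbTE hai) ifF //.
  by apply/eqP => ebi; rewrite ebi hlt in hb.
rewrite e1 e2 [X in _ = _ * X](bigID (fun j : 'I_N => (i < j)%N)) /=.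
rewrite [X in _ = _ * (X * _)](eq_bigl (fun j : 'I_N => (i < j)%N)); last first.
  by move=> j; rewrite andbC; case: ltngtP => //= h; rewrite -val_eqE /= gtn_eqF.
rewrite [X in _ = _ * (_ * X)](eq_bigl (fun j : 'I_N => (j < i)%N)); last first.
  by move=> j; rewrite -val_eqE /=; case: ltngtP.
by ring.
Qed.

(** As a function of one coordinate, V is a constant times a product over the other coordinates;
    comparing two values eliminates the constant. *)
Lemma vdm_ratio y i :
  vdm (bump1 y i) * \prod_(j < N | j != i) (y i - y j) = vdm y * \prod_(j < N | j != i) (y i + e - y j).
Proof.
have [K hK] := vdm_setat y i.
have -> : bump1 y i = setat y i (y i + e).
  apply: functional_extensionality => j; rewrite /bump1 /setat.
  by case: eqP => [->|_]; rewrite ?mul1r ?mul0r ?addr0.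
have -> : vdm y = vdm (setat y i (y i)).
  congr vdm; apply: functional_extensionality => j; rewrite /setat.
  by case: eqP => [->|].
by rewrite !hK; ring.
Qed.

Lemma vdm_neq0 y : injective y -> vdm y != 0.
Proof.
move=> hy; apply/prodf_neq0 => i _; apply/prodf_neq0 => j hij.
by rewrite subr_eq0; apply/eqP => /hy eji; rewrite eji ltnn in hij.
Qed.

Definition boxw y i := vdm (bump1 y i) / vdm y.

(** Lagrange interpolation at the y_i. The difference of the two monic products has degree below N,
    and its value at y_i is e times the product over j <> i of y_i + e - y_j, which [vdm_ratio]
    expresses through [boxw]. *)
Lemma lagrange y (hy : injective y) (u : R) :
  \prod_(j < N) (u - (y j - e)) = \prod_(j < N) (u - y j)
    + \sum_(i < N) e * boxw y i * \prod_(j < N | j != i) (u - y j).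
Proof.
pose pA : {poly R} := \prod_(j < N) ('X - (y j - e)%:P).
pose pB : {poly R} := \prod_(j < N) ('X - (y j)%:P).
pose pi (i : 'I_N) : {poly R} := \prod_(j < N | j != i) ('X - (y j)%:P).
have szN (f : 'I_N -> R) : size (\prod_(j < N) ('X - (f j)%:P) : {poly R}) = N.+1.
  by rewrite size_prod_XsubC /index_enum -enumT size_enum_ord.
have topN (f : 'I_N -> R) : (\prod_(j < N) ('X - (f j)%:P) : {poly R})`_N = 1.
  have := monic_prod_XsubC (index_enum 'I_N) xpredT f.
  by rewrite monicE lead_coefE szN => /eqP.
have szi i : size (pi i) = N.
  have mi : pi i \is monic by apply: monic_prod_XsubC.
  have := szN y; rewrite (bigD1 i) //= -/(pi i) mulrC size_Mmonic ?monicXsubC ?monic_neq0 //.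
  by rewrite size_XsubC addn2 => /= /eq_add_S.
pose P := pA - pB - \sum_(i < N) (e * boxw y i) *: pi i.
have szP : (size P <= N)%N.
  apply/leq_sizeP => j hj; rewrite !coefB coef_sum.
  rewrite [X in _ - X]big1 => [|i _]; last by rewrite coefZ nth_default ?mulr0 // szi.
  move: hj; rewrite leq_eqVlt => /orP[/eqP <-|hj]; first by rewrite !topN subrr subr0.
  by rewrite !nth_default ?subrr // szN.
have hpA x : pA.[x] = \prod_(j < N) (x - (y j - e)).
  by rewrite horner_prod; apply: eq_bigr => j _; rewrite hornerXsubC.
have hpB x : pB.[x] = \prod_(j < N) (x - y j).
  by rewrite horner_prod; apply: eq_bigr => j _; rewrite hornerXsubC.
have hpi i x : (pi i).[x] = \prod_(j < N | j != i) (x - y j).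
  by rewrite horner_prod; apply: eq_bigr => j _; rewrite hornerXsubC.
have hP x : P.[x] = \prod_(j < N) (x - (y j - e)) - \prod_(j < N) (x - y j) -
    \sum_(i < N) e * boxw y i * \prod_(j < N | j != i) (x - y j).
  rewrite hornerD hornerN hornerD hornerN hpA hpB horner_sum; congr (_ - _ - _).
  by apply: eq_bigr => i _; rewrite hornerZ hpi.
have rootP i : P.[y i] = 0.
  have hB0 : \prod_(j < N) (y i - y j) = 0 by rewrite (bigD1 i) //= subrr mul0r.
  have hA0 : \prod_(j < N) (y i - (y j - e)) = e * \prod_(j < N | j != i) (y i + e - y j).
    rewrite (bigD1 i) //= opprB addrCA subrr addr0; congr (_ * _).
    by apply: eq_bigr => j _; rewrite opprB addrA.
  have hS : \sum_(k < N) e * boxw y k * \prod_(j < N | j != k) (y i - y j) =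
      e * boxw y i * \prod_(j < N | j != i) (y i - y j).
    rewrite (bigD1 i) //= [X in _ + X]big1 ?addr0 // => k hk.
    by rewrite (bigD1 i) 1?eq_sym //= subrr mul0r mulr0.
  rewrite hP hB0 hA0 hS subr0.
  have v0 := vdm_neq0 hy.
  have -> : boxw y i = (\prod_(j < N | j != i) (y i + e - y j)) / \prod_(j < N | j != i) (y i - y j).
    apply: (mulIf v0); rewrite /boxw mulfVK // mulrAC; apply/eqP.
    rewrite -mulrA; set Q := \prod_(j < N | j != i) (y i - y j).
    have Q0 : Q != 0.
      by apply/prodf_neq0 => j hj; rewrite subr_eq0; apply/eqP => /hy eji; rewrite eji eqxx in hj.
    by rewrite mulrA eq_sym -(inj_eq (mulIf Q0)) mulfVK // vdm_ratio mulrC.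
  rewrite -mulrA mulfVK; last first.
    by apply/prodf_neq0 => j hj; rewrite subr_eq0; apply/eqP => /hy eji; rewrite eji eqxx in hj.
  by rewrite subrr.
have P0 : P = 0.
  apply/eqP; apply/negPn/negP => nP.
  have hr : all (root P) [seq y i | i <- enum 'I_N].
    by apply/allP => x /mapP[i _ ->]; rewrite /root rootP.
  have hu : uniq [seq y i | i <- enum 'I_N] by rewrite map_inj_uniq ?enum_uniq.
  by have := max_poly_roots nP hr hu; rewrite size_map size_enum_ord ltnNge szP.
have := hP u; rewrite P0 horner0 => /eqP; rewrite eq_sym !subr_eq add0r => /eqP ->.
by rewrite addrC.
Qed.

Definition boxmom y m := e * \sum_(i < N) boxw y i * y i ^+ m.

(** A truncation of the quotient of prod_j (1 - (y_j - e) X) by prod_j (1 - y_j X), as [rprod_split]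
    shows. *)
Definition Psi y M : {poly R} := 1 + \sum_(m < M) boxmom y m *: 'X^(m.+1).

Lemma rprod_split y (hy : injective y) M : exists Z,
  rprod (fun j => y j - e) = rprod y * Psi y M + 'X^(M.+1) * Z.
Proof.
(* This is [lagrange] at u = 1/v, multiplied by v^N; agreement at all v <> 0 suffices for
   polynomials. *)
have step : rprod (fun j => y j - e) = rprod y + \sum_(i < N) (e * boxw y i) *: ('X * rprod' y i).
  apply/eqP; rewrite -subr_eq0; apply/eqP; apply: poly_eq0_off0 => v v0.
  have sc (f : 'I_N -> R) : (rprod f).[v] = v ^+ N * \prod_(j < N) (v^-1 - f j).
    rewrite /rprod horner_prod -[in v ^+ N](card_ord N) -prodr_const -big_split.
    by apply: eq_bigr => j _; rewrite hornerD hornerN hornerZ hornerX hornerC /= mulrBr mulfV // [f j * _]mulrC.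
  rewrite hornerD hornerN hornerD horner_sum !sc (lagrange hy) mulrDr.
  apply/eqP; rewrite subr_eq0; apply/eqP; congr (_ + _).
  rewrite mulr_sumr; apply: eq_bigr => i _.
  rewrite hornerZ hornerM hornerX mulrCA; congr (_ * _).
  rewrite /rprod' horner_prod -[in v ^+ N](card_ord N) -prodr_const (bigD1 i) //= -mulrA -big_split.
  congr (_ * _).
  by apply: eq_bigr => j _; rewrite hornerD hornerN hornerZ hornerX hornerC /= mulrBr mulfV // [y j * _]mulrC.
exists (\sum_(i < N) (e * boxw y i) *: (y i ^+ M *: rprod' y i)).
rewrite step /Psi mulrDr mulr1 -addrA; congr (_ + _).
rewrite !mulr_sumr.
under [X in _ = X + _]eq_bigr => m _ do rewrite /boxmom mulr_sumr scaler_suml mulr_sumr.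
rewrite exchange_big /= -big_split; apply: eq_bigr => i _ /=.
rewrite {1}(rprod_geom y i M) mulrDr scalerDr; congr (_ + _); last first.
  by rewrite mulrA -exprS -!scalerAr.
rewrite -mulr_sumr scalerAr [_ *: (rprod y * _)]scalerAr [LHS]mulrCA; congr (_ * _).
rewrite scaler_sumr mulr_sumr; apply: eq_bigr => m _.
by rewrite scalerA -scalerAr -exprS mulrA.
Qed.

(** The logarithmic derivative of [Psi] is the difference of those of the two products, hence a
    difference of power sums. Reading off coefficients gives the recursion that defines [ph]. *)
Lemma boxmom_rec y (hy : injective y) m :
  m.+1%:R * boxmom y m = \sum_(k < m.+1) (\sum_(j < N) (y j ^+ k.+1 - (y j - e) ^+ k.+1))
      * (if (m - k)%N is n.+1 then boxmom y n else 1).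
Proof.
have [Z hZ] := rprod_split hy m.+1.
have [ZA hA] := deriv_rprod (fun j => y j - e) m.+1.
have [ZB hB] := deriv_rprod y m.+1.
pose B := rprod y. pose Ps := Psi y m.+1.
pose SA : {poly R} := \sum_(k < m.+1) (\sum_(j < N) (y j - e) ^+ k.+1) *: 'X^k.
pose SB : {poly R} := \sum_(k < m.+1) (\sum_(j < N) y j ^+ k.+1) *: 'X^k.
have h : exists W, B * (Ps^`() - Ps * (SB - SA)) = 'X^(m.+1) * W.
  rewrite -/B -/Ps -/SA in hZ hA; rewrite -/B -/SB in hB.
  have := congr1 (@deriv R) hZ; rewrite hA {1}hZ derivD (derivM B) (derivM 'X^_) hB derivXn /=.
  set X := 'X^(m.+1); have -> : 'X^(m.+2) = 'X * X by rewrite exprS.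
  move=> H; exists (ZA - ZB * Ps - Z * m.+2%:R - 'X * Z^`() - 'X * Z * SA).
  have {}H : B * Ps^`() = - ((B * Ps + 'X * X * Z) * SA) + X * ZA
     - (- (B * SB) + X * ZB) * Ps - (X *+ m.+2 * Z + 'X * X * Z^`()).
    by rewrite H; ring.
  by rewrite mulrBr H -[X *+ _]mulr_natl; ring.
have [W hW] := h.
have := unit_coef_cancel (rprod_at0 y) hW (ltnSn m).
rewrite coefB => /eqP; rewrite subr_eq0 => /eqP.
have coPs i : (i <= m.+1)%N -> Ps`_i = if i is n.+1 then boxmom y n else 1.
  move=> hi; rewrite /Ps /Psi coefD coef1 coef_sum; case: i hi => [|i] hi.
    by rewrite big1 ?addr0 // => k _; rewrite coefZ coefXn mulr0.
  rewrite add0r (bigD1 (Ordinal hi)) //= coefZ coefXn eqxx mulr1 big1 ?addr0 //.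
  by move=> k; rewrite -val_eqE /= => hk; rewrite coefZ coefXn eqSS eq_sym (negbTE hk) mulr0.
rewrite coef_deriv coPs // mulr_natl => ->.
rewrite mulrC coefM; apply: eq_bigr => -[k hk] _ /=; rewrite coPs; last by lia.
congr (_ * _); rewrite coefB /SB /SA.
rewrite -(poly_def _ (fun k => \sum_(j < N) y j ^+ k.+1)).
rewrite -(poly_def _ (fun k => \sum_(j < N) (y j - e) ^+ k.+1)).
by rewrite !coef_poly hk sumrB.
Qed.

End KeyIdentity.

(** * The walk weighted by the Vandermonde determinant *)

Section Chain.
Variable R : realFieldType.
Local Notation eps := (invn R).

Definition Pw N (y : 'I_N -> R) (a : nat) : R := eps N * \sum_(j < N) y j ^+ a.

Lemma Qsum_Pw N (y : 'I_N -> R) k : (0 < N)%N ->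
  Qsum N (Pw y) k = \sum_(j < N) (y j ^+ k - (y j - eps N) ^+ k).
Proof.
move=> hN; have P1w a : P1 (Pw y) a = eps N * \sum_(j < N) y j ^+ a.
  case: a => [|a] //=; under eq_bigr do rewrite expr0.
  by rewrite sumr_const card_ord mulrC Neps.
rewrite /Qsum; under eq_bigr do rewrite P1w 2!mulr_sumr.
rewrite exchange_big /=; apply: eq_bigr => j _.
rewrite exprBn big_ord_recl /= subn0 expr0 mul1r mulr1 bin0 mulr1n opprD addNKr -sumrN.
apply: eq_bigr => r _; rewrite /bump /= add1n -mulr_natr [in RHS]exprS [eps N ^+ r.+1]exprS.
by ring.
Qed.

(** With e = 1/N the same number is the lattice step in y and the factor 1/N of the free walk. *)
Lemma boxmom_ph N (y : 'I_N -> R) (hy : injective y) m : (0 < N)%N ->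
  boxmom (eps N) y m = ph N (Pw y) m.+1.
Proof.
move=> hN; elim/ltn_ind: m => m IH.
apply: (@mulfI _ m.+1%:R); first by rewrite pnatr_eq0.
rewrite ph_rec boxmom_rec //; apply: eq_bigr => k _; rewrite Qsum_Pw // subSS.
by case E: (m - k)%N => [|n] //; rewrite IH //; have := ltn_ord k; lia.
Qed.

Lemma vdm_det N (y : 'I_N -> R) : vdm y = \det (Vandermonde N (\row_j y j)).
Proof.
rewrite det_Vandermonde; apply: eq_bigr => i _; apply: eq_bigr => j _.
by rewrite !mxE.
Qed.

Lemma vdm_perm N (y : 'I_N -> R) (s : 'S_N) :
  vdm (fun j => y (s j)) = (-1) ^+ s * vdm y.
Proof.
rewrite !vdm_det.
have -> : Vandermonde N (\row_j y (s j)) = col_perm s (Vandermonde N (\row_j y j)).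
  by apply/matrixP => i j; rewrite !mxE.
by rewrite col_permE det_mulmx det_perm mulrC odd_permV.
Qed.

Lemma vdm_tperm0 N (y : 'I_N -> R) a b : a != b -> y a = y b -> vdm y = 0.
Proof.
move=> hab hy; have := vdm_perm y (tperm a b).
have -> : (fun j => y (tperm a b j)) = y.
  apply: functional_extensionality => j.
  by case: tpermP => [->|->|].
rewrite odd_tperm hab expr1 mulN1r => /eqP; rewrite -addr_eq0 -mulr2n mulrn_eq0 /=.
by move/eqP.
Qed.

(** Stated without division by V because the free walk visits points with equal coordinates. If y_a
    = y_b, then V(y) = 0, jumps at other indices give V = 0, and those at a and at b cancel by
    antisymmetry. *)
Lemma key_identity N (y : 'I_N -> R) m : (0 < N)%N ->
  eps N * \sum_(i < N) vdm (bump1 (eps N) y i) * y i ^+ m = ph N (Pw y) m.+1 * vdm y.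
Proof.
move=> hN; case: (boolP (injectiveb y)) => [/injectiveP hy|/injectivePn [a [b hab hyab]]].
  rewrite -boxmom_ph // /boxmom -mulrA mulr_suml; congr (_ * _); apply: eq_bigr => i _.
  by rewrite /boxw mulrAC mulfVK // vdm_neq0.
rewrite (vdm_tperm0 hab hyab) mulr0.
rewrite (bigD1 a) //= (bigD1 b) 1?eq_sym //= big1 ?addr0 => [|i /andP[ia ib]].
  have -> : vdm (bump1 (eps N) y b) = - vdm (bump1 (eps N) y a).
    rewrite -mulN1r -[-1]expr1 -[in X in _ ^+ X](_ : odd_perm (tperm a b) = 1%N :> nat); last first.
      by rewrite odd_tperm hab.
    rewrite -vdm_perm; congr vdm; apply: functional_extensionality => j; rewrite /bump1.
    case: tpermP => [->|->|/eqP h1 /eqP h2].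
    - by rewrite (negbTE hab) eq_sym (negbTE hab) hyab.
    - by rewrite !eqxx hyab.
    - by rewrite (negbTE h1) (negbTE h2).
  by rewrite hyab mulNr subrr mulr0.
rewrite (@vdm_tperm0 _ _ a b) ?mul0r // /bump1.
by rewrite ![_ == i]eq_sym (negbTE ia) (negbTE ib) hyab.
Qed.

Definition addbox N (g : ('I_N -> R) -> R) (y : 'I_N -> R) : R :=
  eps N * \sum_(i < N) g (bump1 (eps N) y i).

Definition y0 N : 'I_N -> R := fun j => eps N * (N - j.+1)%:R.

(* The Doob transform by V of n steps of the free walk. *)
Definition chainE N n (F : (nat -> R) -> R) : R :=
  iter n (@addbox N) (fun y => vdm y * F (Pw y)) (@y0 N) / vdm (@y0 N).

Lemma jump_horner N a (x : R) : eps N * (jump R N a).[x] = (x + eps N) ^+ a - x ^+ a.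
Proof.
rewrite /jump horner_sum mulr_sumr exprDn big_ord_recl /= subn0 expr0 mulr1 bin0 mulr1n addrC addKr.
apply: eq_bigr => r _; rewrite hornerZ hornerXn /bump /= add1n -[in RHS]mulr_natr exprS; ring.
Qed.

Lemma Pw_bump N (y : 'I_N -> R) i : Pw (bump1 (eps N) y i) = shiftP N (Pw y) (y i).
Proof.
apply: functional_extensionality => a; rewrite /Pw /shiftP expr2 -mulrA jump_horner -mulrDr.
congr (_ * _); rewrite (bigD1 i) //= [in RHS](bigD1 i) //= /bump1 eqxx mul1r.
rewrite (eq_bigr (fun j => y j ^+ a)); first by ring.
by move=> j /negbTE hj; rewrite hj mul0r addr0.
Qed.

(** Functions of the form V times a function of power sums are stable under the free step; this
    yields [E_step]. *)
Lemma addbox_vdm N F (H : (nat -> R) -> {poly R}) (y : 'I_N -> R) : (0 < N)%N ->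
  (forall P x, F (shiftP N P x) = (H P).[x]) ->
  addbox (fun y => vdm y * F (Pw y)) y = vdm y * jmean N (Pw y) (H (Pw y)).
Proof.
move=> hN hF; rewrite /addbox.
under eq_bigr => i _ do rewrite Pw_bump hF horner_coef mulr_sumr.
rewrite exchange_big /= mulr_sumr /jmean mulr_sumr; apply: eq_bigr => m _.
set h := _`_m; transitivity (h * (eps N * \sum_(i < N) vdm (bump1 (eps N) y i) * y i ^+ m)).
  by rewrite mulrCA [in RHS]mulr_sumr; congr (_ * _); apply: eq_bigr => i _; rewrite mulrCA.
by rewrite key_identity //; ring.
Qed.

Lemma y0_inj N : injective (@y0 N).
Proof.
move=> i j; have hN : (0 < N)%N by case: N i {j} => // -[].
move/(congr1 (fun x => N%:R * x)); rewrite /y0 !mulrA Neps // !mul1r => /eqP.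
rewrite eqr_nat => /eqP h; apply/val_inj => /=; have := ltn_ord i; have := ltn_ord j; lia.
Qed.

Lemma iter_addbox_ext N n (f g : ('I_N -> R) -> R) : (forall y, f y = g y) ->
  forall y, iter n (@addbox N) f y = iter n (@addbox N) g y.
Proof. by move=> h; have -> : f = g by apply: functional_extensionality. Qed.

Lemma iter_addbox_lin N n a (f g : ('I_N -> R) -> R) y :
  iter n (@addbox N) (fun y => a * f y + g y) y = a * iter n (@addbox N) f y + iter n (@addbox N) g y.
Proof.
elim: n y => // n IH y; rewrite !iterS /addbox.
under eq_bigr => i _ do rewrite IH.
by rewrite big_split /= -mulr_sumr; ring.
Qed.

Lemma chainE_next N n F (H : (nat -> R) -> {poly R}) : (0 < N)%N ->
  (forall P y, F (shiftP N P y) = (H P).[y]) ->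
  chainE N n.+1 F = chainE N n (fun P => jmean N P (H P)).
Proof.
move=> hN hF; rewrite /chainE iterSr; congr (_ / _).
by apply: iter_addbox_ext => y; apply: addbox_vdm.
Qed.

Lemma chainE_chain : chain_expectation chainE.
Proof.
have v0 N : vdm (@y0 N) != 0 by apply/vdm_neq0/y0_inj.
split.
- move=> N n a F G _; rewrite /chainE mulrA -mulrDl -iter_addbox_lin; congr (_ / _).
  by apply: iter_addbox_ext => y; ring.
- move=> N n F G h; rewrite /chainE; congr (_ / _).
  by apply: iter_addbox_ext => y; rewrite h.
- move=> N n hN; elim: n => [|n IH].
    by rewrite /chainE /= mulr1 mulfV.
  rewrite (@chainE_next _ _ _ (fun _ => 1)) //; last by move=> P y; rewrite hornerC.
  rewrite -[RHS]IH /chainE; congr (_ / _); apply: iter_addbox_ext => y.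
  by rewrite -polyC1 jmeanC.
- move=> N F hN; rewrite /chainE /= mulrAC mulfV // mul1r; congr F.
  apply: functional_extensionality => a; rewrite /Pw /y0.
  rewrite exprS -mulrA; congr (_ * _); rewrite mulr_sumr.
  rewrite (reindex_inj rev_ord_inj) /=; apply: eq_bigr => i _.
  by rewrite exprMn; congr (_ * _%:R ^+ _); have := ltn_ord i; lia.
- by move=> N n F H hN hF; apply: chainE_next.
Qed.

End Chain.

Local Notation R := Rdefinitions.R.
Local Notation "a +z b" := (BinInt.Z.add a b) (at level 50, left associativity).
Local Notation "a -z b" := (BinInt.Z.sub a b) (at level 50, left associativity).
Local Notation z0 := BinNums.Z0.
Local Notation z1 := (BinNums.Zpos BinNums.xH).
Local Notation ZN := BinInt.Z.of_nat.
Local Notation pZ := Rfunctions.powerRZ.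
Local Notation IZR := Rdefinitions.IZR.
Local Notation exp := Rtrigo_def.exp.
Local Notation eps := (invn R).
Local Notation lc := Contour.laurent_coef.

(** * Schur functions *)

Section DetColumn.
Variable K : comNzRingType.

(** Column operations, as multiplication by a unitriangular [U], clear the first row except for its
    last entry. *)
Lemma det_column_reduce N (G : nat -> nat -> K) (c : nat -> K) :
  (forall j, (j < N)%N -> G 0 j = c j * G 0 j.+1) ->
  \det (\matrix_(i < N.+1, j < N.+1) G i j) =
  (-1) ^+ N * G 0 N * \det (\matrix_(i < N, j < N) (G i.+1 j - c j * G i.+1 j.+1)).
Proof.
move=> h0.
pose M := \matrix_(i < N.+1, j < N.+1) G i j.
pose U := \matrix_(k < N.+1, j < N.+1) ((k == j :> nat)%:R - (if k == j.+1 :> nat then c j else 0)).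
have dU : \det U = 1.
  rewrite det_trig.
    by rewrite big1 // => i _; rewrite mxE eqxx ltn_eqF // subr0.
  apply/is_trig_mxP => i j hij; rewrite mxE !ltn_eqF ?subrr //.
  exact: leq_trans hij _.
have MU i j : (M *m U) i j = G i j - (if (j < N)%N then c j * G i j.+1 else 0).
  rewrite mxE; under eq_bigr => k _ do rewrite !mxE mulrBr.
  rewrite sumrB; congr (_ - _).
    rewrite (bigD1 j) //= eqxx mulr1 big1 ?addr0 // => k.
    by rewrite -val_eqE /= => /negbTE ->; rewrite mulr0.
  case: ltnP => hj.
    rewrite (bigD1 (Ordinal (hj : (j.+1 < N.+1)%N))) //= eqxx mulrC big1 ?addr0 // => k.
    by rewrite -val_eqE /= => /negbTE ->; rewrite mulr0.
  rewrite big1 // => k _; rewrite ltn_eqF ?mulr0 //.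
  exact: leq_trans (ltn_ord k) _.
rewrite -/M -[LHS]mulr1 -[X in _ * X = _]dU -det_mulmx (expand_det_row _ ord0) (bigD1 ord_max) //=.
rewrite [X in _ + X]big1 ?addr0 => [|j hj]; last first.
  have hjN : (j < N)%N.
    by rewrite ltn_neqAle -ltnS ltn_ord andbT; move: hj; rewrite -val_eqE.
  by rewrite MU hjN -h0 // subrr mul0r.
rewrite MU ltnn subr0 /cofactor add0n [LHS]mulrCA [LHS]mulrA; congr (_ * \det _).
apply/matrixP => i j; rewrite [LHS]mxE [LHS]mxE [RHS]mxE MU.
by rewrite lift_max ltn_ord.
Qed.

End DetColumn.

Lemma sum_mapE (T : Type) (f : T -> R) s : sum_list (List.map f s) = \sum_(x <- s) f x.
Proof. by elim: s => [|a s IH]; rewrite ?big_nil // big_cons -IH. Qed.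

Lemma sum_listE s : sum_list s = \sum_(x <- s) x.
Proof. by elim: s => [|a s IH]; rewrite ?big_nil // big_cons -IH. Qed.

Lemma sum_flat_map (T U : Type) (f : T -> seq U) (g : U -> R) s :
  \sum_(x <- List.flat_map f s) g x = \sum_(y <- s) \sum_(x <- f y) g x.
Proof.
elim: s => [|a s IH]; first by rewrite !big_nil.
by rewrite big_cons -IH -big_cat.
Qed.

Lemma sum_Lmap (T U : Type) (f : T -> U) (g : U -> R) s :
  \sum_(x <- List.map f s) g x = \sum_(y <- s) g (f y).
Proof. by elim: s => [|a s IH]; rewrite ?big_nil // !big_cons IH. Qed.

Lemma sum_Lseq (g : nat -> R) n : \sum_(x <- List.seq 0 n) g x = \sum_(i < n) g i.
Proof.
have -> : List.seq 0 n = iota 0 n by elim: n (0%N) => //= n IH m; rewrite IH.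
by rewrite -(big_mkord xpredT) /index_iota subn0.
Qed.

Lemma eq_bigIn (T : Type) (f g : T -> R) s : (forall x, List.In x s -> f x = g x) ->
  \sum_(x <- s) f x = \sum_(x <- s) g x.
Proof.
elim: s => [|a s IH] h; first by rewrite !big_nil.
by rewrite !big_cons h ?IH //; [move=> x hx; apply: h; right | left].
Qed.

Lemma pZ_add (x : R) a b : x != 0 -> pZ x (a +z b) = pZ x a * pZ x b.
Proof. by move=> /eqP hx; rewrite Rfunctions.powerRZ_add. Qed.

Lemma sum_Zrange (G h : BinInt.Z -> R) (y : R) b a s : y != 0 ->
  (forall z, G (z +z z1) = y * G z + h z) -> BinInt.Z.le b a ->
  \sum_(m <- Zrange b a) pZ y (a -z m) * h (m +z s) =
  G (a +z z1 +z s) - pZ y (a -z b +z z1) * G (b +z s).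
Proof.
move=> y0 hG hab; rewrite /Zrange sum_Lmap sum_Lseq.
have [n hn] : exists n, (a -z b +z z1) = ZN n.
  by exists (BinInt.Z.to_nat (a -z b +z z1)); lia.
rewrite hn Znat.Nat2Z.id.
have -> : a = (b +z ZN n -z z1) by lia.
have -> : (b +z ZN n -z z1 +z z1 +z s) = (b +z s +z ZN n) by lia.
have H : forall n, \sum_(i < n) pZ y (b +z ZN n -z z1 -z (b +z ZN i)) * h (b +z ZN i +z s) =
     G (b +z s +z ZN n) - pZ y (ZN n) * G (b +z s).
  elim=> [|k IH].
    by rewrite big_ord0 BinInt.Z.add_0_r /= mul1r subrr.
  have eZ : ZN k.+1 = (ZN k +z z1) by lia.
  rewrite eZ big_ord_recr /=.
  have -> : (b +z (ZN k +z z1) -z z1 -z (b +z ZN k)) = z0 by lia.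
  rewrite (eq_bigr (fun i : 'I_k => y * (pZ y (b +z ZN k -z z1 -z (b +z ZN i)) * h (b +z ZN i +z s)))).
    rewrite -mulr_sumr IH.
    have -> : (b +z s +z (ZN k +z z1)) = (b +z s +z ZN k +z z1) by lia.
    have -> : (b +z ZN k +z s) = (b +z s +z ZN k) by lia.
    rewrite hG pZ_add // -[pZ y z0]/(1 : R).
    have -> : pZ y z1 = y by rewrite Rfunctions.powerRZ_1.
    by ring.
  move=> i _; have -> : (b +z (ZN k +z z1) -z z1 -z (b +z ZN i)) = (z1 +z (b +z ZN k -z z1 -z (b +z ZN i))) by lia.
  rewrite pZ_add //; have -> : pZ y z1 = y by rewrite Rfunctions.powerRZ_1.
  by rewrite mulrA.
exact: H.
Qed.

Definition ell (l : seq BinInt.Z) (j : nat) : BinInt.Z :=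
  (nth z0 l j +z ZN (size l - j.+1)).

(** The range of each entry of an interlacing row depends only on the upper row, so the sum
    factorises. *)
Lemma interl_prod a t (u : nat -> BinInt.Z -> R) :
  \sum_(mu <- interl (a :: t)) \prod_(j < size t) u j (nth z0 mu j) =
  \prod_(j < size t) \sum_(m <- Zrange (nth z0 (a :: t) j.+1) (nth z0 (a :: t) j)) u j m.
Proof.
elim: t a u => [|b t IH] a u; first by rewrite /= big_cons big_nil !big_ord0 addr0.
rewrite -[interl _]/(List.flat_map (fun m => List.map (cons m) (interl (b :: t))) (Zrange b a)).
have := IH b (fun j => u j.+1); set I := interl (b :: t) => IHb.
rewrite sum_flat_map big_ord_recl /= mulr_suml; apply: eq_bigr => m _.
rewrite sum_Lmap -IHb mulr_sumr; apply: eq_bigr => mu _.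
by rewrite big_ord_recl.
Qed.

Lemma interl_spec a t mu : nonincreasing (a :: t) -> List.In mu (interl (a :: t)) ->
  size mu = size t /\ nonincreasing (a :: mu).
Proof.
elim: t a mu => [|b t IH] a mu; first by move=> _ [<- //|[]].
move=> [hba hbt] /List.in_flat_map [m [hm]] /List.in_map_iff [mu' [<- hmu']].
have [sz ni] := IH _ _ hbt hmu'.
have [hbm hma] : BinInt.Z.le b m /\ BinInt.Z.le m a.
  move: hm => /List.in_map_iff [i [<- /List.in_seq hi]]; move: hi.
  by rewrite !plusE; lia.
split; first by rewrite /= sz.
split=> //; case: mu' ni {hmu' sz} => [//|x mu'] [hxb h]; split=> //; lia.
Qed.

Lemma nonincr_behead a t : nonincreasing (a :: t) -> nonincreasing t.
Proof. by case: t => [//|b t] []. Qed.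

Lemma nonincr_nth l j : nonincreasing l -> (j.+1 < size l)%N ->
  BinInt.Z.le (nth z0 l j.+1) (nth z0 l j).
Proof.
elim: l j => [//|a [|b t] IH] j; first by [].
by move=> [hba ht]; case: j => [//|j] hj; apply: (IH j).
Qed.

Lemma interl_weight (y : R) a t mu : y != 0 -> size mu = size t ->
  pZ y (nth z0 (a :: t) (size t)) * \prod_(j < size t) pZ y (nth z0 (a :: t) j -z nth z0 mu j)
  = pZ y (sumZ (a :: t) -z sumZ mu).
Proof.
move=> y0; elim: t a mu => [|b t IH] a [|m mu] //.
  by move=> _; rewrite big_ord0 mulr1 /=; congr (pZ y _); lia.
move=> [hs]; rewrite big_ord_recl.
rewrite -[nth _ _ (size _)]/(nth z0 (b :: t) (size t)).
have -> : (sumZ (a :: b :: t) -z sumZ (m :: mu)) =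
   ((a -z m) +z (sumZ (b :: t) -z sumZ mu)).
  rewrite -[sumZ (a :: _)]/(a +z sumZ (b :: t)) -[sumZ (m :: mu)]/(m +z sumZ mu); lia.
by rewrite pZ_add // -IH // mulrCA.
Qed.

(** The common induction step of the bialternant and dimension formulas. After the column operations
    that clear the row of powers of y, each entry telescopes by [sum_Zrange] into a sum over one
    coordinate of mu; multilinearity of the determinant and [interl_prod] recover the branching
    sum. *)
Lemma branching a t (y : R) (g h : nat -> BinNums.Z -> R) : let N := size t in
  nonincreasing (a :: t) -> y != 0 ->
  (forall i, (i < N)%N -> forall z, g i (z +z z1) = y * g i z + h i z) ->
  \det (\matrix_(i < N.+1, j < N.+1)
      (if (i : nat) is i'.+1 then g i' (ell (a :: t) j) else pZ y (ell (a :: t) j))) =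
  (-1) ^+ N * \sum_(mu <- interl (a :: t)) pZ y (sumZ (a :: t) -z sumZ mu) *
       \det (\matrix_(i < N, j < N) h i (ell mu j)).
Proof.
move=> N hni y0 hg; set l := a :: t.
pose c j := pZ y (ell l j -z ell l j.+1).
rewrite (@det_column_reduce _ N (fun i j => if i is i'.+1 then g i' (ell l j) else pZ y (ell l j)) c); last first.
  by move=> j hj; rewrite -pZ_add //; congr (pZ y _); lia.
rewrite -mulrA; congr (_ * _).
have hK (i j : 'I_N) : g i (ell l j) - c j * g i (ell l j.+1) =
   \sum_(m <- Zrange (nth z0 l j.+1) (nth z0 l j))
       pZ y (nth z0 l j -z m) * h i (m +z ZN (N - j.+1)).
  have hj := ltn_ord j.
  rewrite (sum_Zrange (ZN (N - j.+1)) y0 (hg i (ltn_ord i))); last first.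
    exact: nonincr_nth.
  rewrite /c /ell -[size l]/N.+1 subSS [in RHS]subnS.
  have e1 : (nth z0 l j +z z1 +z ZN (N - j).-1) = (nth z0 l j +z ZN (N - j)) by lia.
  rewrite e1 -subnS; congr (_ - pZ y _ * _); lia.
(* The permutation is extended to natural indices, as [interl_prod] expects; the default 0 is never
   reached for j < N. *)
pose sn (s : 'S_N) (j : nat) : nat := if insub j is Some j' then s j' : nat else 0%N.
have snE s (j : 'I_N) : sn s j = s j by rewrite /sn valK.
have detT (f : nat -> nat -> R) : \det (\matrix_(i < N, j < N) f i j) =
   \sum_(s : 'S_N) (-1) ^+ s * \prod_(j < N) f (sn s j) j.
  rewrite -det_tr /determinant; apply: eq_bigr => s _; congr (_ * _).
  by apply: eq_bigr => j _; rewrite !mxE snE.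
have -> : \matrix_(i < N, j < N) (g i (ell l j) - c j * g i (ell l j.+1)) =
  \matrix_(i < N, j < N) (\sum_(m <- Zrange (nth z0 l j.+1) (nth z0 l j))
       pZ y (nth z0 l j -z m) * h i (m +z ZN (N - j.+1))).
  by apply/matrixP => i j; rewrite !mxE hK.
rewrite (detT (fun i j => \sum_(m <- Zrange (nth z0 l j.+1) (nth z0 l j))
       pZ y (nth z0 l j -z m) * h i (m +z ZN (N - j.+1)))).
under eq_bigr => s _ do rewrite -(interl_prod a t (fun j m => pZ y (nth z0 l j -z m) * h (sn s j) (m +z ZN (N - j.+1)))) mulr_sumr.
rewrite exchange_big /= mulr_sumr; apply: eq_bigIn => mu hmu.
have [szmu _] := interl_spec hni hmu.
rewrite (detT (fun i j => h i (ell mu j))) -(interl_weight a y0 szmu) -/l !mulr_sumr.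
have -> : ell l N = nth z0 l (size t) by rewrite /ell -[size l]/N.+1 subnn; apply: BinInt.Z.add_0_r.
apply: eq_bigr => s _; rewrite big_split /= -mulrA; congr (_ * _).
rewrite [LHS]mulrCA; congr (_ * (_ * _)).
by apply: eq_bigr => j _; rewrite /ell szmu.
Qed.

Fixpoint vdm_seq (xs : seq R) : R := if xs is y :: t then \prod_(x <- t) (y - x) * vdm_seq t else 1.

Lemma schur_rev_cons y xs l : schur_rev (y :: xs) l =
  \sum_(mu <- interl l) schur_rev xs mu * pZ y (sumZ l -z sumZ mu).
Proof. exact: sum_mapE. Qed.

(** [branching] with g the powers of x_i and h = (x_i - y) g; the factors x_i - y supply the
    Vandermonde product. *)
Lemma bialternant xs l : all (fun x => x != 0) xs -> size l = size xs -> nonincreasing l ->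
  \det (\matrix_(i < size xs, j < size xs) pZ (nth 0 xs i) (ell l j)) = schur_rev xs l * vdm_seq xs.
Proof.
elim: xs l => [|y xs IH] [|a t] //; first by rewrite det_mx00 mulr1.
move=> /andP[y0 hxs] [szt] hni; rewrite schur_rev_cons [vdm_seq _]/=.
have hg i : (i < size t)%N -> forall z, pZ (nth 0 xs i) (z +z z1) =
    y * pZ (nth 0 xs i) z + (nth 0 xs i - y) * pZ (nth 0 xs i) z.
  rewrite szt => hi z; rewrite pZ_add; last by apply: (allP hxs); apply: mem_nth.
  by rewrite Rfunctions.powerRZ_1; ring.
have := branching hni y0 hg; rewrite /= szt => hb.
transitivity (\det (\matrix_(i < (size xs).+1, j < (size xs).+1)
   (if (i : nat) is i'.+1 then pZ (nth 0 xs i') (ell (a :: t) j) else pZ y (ell (a :: t) j)))).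
  by congr (\det _); apply/matrixP => -[[|i] hi] j; rewrite !mxE.
rewrite hb mulr_sumr mulr_suml; apply: eq_bigIn => mu hmu.
have [szmu ni] := interl_spec hni hmu.
have -> : \matrix_(i < size xs, j < size xs) ((nth 0 xs i - y) * pZ (nth 0 xs i) (ell mu j)) =
   diag_mx (\row_(i < size xs) (nth 0 xs i - y)) *m \matrix_(i < size xs, j < size xs) pZ (nth 0 xs i) (ell mu j).
  by apply/matrixP => i j; rewrite mul_diag_mx !mxE.
rewrite det_mulmx det_diag (IH mu) ?szmu //; last exact: nonincr_behead ni.
have -> : \prod_(x <- xs) (y - x) = (-1) ^+ size xs * \prod_(i < size xs) (\row_(i < size xs) (nth 0 xs i - y)) 0 i.
  rewrite (big_nth 0) big_mkord.
  have -> : (-1) ^+ size xs = \prod_(i < size xs) (-1) :> R by rewrite prodr_const card_ord.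
  rewrite -big_split.
  by apply: eq_bigr => i _; rewrite mxE /=; ring.
by ring.
Qed.

Lemma schur_rev_nil0 xs : all (fun x => x != 0) xs -> schur_rev xs (nseq (size xs) z0) = 1.
Proof.
elim: xs => [//|y xs IH] /andP[y0 hxs]; rewrite schur_rev_cons.
have hi n : interl (nseq n.+1 z0) = [:: nseq n z0] by elim: n => //= n ->.
have hs n : sumZ (nseq n z0) = z0 by elim: n.
by rewrite hi big_seq1 !hs IH // mulr1.
Qed.

Lemma nonincr_nseq n : nonincreasing (nseq n z0).
Proof. by elim: n => [|[|n] IH] //; split. Qed.

(** The binomial coefficient of x/e over i as a polynomial in x. *)
Definition binpol (e : R) (i : nat) : {poly R} :=
  (i`!%:R)^-1 *: \prod_(k < i) (e^-1 *: 'X - k%:R%:P).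

Lemma binpol_step e i z : e != 0 ->
  (binpol e i.+1).[e * Rdefinitions.IZR (z +z z1)] =
  (binpol e i.+1).[e * Rdefinitions.IZR z] + (binpol e i).[e * Rdefinitions.IZR z].
Proof.
move=> e0; rewrite /binpol !hornerZ !horner_prod.
have hh n w : \prod_(k < n) (e^-1 *: 'X - k%:R%:P).[e * w] = \prod_(k < n) (w - k%:R) :> R.
  by apply: eq_bigr => k _; rewrite hornerD hornerN hornerC hornerZ hornerX mulKf.
rewrite !hh; have -> : Rdefinitions.IZR (z +z z1) = Rdefinitions.IZR z + 1 by rewrite RIneq.plus_IZR.
set w := Rdefinitions.IZR z.
have e1 : \prod_(k < i.+1) (w + 1 - k%:R) = (w + 1) * \prod_(k < i) (w - k%:R).
  rewrite big_ord_recl subr0; congr (_ * _); apply: eq_bigr => k _.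
  by rewrite lift0 -natr1; ring.
rewrite e1 big_ord_recr /= factS natrM invfM.
set P := \prod_(k < i) _.
have f0 : (i.+1%:R : R) != 0 by rewrite pnatr_eq0.
have -> : (w + 1) * P = P * (w - i%:R) + i.+1%:R * P by rewrite -natr1; ring.
rewrite mulrDr; congr (_ + _).
by rewrite mulrACA mulVf // mul1r.
Qed.

(** At x = 1 with N > 1 the bialternant formula degenerates to 0 = 0, so the value comes from
    [branching] with y = 1 and Pascal's rule. *)
Lemma schur_rev_ones N e l : e != 0 -> size l = N -> nonincreasing l ->
  schur_rev (nseq N 1) l = (\prod_(k < N) (-1) ^+ k) *
    \det (\matrix_(i < N, j < N) (binpol e i).[e * Rdefinitions.IZR (ell l j)]).
Proof.
move=> e0; elim: N l => [|N IH] [|a t] //; first by rewrite det_mx00 big_ord0 mulr1.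
move=> [szt] hni; rewrite -[nseq _ _]/(1 :: nseq N 1) schur_rev_cons.
have y0 : (1 : R) != 0 by rewrite oner_eq0.
have hg i : (i < size t)%N -> forall z, (binpol e i.+1).[e * Rdefinitions.IZR (z +z z1)] =
  1 * (binpol e i.+1).[e * Rdefinitions.IZR z] + (binpol e i).[e * Rdefinitions.IZR z].
  by move=> _ z; rewrite binpol_step // mul1r.
have p1 z : pZ 1 z = 1 by apply: Rfunctions.powerRZ_R1.
have := branching hni y0 hg; rewrite /= szt => hb.
have -> : \matrix_(i < N.+1, j < N.+1) (binpol e i).[e * Rdefinitions.IZR (ell (a :: t) j)] =
  \matrix_(i < N.+1, j < N.+1)
      (if (i : nat) is i'.+1 then (binpol e i'.+1).[e * Rdefinitions.IZR (ell (a :: t) j)] else pZ 1 (ell (a :: t) j)).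
  apply/matrixP => -[[|i] hi] j; rewrite !mxE //=.
  by rewrite p1 /binpol big_ord0 fact0 invr1 scale1r hornerC.
rewrite hb big_ord_recr /= !mulr_sumr; apply: eq_bigIn => mu hmu.
have [szmu ni] := interl_spec hni hmu.
rewrite (IH mu) ?szmu //; last exact: nonincr_behead ni.
rewrite p1 mulr1 mul1r; set q := \prod_(k < N) _; set d := \det _.
by rewrite mulrA -[_ * _ * (-1) ^+ N]mulrA -expr2 sqrr_sign mulr1.
Qed.

(** Row i consists of values of a polynomial of degree at most i, so the matrix is a coefficient
    matrix times a Vandermonde matrix. Only independence of K from l matters; its value is fixed
    later at the empty signature. *)
Lemma dimension_vdm N e : e != 0 -> exists K, forall l, size l = N -> nonincreasing l ->
  schur_rev (nseq N 1) l = K * vdm (fun j : 'I_N => e * Rdefinitions.IZR (ell l j)).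
Proof.
move=> e0; exists ((\prod_(k < N) (-1) ^+ k) * \det (\matrix_(i < N, k < N) (binpol e i)`_k)) => l hs hni.
rewrite (schur_rev_ones e0 hs hni) -mulrA; congr (_ * _).
rewrite vdm_det -det_mulmx; congr (\det _); apply/matrixP => i j; rewrite !mxE.
have sz : (size (binpol e i) <= N)%N.
  have h : (size (\prod_(k < i) (e^-1 *: 'X - k%:R%:P) : {poly R})%R <= i.+1)%N.
    apply: (leq_trans (size_poly_prod_leq _ _)).
    rewrite card_ord leq_subLR.
    apply: (@leq_trans (\sum_(k < i) 2).+1).
      rewrite ltnS; apply: leq_sum => k _.
      apply: (leq_trans (size_polyD _ _)); rewrite size_polyN geq_max.
      rewrite (leq_trans (size_scale_leq _ _)) ?size_polyX //=.
      by rewrite (leq_trans (size_polyC_leq1 _)).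
    by rewrite sum_nat_const card_ord; lia.
  apply: (leq_trans (size_scale_leq _ _)); apply: leq_trans h _.
  exact: ltn_ord.
rewrite (horner_coef_wide _ sz); apply: eq_bigr => k _.
by rewrite !mxE.
Qed.

Lemma interpolation (T : Type) (q f : T -> R) (s : seq T) :
  (forall a b, List.In a s -> List.In b s -> q a = q b -> f a = f b) ->
  exists P : {poly R}, forall a, List.In a s -> P.[q a] = f a.
Proof.
elim: s => [|a s IH] h; first by exists 0.
have [P hP] : exists P : {poly R}, forall a, List.In a s -> P.[q a] = f a.
  by apply: IH => b c hb hc; apply: h; right.
have mapP_In x : x \in map q s -> exists2 b, List.In b s & x = q b.
  elim: (s) => //= b t IHt; rewrite in_cons => /orP[/eqP ->|/IHt [d hd ->]]; first by exists b; [left|].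
  by exists d; [right|].
case: (boolP (q a \in map q s)) => [/mapP_In [b hb e]|hn].
  exists P => d [<-|]; last exact: hP.
  by rewrite e hP //; apply: h => //; [right | left].
pose M : {poly R} := \prod_(x <- map q s) ('X - x%:P).
have M0 : M.[q a] != 0 by rewrite -/(root M (q a)) root_prod_XsubC.
exists (P + ((f a - P.[q a]) / M.[q a]) *: M) => d [<-|hd].
  by rewrite hornerD hornerZ mulfVK // addrC subrK.
rewrite hornerD hornerZ hP //; have : root M (q d).
  by rewrite root_prod_XsubC; elim: (s) hd => //= b t IHt [<-|/IHt ht]; rewrite in_cons ?eqxx ?ht ?orbT.
by rewrite /root => /eqP ->; rewrite mulr0 addr0.
Qed.

Lemma exists_nonroot (p : {poly R}) : p != 0 -> exists t : nat, p.[t%:R] != 0.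
Proof.
move=> p0; pose s : seq R := [seq i%:R | i <- iota 0 (size p)].
have us : uniq s.
  by rewrite map_inj_uniq ?iota_uniq // => i j /eqP; rewrite eqr_nat => /eqP.
case: (boolP (all (root p) s)) => [rs|].
  by have := max_poly_roots p0 rs us; rewrite size_map size_iota ltnn.
by rewrite -has_predC => /hasP[x /mapP[t _ ->] ht]; exists t.
Qed.

(** * Linear functionals attached to Laurent polynomials *)

Section Rep.
Variable N : nat.
Local Notation LZ := ('I_N -> BinNums.Z).

Definition evalx (x : 'I_N -> R) (l : LZ) : R := \prod_(i < N) pZ (x i) (l i).

(* [Phi] is the functional obtained from the Laurent polynomial [phi] by the
   substitution x^l -> F l. *)
Definition Rep (phi : ('I_N -> R) -> R) (Phi : (LZ -> R) -> R) :=
  exists s : seq (R * LZ),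
    (forall x, (forall i, 0 < x i) -> phi x = \sum_(p <- s) p.1 * evalx x p.2) /\
    (forall F, Phi F = \sum_(p <- s) p.1 * F p.2).

Lemma evalx_exp (u : 'I_N -> R) l :
  evalx (fun i => exp (u i)) l = exp (\sum_(i < N) IZR (l i) * u i).
Proof.
rewrite /evalx; apply: (big_rec2 (fun a b => a = exp b)); first by rewrite Rtrigo_def.exp_0.
move=> i a b _ ->; rewrite Exp_prop.exp_plus; congr (_ * _).
by rewrite Rpower.powerRZ_Rpower ?/Rpower.Rpower ?Rpower.ln_exp //; apply: Exp_prop.exp_pos.
Qed.

Lemma exp_expr (x : R) k : exp (k%:R * x) = exp x ^+ k.
Proof.
elim: k => [|k IH]; first by rewrite mul0r expr0 Rtrigo_def.exp_0.
by rewrite -natr1 mulrDl mul1r Exp_prop.exp_plus IH exprSr.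
Qed.

(* Take u_i = t^i, with t avoiding the roots of all the polynomials [d p q]. *)
Lemma separate (s : seq (R * LZ)) : exists u : 'I_N -> R, forall p q, List.In p s -> List.In q s ->
  \sum_(i < N) IZR (p.2 i) * u i = \sum_(i < N) IZR (q.2 i) * u i -> p.2 = q.2.
Proof.
pose d (p q : R * LZ) : {poly R} := \poly_(i < N) (if insub i is Some j then IZR (p.2 j) - IZR (q.2 j) else 0).
have dE p q t : (d p q).[t] = \sum_(i < N) (IZR (p.2 i) - IZR (q.2 i)) * t ^+ i.
  by rewrite horner_poly; apply: eq_bigr => i _; rewrite valK.
have d0 p q : d p q = 0 -> p.2 = q.2.
  move=> h; apply: functional_extensionality => i; apply: RIneq.eq_IZR.
  have := congr1 (fun r : {poly R} => r`_i) h; rewrite /= coef_poly ltn_ord valK coef0.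
  by move/eqP; rewrite subr_eq0 => /eqP.
pose P : {poly R} := \prod_(p <- s) \prod_(q <- s) (if d p q == 0 then 1 else d p q).
have P0 : P != 0.
  rewrite /P; apply: (big_ind (fun r : {poly R} => r != 0)); rewrite ?oner_eq0 //.
    by move=> x y hx hy; rewrite mulf_neq0.
  move=> p _; apply: (big_ind (fun r : {poly R} => r != 0)); rewrite ?oner_eq0 //.
    by move=> x y hx hy; rewrite mulf_neq0.
  by move=> q _; case: (boolP (d p q == 0)); rewrite ?oner_eq0.
have [t ht] := exists_nonroot P0.
exists (fun i => t%:R ^+ i) => p q hp hq e.
apply: d0; apply/eqP/negPn/negP => hd.
have prodIn (T : Type) (f : T -> {poly R}) (r : seq T) a : List.In a r -> (\prod_(x <- r) f x).[t%:R] != 0 -> (f a).[t%:R] != 0.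
  elim: r => [[]|b r IH /= [->|/IH h]]; rewrite big_cons hornerM mulf_eq0 negb_or => /andP[h1 h2] //.
  exact: h.
have := prodIn _ _ _ _ hq (prodIn _ _ _ _ hp ht).
rewrite (negbTE hd) dE; under eq_bigr do rewrite mulrBl.
by rewrite sumrB e subrr eqxx.
Qed.

(** Choose u so that distinct exponents l give distinct q = exp (sum_i l_i u_i), and write F as a
    polynomial in q. Then Phi F is a combination of values of phi at the points with x_i = exp (k
    u_i). *)
Lemma Rep_unique phi Phi F : Rep phi Phi -> (forall x, (forall i, 0 < x i) -> phi x = 0) -> Phi F = 0.
Proof.
move=> [s [h1 h2]] h0; rewrite h2.
have [u hu] := separate s.
pose q (p : R * LZ) := exp (\sum_(i < N) IZR (p.2 i) * u i).
have [P hP] : exists P : {poly R}, forall p, List.In p s -> P.[q p] = F p.2.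
  apply: (interpolation (f := fun p => F p.2)) => a b ha hb /Rpower.exp_inv e.
  by rewrite (hu a b ha hb).
rewrite (eq_bigIn (g := fun p => \sum_(k < size P) P`_k * (p.1 * q p ^+ k))); last first.
  move=> p hp; rewrite -hP // horner_coef mulr_sumr; apply: eq_bigr => k _; ring.
rewrite exchange_big big1 // => k _; rewrite -mulr_sumr.
have hx i : 0 < exp (k%:R * u i) by apply/RltP; apply: Exp_prop.exp_pos.
have := h0 _ hx; rewrite h1 // => e.
rewrite (eq_bigr (fun p => p.1 * evalx (fun i => exp (k%:R * u i)) p.2)) ?e ?mulr0 // => p _.
rewrite evalx_exp -exp_expr; congr (_ * exp _); rewrite mulr_sumr.
by apply: eq_bigr => i _; ring.
Qed.

Lemma Rep_ext phi Phi phi' Phi' : Rep phi Phi ->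
  (forall x, (forall i, 0 < x i) -> phi' x = phi x) -> (forall F, Phi' F = Phi F) -> Rep phi' Phi'.
Proof.
by move=> [s [h1 h2]] e1 e2; exists s; split=> [x hx|F]; rewrite ?e1 ?e2 ?h1 ?h2.
Qed.

Lemma Rep_mon l : Rep (fun x => evalx x l) (fun F => F l).
Proof. by exists [:: (1, l)]; split=> *; rewrite big_seq1 mul1r. Qed.

Lemma Rep0 : Rep (fun _ => 0) (fun _ => 0).
Proof. by exists [::]; split=> *; rewrite big_nil. Qed.

Lemma Rep_D phi Phi phi' Phi' : Rep phi Phi -> Rep phi' Phi' ->
  Rep (fun x => phi x + phi' x) (fun F => Phi F + Phi' F).
Proof.
move=> [s [h1 h2]] [t [h1' h2']]; exists (s ++ t).
by split=> *; rewrite big_cat /= ?h1 ?h1' ?h2 ?h2'.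
Qed.

Lemma Rep_Z a phi Phi : Rep phi Phi -> Rep (fun x => a * phi x) (fun F => a * Phi F).
Proof.
move=> [s [h1 h2]]; exists [seq (a * p.1, p.2) | p <- s].
split=> *; rewrite big_map /= ?h1 ?h2 // mulr_sumr; by apply: eq_bigr => p _; rewrite mulrA.
Qed.

Lemma Rep_sum (I : Type) (r : seq I) phi Phi : (forall i : I, Rep (phi i) (Phi i)) ->
  Rep (fun x => \sum_(i <- r) phi i x) (fun F => \sum_(i <- r) Phi i F).
Proof.
move=> h; elim: r => [|i r IH].
  by apply: Rep_ext Rep0 _ _ => *; rewrite big_nil.
by apply: Rep_ext (Rep_D (h i) IH) _ _ => *; rewrite big_cons.
Qed.

Definition incZ (l : LZ) i : LZ := fun j => if j == i then l j +z z1 else l j.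

Lemma Rep_mulx i phi Phi : Rep phi Phi ->
  Rep (fun x => x i * phi x) (fun F => Phi (fun l => F (incZ l i))).
Proof.
move=> [s [h1 h2]]; exists [seq (p.1, incZ p.2 i) | p <- s].
split=> [x hx|F]; rewrite big_map /= ?h1 ?h2 // mulr_sumr; apply: eq_bigr => p _.
rewrite mulrCA; congr (_ * _); rewrite /evalx (bigD1 i) //= [in RHS](bigD1 i) //= /incZ eqxx.
rewrite pZ_add ?gt_eqF // Rfunctions.powerRZ_1 mulrA [x i * _]mulrC; congr (_ * _).
by apply: eq_bigr => j /negbTE ->.
Qed.

Definition addboxZ (F : LZ -> R) (l : LZ) : R := \sum_(i < N) F (incZ l i).

(** Multiplication by x_1 + ... + x_N is dual to a free step applied to the test function; this is
    how the Schur generating function produces the walk. *)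
Lemma Rep_mulsum phi Phi : Rep phi Phi ->
  Rep (fun x => (\sum_(i < N) x i) * phi x) (fun F => Phi (addboxZ F)).
Proof.
move=> h; apply: Rep_ext (Rep_sum (index_enum 'I_N) (fun i => Rep_mulx i h)) _ _.
  by move=> x _; rewrite mulr_suml.
move=> F; have [s [_ h2]] := h; rewrite h2 /addboxZ.
under eq_bigr do rewrite mulr_sumr.
by rewrite exchange_big; apply: eq_bigr => i _; rewrite h2.
Qed.

Lemma Rep_mulpow n phi Phi : Rep phi Phi ->
  Rep (fun x => (\sum_(i < N) x i) ^+ n * phi x) (fun F => Phi (iter n addboxZ F)).
Proof.
move=> h; elim: n => [|n IH]; first by apply: Rep_ext h _ _ => // x _; rewrite expr0 mul1r.
by apply: Rep_ext (Rep_mulsum IH) _ _ => [x _|F]; rewrite ?exprS ?mulrA // iterSr.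
Qed.

Lemma Rep_det (l : LZ) : Rep (fun x => \det (\matrix_(i < N, j < N) pZ (x i) (l j)))
  (fun F => \sum_(s : 'S_N) (-1) ^+ s * F (fun i => l (s i))).
Proof.
apply: Rep_ext (Rep_sum (index_enum _) (fun s : 'S_N => Rep_Z ((-1) ^+ s) (Rep_mon (fun i => l (s i))))) _ _ => //.
move=> x _; rewrite /determinant; apply: eq_bigr => s _; congr (_ * _).
by apply: eq_bigr => i _; rewrite mxE.
Qed.

End Rep.

(** * The measure as the law of the chain *)

Lemma IZR_ZN n : IZR (ZN n) = n%:R.
Proof. by rewrite -RIneq.INR_IZR_INZ INRE. Qed.

Lemma In_mem (T : eqType) (s : seq T) t : List.In t s -> t \in s.
Proof. by elim: s => [[]|b r IH /= [->|/IH h]]; rewrite in_cons ?eqxx ?h ?orbT. Qed.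

Section Antisymmetry.
Variable N : nat.

(** On such functions the N! terms of an alternant all give the same value. *)
Definition asym (G : ('I_N -> R) -> R) := forall (s : 'S_N) y, G (fun i => y (s i)) = (-1) ^+ s * G y.

Lemma Pw_perm (y : 'I_N -> R) (s : 'S_N) : Pw (fun i => y (s i)) = Pw y.
Proof.
apply: functional_extensionality => a; rewrite /Pw; congr (_ * _).
by rewrite [RHS](reindex_inj (@perm_inj _ s)).
Qed.

Lemma asym_vdm F : asym (fun y => vdm y * F (Pw y)).
Proof. by move=> s y; rewrite vdm_perm Pw_perm mulrA. Qed.

Lemma asym_addbox G : asym G -> asym (addbox G).
Proof.
move=> hG s y; rewrite /addbox mulrCA; congr (_ * _); rewrite mulr_sumr.
rewrite [RHS](reindex_inj (@perm_inj _ s)) /=; apply: eq_bigr => i _.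
rewrite -hG; congr G; apply: functional_extensionality => j; rewrite /bump1.
by rewrite (inj_eq (@perm_inj _ s)).
Qed.

Lemma asym_iter n G : asym G -> asym (iter n (@addbox R N) G).
Proof. by move=> h; elim: n => // n IH; apply: asym_addbox. Qed.

Definition scaleZ (l : 'I_N -> BinNums.Z) : 'I_N -> R := fun i => eps N * IZR (l i).

Lemma addboxZ_scale n G l : (0 < N)%N ->
  iter n (@addboxZ N) (fun l => G (scaleZ l)) l = N%:R ^+ n * iter n (@addbox R N) G (scaleZ l).
Proof.
move=> hN; elim: n l => [|n IH] l; first by rewrite expr0 mul1r.
rewrite !iterS {1}/addboxZ /addbox exprS mulrACA Neps // mul1r mulr_sumr.
apply: eq_bigr => i _; rewrite IH.
have -> // : scaleZ (incZ l i) = bump1 (eps N) (scaleZ l) i.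
apply: functional_extensionality => j; rewrite /scaleZ /incZ /bump1.
by case: eqP => _; rewrite ?mul1r ?mul0r ?addr0 // RIneq.plus_IZR mulrDr mulr1.
Qed.

Lemma sum_asym G y : asym G -> \sum_(s : 'S_N) (-1) ^+ s * G (fun i => y (s i)) = N`!%:R * G y.
Proof.
move=> hG; rewrite (eq_bigr (fun _ => G y)) => [|s _].
  by rewrite sumr_const card_Sn mulr_natl.
by rewrite hG mulrA -expr2 sqrr_sign mul1r.
Qed.

End Antisymmetry.

Definition ycoord N (l : seq BinNums.Z) : 'I_N -> R := fun j => eps N * IZR (ell l j).

Lemma ycoord_nseq0 N : ycoord (nseq N z0) = @y0 R N.
Proof.
apply: functional_extensionality => j; rewrite /ycoord /y0 /ell size_nseq nth_nseq if_same.
by rewrite BinInt.Z.add_0_l IZR_ZN.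
Qed.

Lemma ell_lt l i j : nonincreasing l -> (i < j)%N -> (j < size l)%N -> BinInt.Z.lt (ell l j) (ell l i).
Proof.
move=> hni; elim: j => // j IH; rewrite ltnS leq_eqVlt => /orP[/eqP ->|hij] hj.
  by have := nonincr_nth hni hj; rewrite /ell; lia.
have h1 := IH hij (ltnW hj); apply: (BinInt.Z.lt_trans _ _ _ _ h1).
by have := nonincr_nth hni hj; rewrite /ell; lia.
Qed.

Lemma ycoord_inj N l : (0 < N)%N -> size l = N -> nonincreasing l -> injective (ycoord l : 'I_N -> R).
Proof.
move=> hN hs hni i j; rewrite /ycoord => /mulfI h.
have e0 : eps N != 0 by rewrite /invn invr_eq0 pnatr_eq0 -lt0n.
have {}h := RIneq.eq_IZR _ _ (h e0).
apply/val_inj; case: (ltngtP i j) => // hij.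
  by have := ell_lt hni hij; rewrite hs ltn_ord h => /(_ isT) /BinInt.Z.lt_irrefl.
by have := ell_lt hni hij; rewrite hs ltn_ord h => /(_ isT) /BinInt.Z.lt_irrefl.
Qed.

Lemma expectE rho f : expect rho f = \sum_(p <- rho) p.2 * f p.1.
Proof. exact: sum_mapE. Qed.

Lemma rev_involutive_sum (xs : seq R) : sum_list (List.rev xs) = \sum_(x <- xs) x.
Proof.
have -> : List.rev xs = rev xs.
  by elim: xs => //= a s IH; rewrite IH rev_cons -cats1.
by rewrite sum_listE (perm_big xs) // perm_rev.
Qed.

Lemma repeat_nseq N (x : R) : List.rev (List.repeat x N) = nseq N x.
Proof. by rewrite List.rev_repeat; elim: N => //= n ->. Qed.

Lemma bialternant_size N (xs : seq R) l : size xs = N -> all (fun x => x != 0) xs ->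
  size l = N -> nonincreasing l ->
  \det (\matrix_(i < N, j < N) pZ (nth 0 xs i) (ell l j)) = schur_rev xs l * vdm_seq xs.
Proof. by move=> <-; apply: bialternant. Qed.

Section Expectation.
Variables (N n : nat) (rho : fmeasure).
Hypotheses (hN : (0 < N)%N) (hP : is_prob_GT N rho) (hS : has_SGF_tensor_power N n rho).

Lemma rho_sig p : List.In p rho -> size p.1 = N /\ nonincreasing p.1.
Proof. by case: hP => /List.Forall_forall h _ /h [[h1 h2] _]. Qed.

(** Multiplied by the Vandermonde product, the generating function identity equates combinations of
    alternants. The substitution x^l -> V F turns the left side into N! times the sum of rho V F /
    s(1), where s(1) = K V, and the right side into N! times n free steps of V F from the empty
    signature. *)
Lemma expect_chain F : expect rho (fun l => F (Pw (@ycoord N l))) = chainE N n F.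
Proof.
have e0 : eps N != 0 by rewrite /invn invr_eq0 pnatr_eq0 -lt0n.
have [K hK] := dimension_vdm N e0.
(* The Schur function of the empty signature is 1, which determines K. *)
have K1 : K * vdm (@y0 R N) = 1.
  rewrite -ycoord_nseq0 -hK ?size_nseq //; last exact: nonincr_nseq.
  have := @schur_rev_nil0 (nseq N 1); rewrite size_nseq => -> //.
  by apply/allP => x /nseqP[-> _]; rewrite oner_eq0.
have K0 : K != 0 by apply/eqP => k0; move: K1; rewrite k0 mul0r => /eqP; rewrite eq_sym oner_eq0.
pose del : 'I_N -> BinNums.Z := fun j => ell (nseq N z0) j.
pose s1 l := schur_rev (nseq N 1) l.
pose Phi1 (p : seq BinNums.Z * R) := (p.2 / s1 p.1).
have rep1 := Rep_sum rho (fun p => Rep_Z (Phi1 p) (Rep_det (fun j : 'I_N => ell p.1 j))).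
have rep2 := Rep_Z (- (N%:R ^+ n)^-1) (Rep_mulpow n (Rep_det del)).
pose G (y : 'I_N -> R) := vdm y * F (Pw y).
have zero : forall x : 'I_N -> R, (forall i, 0 < x i) ->
  \sum_(p <- rho) Phi1 p * \det (\matrix_(i < N, j < N) pZ (x i) (ell p.1 j)) +
  - (N%:R ^+ n)^-1 * ((\sum_(i < N) x i) ^+ n * \det (\matrix_(i < N, j < N) pZ (x i) (del j))) = 0.
  move=> x hx; pose xs := [seq x i | i <- enum 'I_N].
  have szx : size xs = N by rewrite size_map size_enum_ord.
  have hxs : all (fun t => t != 0) xs by apply/allP => t /mapP[i _ ->]; rewrite gt_eqF.
  have nthx (i : 'I_N) : nth 0 xs i = x i by rewrite (nth_map i) ?size_enum_ord // nth_ord_enum.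
  have bi l : size l = N -> nonincreasing l ->
    \det (\matrix_(i < N, j < N) pZ (x i) (ell l j)) = schur_rev xs l * vdm_seq xs.
    move=> hs hni; rewrite -(bialternant_size szx) //; congr (\det _).
    by apply/matrixP => i j; rewrite !mxE nthx.
  have hd : \det (\matrix_(i < N, j < N) pZ (x i) (del j)) = vdm_seq xs.
    rewrite bi ?size_nseq //; last exact: nonincr_nseq.
    by have := schur_rev_nil0 hxs; rewrite szx => ->; rewrite mul1r.
  have hlen : length (List.rev xs) = N by rewrite List.length_rev.
  have hpos : List.Forall (fun t => Rdefinitions.Rlt 0 t) (List.rev xs).
    apply/List.Forall_forall => t /(proj2 (List.in_rev _ _)) ht; apply/RltP.
    have hm : t \in xs by apply: In_mem.
    by case/mapP: hm => i _ ->.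
  have h : \sum_(p <- rho) p.2 * (schur_rev xs p.1 / s1 p.1) = (\sum_(i < N) x i) ^+ n / N%:R ^+ n.
    have hsum : sum_list (List.rev xs) = \sum_(i < N) x i.
      by rewrite rev_involutive_sum big_map big_enum.
    have := hS hlen hpos; rewrite /SGF expectE hsum RdivE !RpowE INRE => <-.
    apply: eq_bigr => p _; rewrite /schur List.rev_involutive repeat_nseq RdivE.
    by [].
  rewrite hd (eq_bigIn (g := fun p => vdm_seq xs * (p.2 * (schur_rev xs p.1 / s1 p.1)))); last first.
    by move=> p /rho_sig [hs hni]; rewrite bi // /Phi1; ring.
  by rewrite -mulr_sumr h; ring.
have := Rep_unique (fun l => G (scaleZ l)) (Rep_D rep1 rep2) zero.
have aG : asym G := asym_vdm F.
have -> : \sum_(s : 'S_N) (-1) ^+ s * iter n (@addboxZ N) (fun l => G (scaleZ l)) (fun i => del (s i)) =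
   N%:R ^+ n * (N`!%:R * iter n (@addbox R N) G (@y0 R N)).
  rewrite -(sum_asym _ (asym_iter n aG)) mulr_sumr; apply: eq_bigr => s _.
  by rewrite addboxZ_scale // mulrCA -ycoord_nseq0.
have N0 : (N%:R : R) ^+ n != 0 by rewrite expf_neq0 // pnatr_eq0 -lt0n.
rewrite mulNr mulKf // => /eqP; rewrite subr_eq0 => /eqP hmain.
have f0 : (N`!%:R : R) != 0 by rewrite pnatr_eq0 -lt0n fact_gt0.
rewrite /chainE -/G; apply: (mulfI f0); rewrite mulrA -hmain expectE mulr_sumr mulr_suml.
apply: eq_bigIn => p hp; have [hs hni] := rho_sig hp.
have -> : \sum_(s : 'S_N) (-1) ^+ s * G (scaleZ (fun i => ell p.1 (s i))) = N`!%:R * G (ycoord p.1).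
  by rewrite -(sum_asym _ aG).
have v0 := vdm_neq0 (ycoord_inj hN hs hni).
have vy0 : vdm (@y0 R N) != 0 by apply: contra_eq_neq K1 => ->; rewrite mulr0 eq_sym oner_eq0.
rewrite /Phi1 /s1 hK // /G -/(ycoord p.1).
have -> : K = (vdm (@y0 R N))^-1 by apply: (mulIf vy0); rewrite K1 mulVf.
rewrite invfM invrK; set v := vdm (ycoord _) in v0 *; set w := vdm _ in vy0 *.
by field; rewrite v0 vy0.
Qed.

Lemma pkE k l : size l = N -> pk N k l = N%:R ^+ k.+1 * Pw (@ycoord N l) k.
Proof.
move=> hs; rewrite /pk sum_mapE.
have H m t : \sum_(p <- List.combine t (List.seq m (size t))) (IZR (p.1 +z ZN N -z ZN p.2)) ^+ k =
   \sum_(j < size t) IZR (nth z0 t j +z ZN N -z ZN (m + j)) ^+ k.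
  elim: t m => [|a t IH] m; first by rewrite big_nil big_ord0.
  rewrite [List.combine _ _]/= big_cons IH big_ord_recl /= addn0; congr (_ + _).
  by apply: eq_bigr => j _; have -> : (m + bump 0 j)%N = (m + j).+1 by rewrite /bump /=; lia.
rewrite (eq_bigr (fun p => (IZR (p.1 +z ZN N -z ZN p.2)) ^+ k)); last by move=> p _; rewrite RpowE.
rewrite -{1}hs H hs /Pw mulrA exprS -(mulrA N%:R) [N%:R ^+ k * _]mulrC mulrA Neps // mul1r mulr_sumr.
apply: eq_bigr => j _; rewrite /ycoord -exprMn mulrA Neps // mul1r /ell hs.
by congr (IZR _ ^+ k); have := ltn_ord j; lia.
Qed.

Lemma expect_pk k : expect rho (pk N k) = N%:R ^+ k.+1 * beta (@chainE R) k N n.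
Proof.
rewrite /beta -expect_chain !expectE mulr_sumr; apply: eq_bigIn => p hp.
by rewrite pkE ?(rho_sig hp).1 // mulrCA.
Qed.

Lemma joint_moment_mom ks : joint_moment rho N ks = mom (@chainE R) ks N n.
Proof.
rewrite /joint_moment /mom -expect_chain !expectE; apply: eq_bigIn => p hp.
congr (_ * _); rewrite /mon; elim: ks => [|k ks IH]; first by rewrite big_nil.
rewrite big_cons -IH /= -/(prod_list _); congr (_ * _).
rewrite /Xk expect_pk pkE ?(rho_sig hp).1 // RdivE RminusE RpowE INRE /fluct.
have N0 : (N%:R : R) ^+ k != 0 by rewrite expf_neq0 // pnatr_eq0 -lt0n.
by rewrite exprS; field.
Qed.

End Expectation.

(** * Limits *)

Definition covR (c : R) (k l : nat) : R := (Cov R k l).[c].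

Lemma contract_horner (g : nat -> {poly R}) W t (c : R) : (contract g W t).[c] =
  \sum_(j < size t) (g (nth 0%N t j)).[c] * (W (remove_at j t)).[c].
Proof.
elim: t W => [|l t IH] W; first by rewrite /= horner0 big_ord0.
by rewrite [contract _ _ _]/= hornerD hornerM IH big_ord_recl.
Qed.

Lemma wick_f_horner c n s : wick_f (covR c) n s = (wickP_rec R n s).[c].
Proof.
elim: n s => [|n IH] [|k t]; rewrite ?hornerC //.
rewrite [LHS]/= sum_mapE sum_Lseq [wickP_rec _ _ _]/= contract_horner; apply: eq_bigr => j _.
have e i : List.nth i t O = nth 0%N t i by elim: t i {j} => [|a t IHt] [|i] //=.
by rewrite -IH e.
Qed.

Lemma wick_horner c ks : wick (covR c) ks = (wickP R ks).[c].
Proof. exact: wick_f_horner. Qed.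

Section Limits.
Variables (c : R) (hc : 0 < c).

Lemma nfloor_bounds N : (nfloor c N)%:R <= c * N%:R ^+ 2 < (nfloor c N)%:R + 1.
Proof.
set x := c * N%:R ^+ 2.
have x0 : 0 <= x by apply: mulr_ge0; [apply: ltW | apply: exprn_ge0].
have ex : Rdefinitions.Rmult c (Rpow_def.pow (Raxioms.INR N) 2) = x by rewrite RpowE INRE.
have [/RleP h1 /RltP h2] := R_Ifp.base_Int_part x.
have {}h2 : x < Rdefinitions.IZR (R_Ifp.Int_part x) + 1.
  have : (-1 : R) < Rdefinitions.IZR (R_Ifp.Int_part x) - x by exact: h2.
  by rewrite ltrBrDr => h3; rewrite -subr_gt0; move: h3; rewrite -subr_gt0; lra.
have i0 : BinInt.Z.le BinNums.Z0 (R_Ifp.Int_part x).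
  apply: RIneq.le_IZR; apply/RleP.
  rewrite leNgt; apply/negP => hneg.
  have : Rdefinitions.IZR (R_Ifp.Int_part x) <= -1.
    by apply/RleP; apply: (RIneq.IZR_le _ (BinNums.Zneg BinNums.xH)); have /RltP/RIneq.lt_IZR := hneg; lia.
  by move=> h3; move: h2 x0 h3; lra.
have e : (nfloor c N)%:R = Rdefinitions.IZR (R_Ifp.Int_part x).
  by rewrite /nfloor ex -IZR_ZN Znat.Z2Nat.id.
by rewrite e h1 h2.
Qed.

(** The time floor(c N^2) / N^2 differs from c by at most N^-2, so Taylor's formula keeps the rate
    1/N. *)
Lemma approx_at_floor g (G : {poly R}) : approx c g G ->
  exists2 K, 0 <= K & forall N, (0 < N)%N -> `|g N (nfloor c N) - G.[c]| <= K * eps N.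
Proof.
move=> [K K0 hK]; have c0 := ltW hc.
have [T T0 hT] := poly_taylor c0 G; have [M M0 hM] := poly_bounded c0 G^`().
exists (K + (T + M)); first by rewrite !addr_ge0.
move=> N hN; have /andP[b1 b2] := nfloor_bounds N.
have dm : dom c N (nfloor c N) by rewrite /dom hN.
have /andP[t0 tc] := tm_itv dm.
have e0 := eps_ge0 R N; have e1 := eps_le1 R N; have Ne := Neps R hN.
set t := tm R N (nfloor c N) in t0 tc *.
have ht : c - t <= eps N ^+ 2.
  have : (c * N%:R ^+ 2) * eps N ^+ 2 <= ((nfloor c N)%:R + 1) * eps N ^+ 2.
    by rewrite ler_wpM2r ?exprn_ge0 // ltW.
  by rewrite -mulrA -exprMn Ne expr1n mulr1 mulrDl mul1r /t /tm lerBlDl.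
have h0 : 0 <= c - t by rewrite subr_ge0.
have := hT t (c - t) t0 h0; rewrite addrC subrK => /(_ (lexx _)) hTx.
have hMx := hM t; rewrite t0 tc in hMx; have {}hMx := hMx isT.
have hKx := hK _ _ dm; rewrite -/t in hKx.
set h := c - t in ht h0 hTx.
have he : h <= eps N by apply: (le_trans ht); rewrite expr2 ler_piMl.
have he2 : h ^+ 2 <= eps N.
  apply: (@le_trans _ _ h) => //; rewrite expr2 ler_piMl //; exact: le_trans he e1.
have b3 : `|G.[c] - G.[t]| <= (T + M) * eps N.
  rewrite -(subrK (h * G^`().[t]) (G.[c] - G.[t])); apply: (le_trans (ler_normD _ _)).
  rewrite [X in _ <= X]mulrDl; apply: lerD; first by apply: (le_trans hTx); rewrite ler_wpM2l.
  by rewrite normrM ger0_norm // mulrC ler_pM.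
rewrite (_ : _ - _ = (g N (nfloor c N) - G.[t]) - (G.[c] - G.[t])); last by ring.
by apply: (le_trans (ler_normB _ _)); rewrite [X in _ <= X]mulrDl; apply: lerD.
Qed.

Lemma Un_cv_of_rate (u : nat -> R) l K : 0 <= K ->
  (forall N, (0 < N)%N -> `|u N - l| <= K * eps N) -> Rseries.Un_cv u l.
Proof.
move=> K0 h e /RltP he.
have [m hm] : exists m : nat, K / e < m%:R.
  have [/RltP h1 _] := Raxioms.archimed (K / e).
  exists (BinInt.Z.to_nat (Rdefinitions.up (K / e))); apply: (lt_le_trans h1).
  rewrite -IZR_ZN; apply/RleP; apply: RIneq.IZR_le; lia.
exists m.+1 => N hN; rewrite RdistE; apply/RltP.
have hN0 : (0 < N)%N by lia.
apply: (le_lt_trans (h N hN0)); rewrite /invn ltr_pdivrMr ?ltr0n //.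
rewrite mulrC -ltr_pdivrMr //; apply: (lt_le_trans hm).
by rewrite ler_nat; lia.
Qed.

Variables (rho : nat -> fmeasure).
Hypothesis hrho : forall N : nat, (0 < N)%N ->
  is_prob_GT N (rho N) /\ has_SGF_tensor_power N (nfloor c N) (rho N).

Lemma joint_moment_cv ks : pos ks -> Rseries.Un_cv (fun N => joint_moment (rho N) N ks) (wick (covR c) ks).
Proof.
move=> hp; have c0 := ltW hc.
have [K K0 hK] := approx_at_floor (moments_limit c0 (chainE_chain R) hp).
apply: (Un_cv_of_rate K0) => N hN; have [h1 h2] := hrho hN.
by rewrite (joint_moment_mom hN h1 h2) wick_horner; apply: hK.
Qed.

Lemma cov_joint_moment N k1 k2 : (0 < N)%N ->
  Rdefinitions.Rdiv (cov (rho N) (pk N k1) (pk N k2)) (Rpow_def.pow (Raxioms.INR N) (k1 + k2)) =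
  joint_moment (rho N) N [:: k1; k2].
Proof.
move=> hN; have [[_ h1] _] := hrho hN.
rewrite sum_mapE in h1.
have N0 : (N%:R : R) != 0 by rewrite pnatr_eq0 -lt0n.
rewrite /joint_moment expectE /cov; set e1 := expect _ (pk N k1); set e2 := expect _ (pk N k2).
rewrite RdivE RminusE RmultE RpowE INRE.
rewrite (eq_bigr (fun p => (p.2 * (pk N k1 p.1 * pk N k2 p.1) - e2 * (p.2 * pk N k1 p.1)
   - e1 * (p.2 * pk N k2 p.1) + e1 * e2 * p.2) / N%:R ^+ (k1 + k2))); last first.
  move=> p _; rewrite /= /Xk -/e1 -/e2 !RdivE !RminusE !RpowE INRE exprD.
  have n1 : (N%:R : R) ^+ k1 != 0 by rewrite expf_neq0.
  have n2 : (N%:R : R) ^+ k2 != 0 by rewrite expf_neq0.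
  rewrite !RmultE -[Rdefinitions.IZR (BinNums.Zpos _)]/(1 : R) mulr1; field; by rewrite n1 n2.
rewrite -mulr_suml; congr (_ / _).
rewrite big_split /= !sumrB -!mulr_sumr h1 -[\sum_(i <- _) _ * pk N k1 _]expectE -[\sum_(i <- _) _ * pk N k2 _]expectE
  -/e1 -/e2 mulr1 expectE [e1 * e2]mulrC subrK.
by [].
Qed.

Lemma cov_cv k1 k2 : (0 < k1)%N -> (0 < k2)%N ->
  Rseries.Un_cv (fun N => Rdefinitions.Rdiv (cov (rho N) (pk N k1) (pk N k2)) (Rpow_def.pow (Raxioms.INR N) (k1 + k2)))
    (covR c k1 k2).
Proof.
move=> h1 h2; have hp : pos [:: k1; k2] by rewrite /pos /= h1 h2.
have := joint_moment_cv hp.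
have -> : wick (covR c) [:: k1; k2] = covR c k1 k2.
  by rewrite /wick /= !RplusE !RmultE mulr1 addr0.
move=> H e he; have [n0 hn0] := H e he; exists n0.+1 => N hN.
rewrite cov_joint_moment; last by lia.
by apply: hn0; lia.
Qed.

End Limits.

(** * The contour integral is [Cov] at t = c *)

Lemma laurent_coefS c k s : lc c k.+1 s = lc c k (s +z z1) + (1 + c) * lc c k s + c * lc c k (s -z z1) :> R.
Proof. by []. Qed.

Lemma laurent_coef0 c s : lc c 0 s = if BinInt.Z.eqb s z0 then 1 else 0.
Proof. by []. Qed.

Lemma laurent_coef_low c k s : BinInt.Z.lt s (BinInt.Z.opp (ZN k)) -> lc c k s = 0.
Proof.
elim: k s => [|k IH] s hs.
  by rewrite /= (_ : BinInt.Z.eqb s z0 = false) //; apply/BinInt.Z.eqb_neq; lia.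
by rewrite laurent_coefS !IH ?mulr0 ?addr0 //; lia.
Qed.

Lemma zf_expS k : zf R ^+ k.+1 = zf R ^+ k + ((1 + 'X)%:P * (zf R ^+ k * 'X) + ('X)%:P * (zf R ^+ k * 'X * 'X)).
Proof. by rewrite exprS {1}/zf /tC polyCD polyC1; ring. Qed.

Lemma laurent_coef_zf (c : R) k i : lc c k (ZN i -z ZN k) = ((zf R ^+ k)`_i).[c].
Proof.
elim: k i => [|k IH] i.
  rewrite expr0 coef1 /=; case: i => [|i] /=; rewrite ?hornerC //.
rewrite laurent_coefS zf_expS !coefD !coefCM !coefMX !hornerD !hornerM hornerD hornerX hornerC.
have -> : (ZN i -z ZN k.+1 +z z1) = (ZN i -z ZN k) by lia.
rewrite IH -addrA; congr (_ + _).
have hA : lc c k (ZN i -z ZN k.+1) = if i is j.+1 then ((zf R ^+ k)`_j).[c] else 0.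
  case: i => [|i]; first by apply: laurent_coef_low; lia.
  by rewrite -IH; congr lc; lia.
have hB : lc c k (ZN i -z ZN k.+1 -z z1) = if i is j.+2 then ((zf R ^+ k)`_j).[c] else 0.
  case: i {hA} => [|[|i]]; first by apply: laurent_coef_low; lia.
    by apply: laurent_coef_low; lia.
  by rewrite -IH; congr lc; lia.
rewrite hA hB; case: i {hA hB} => [|[|i]] //=; rewrite ?horner0 ?mulr0 ?addr0 //.
Qed.

(** The sum stops at k1 because f^k1 has no power below z^(-k1). At s = 0 it is the sum in [Cov]. *)
Lemma shiftF_outer (c : R) k1 k s :
  fst (Contour.shiftF c k (Contour.outer_seq c k1) s) =
  \sum_(m < k1) m.+1%:R * (lc c k1 (BinInt.Z.opp (ZN m.+1)) * lc c k (ZN m.+1 -z s)).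
Proof.
elim: k s => [|k IH] s; last first.
  transitivity (fst (Contour.shiftF c k (Contour.outer_seq c k1) (s -z z1))
    + (1 + c) * fst (Contour.shiftF c k (Contour.outer_seq c k1) s)
    + c * fst (Contour.shiftF c k (Contour.outer_seq c k1) (s +z z1))).
    have hs t : snd (Contour.shiftF c k (Contour.outer_seq c k1) t) = 0 by apply: Contour.snd_shiftF.
    by rewrite /= !RplusE !RminusE !RmultE !mul0r !subr0.
  rewrite !IH !mulr_sumr -!big_split; apply: eq_bigr => m _; set M := ZN m.+1.
  have -> : (M -z (s -z z1)) = (M -z s +z z1) by lia.
  have -> : (M -z (s +z z1)) = (M -z s -z z1) by lia.
  by rewrite laurent_coefS /=; ring.
rewrite /Contour.shiftF /Contour.outer_seq [LHS]/=.
case: (BinInt.Z.leb_spec z1 s) => hs; last first.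
  rewrite big1 // => m _; rewrite laurent_coef0 (_ : BinInt.Z.eqb _ _ = false) ?mulr0 //.
  by apply/BinInt.Z.eqb_neq; lia.
have [m0 ->] : exists m0, s = ZN m0.+1 by exists (BinInt.Z.to_nat s).-1; lia.
case: (ltnP m0 k1) => hk; last first.
  rewrite laurent_coef_low ?RmultE ?mulr0; last by lia.
  rewrite big1 // => m _; have hm := ltn_ord m; rewrite laurent_coef0 (_ : BinInt.Z.eqb _ _ = false) ?mulr0 //.
  by apply/BinInt.Z.eqb_neq; lia.
rewrite (bigD1 (Ordinal hk)) // big1 ?addr0.
  have e0 : BinInt.Z.eqb (ZN m0.+1 -z ZN m0.+1) z0 = true by apply/BinInt.Z.eqb_eq; lia.
  by rewrite [Ordinal hk : nat]/= laurent_coef0 e0 mulr1 [RHS]addr0 IZR_ZN.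
move=> m /eqP hm; have {}hm : nat_of_ord m <> m0 by move=> e; apply: hm; apply: val_inj.
by rewrite laurent_coef0 (_ : BinInt.Z.eqb _ _ = false) ?mulr0 //; apply/BinInt.Z.eqb_neq; lia.
Qed.

Lemma contour_limit_cov (c : R) k1 k2 : (0 < k1)%N -> (0 < k2)%N -> Contour.contour_limit c k1 k2 = covR c k1 k2.
Proof.
case: k1 => // k1 _; case: k2 => // k2 _.
rewrite /Contour.contour_limit shiftF_outer /covR /Cov RminusE !RmultE hornerD hornerN.
have hF k : lc c k.+1 (BinNums.Zneg BinNums.xH) = (resF R k.+1).[c].
  by rewrite /resF -laurent_coef_zf; congr lc; lia.
rewrite !hF !hornerM hornerX; congr (_ - _); last by ring.
rewrite horner_sum; apply: eq_bigr => m _; have hm := ltn_ord m.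
rewrite !hornerM -polyC_natr hornerC -!laurent_coef_zf.
by congr (_ * (_ * _)); congr lc; lia.
Qed.

Theorem power_sums_gaussian (c : R) (hc : Rdefinitions.Rlt 0 c) (rho : nat -> fmeasure)
  (hrho : forall N : nat, Peano.le 1 N ->
     is_prob_GT N (rho N) /\ has_SGF_tensor_power N (nfloor c N) (rho N)) :
  (forall ks : seq nat, List.Forall (fun k => Peano.le 1 k) ks ->
     Rseries.Un_cv (fun N => joint_moment (rho N) N ks) (wick (covR c) ks)) /\
  (forall k1 k2 : nat, Peano.le 1 k1 -> Peano.le 1 k2 ->
     Rseries.Un_cv (fun N => Rdefinitions.Rdiv (cov (rho N) (pk N k1) (pk N k2))
        (Rpow_def.pow (Raxioms.INR N) (Nat.add k1 k2))) (covR c k1 k2)) /\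
  (forall e : R, Rdefinitions.Rlt 0 e -> forall k1 k2 : nat, Peano.le 1 k1 -> Peano.le 1 k2 ->
     contour_value c k1 k2 e (covR c k1 k2)).
Proof.
have hc' : 0 < c by apply/RltP.
have hrho' : forall N : nat, (0 < N)%N ->
  is_prob_GT N (rho N) /\ has_SGF_tensor_power N (nfloor c N) (rho N).
  by move=> N /ssrnat.leP hN; apply: hrho.
split; last split.
- move=> ks hks; apply: joint_moment_cv => //.
  by elim: ks hks => // k ks IH h; inversion h; rewrite /pos /=; apply/andP; split; [apply/ssrnat.leP | apply: IH].
- by move=> k1 k2 /ssrnat.leP h1 /ssrnat.leP h2; apply: cov_cv.
move=> e he k1 k2 /ssrnat.leP h1 /ssrnat.leP h2.
by rewrite -contour_limit_cov //; apply: Contour.contour_value_limit.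
Qed.

End Moments.

From Stdlib Require Import Reals ZArith List.
Import ListNotations.
Open Scope R_scope.

Theorem mainTheorem5 (c : R) (hc : 0 < c) (rho : nat -> fmeasure)
  (hrho : forall N : nat, (1 <= N)%nat ->
     is_prob_GT N (rho N) /\ has_SGF_tensor_power N (nfloor c N) (rho N)) :
  exists C : nat -> nat -> R,
    (forall ks : list nat, Forall (fun k => (1 <= k)%nat) ks ->
       Un_cv (fun N => joint_moment (rho N) N ks) (wick C ks)) /\
    (forall k1 k2 : nat, (1 <= k1)%nat -> (1 <= k2)%nat ->
       Un_cv (fun N => cov (rho N) (pk N k1) (pk N k2) / INR N ^ (k1 + k2)) (C k1 k2)) /\
    (exists eps0 : R, 0 < eps0 /\
       forall eps : R, 0 < eps < eps0 ->
       forall k1 k2 : nat, (1 <= k1)%nat -> (1 <= k2)%nat ->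
         contour_value c k1 k2 eps (C k1 k2)).
Proof.
  destruct (Moments.power_sums_gaussian hc hrho) as [h1 [h2 h3]].
  exists (Moments.covR c); split; [exact h1|split; [exact h2|]].
  (* The bound 1 is an arbitrary choice: the value is the same for every radius, since z = 0 is the
     only pole of f and |w| = 2 |z|. *)
  exists 1; split; [exact Rlt_0_1|].
  intros eps [heps _] k1 k2; now apply h3.
Qed.
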